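(* Let $\pi$ be a probability measure on $\Phi_L$ with $\int_{\Phi_L}V_0^\varphi\,\pi(d\varphi)<\infty$ a.s., and let $\bar V_t^{(2)}=\int_{\Phi_L}V_t^\varphi\,\pi(d\varphi)$, $t\in\mathbb R$, be the strictly stationary supCOGARCH 2 process. (a) Suppose that $\pi(\Phi_L^{(1)})=1$. Then for all $t\ge0$ $$\mathbb E[\bar V_t^{(2)}]=\int_{\Phi_L}\mathbb E[V_0^\varphi]\,\pi(d\varphi)=\beta\int_{\Phi_L}\frac{1}{\eta-\varphi\mathbb E[S_1]}\,\pi(d\varphi).$$ (b) Suppose that $\pi(\Phi_L^{(2)})=1$. Then for $t\in\mathbb R$ and $h\ge0$ $$\mathbb E[(\bar V_t^{(2)})^2]=\int_{\Phi_L}\int_{\Phi_L}\mathbb E[V_0^\varphi V_0^{\tilde\varphi}]\,\pi(d\varphi)\,\pi(d\tilde\varphi),$$ $$\operatorname{Var}[\bar V_t^{(2)}]=\int_{\Phi_L}\int_{\Phi_L}\operatorname{Cov}[V_0^\varphi,V_0^{\tilde\varphi}]\,\pi(d\varphi)\,\pi(d\tilde\varphi),$$ $$\operatorname{Cov}[\bar V_t^{(2)},\bar V_{t+h}^{(2)}]=\int_{\Phi_L}\int_{\Phi_L}\operatorname{Cov}[V_0^\varphi,V_h^{\tilde\varphi}]\,\pi(d\varphi)\,\pi(d\tilde\varphi),$$ where $$\mathbb E[V_0^\varphi V_0^{\tilde\varphi}]=\frac{\beta^2((\varphi+\tilde\varphi)\mathbb E[S_1]-2\eta)}{(\varphi\mathbb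 E[S_1]-\eta)(\tilde\varphi\mathbb E[S_1]-\eta)((\varphi+\tilde\varphi)\mathbb E[S_1]+\varphi\tilde\varphi\operatorname{Var}[S_1]-2\eta)},$$ $$\operatorname{Cov}[V_0^\varphi,V_h^{\tilde\varphi}]=e^{h(\tilde\varphi\mathbb E[S_1]-\eta)}\frac{\beta^2\varphi\tilde\varphi\operatorname{Var}[S_1]}{(\varphi\mathbb E[S_1]-\eta)(\tilde\varphi\mathbb E[S_1]-\eta)(2\eta-(\varphi+\tilde\varphi)\mathbb E[S_1]-\varphi\tilde\varphi\operatorname{Var}[S_1])}.$$ The moments of $\bar V^{(2)}$ in (a) and (b) may be infinite.
   Context: Constants $\beta>0$, $\eta>0$ are fixed. $L=(L_t)_{t\in\mathbb R}$ is a two-sided real-valued Lévy process with Lévy measure $\nu_L$, and $S=(S_t)_{t\in\mathbb R}$ is the two-sided driftless subordinator $S_t=\sum_{0<s\le t}(\Delta L_s)^2$ for $t\ge0$, $S_t=-\sum_{t<s\le0}(\Delta L_s)^2$ for $t\le0$, with Lévy measure $\nu_S$ (image of $\nu_L$ under $y\mapsto y^2$). For $\varphi\ge0$, $$X_t^\varphi=\eta t-\sum_{0<s\le t}\log(1+\varphi\Delta S_s)\ (t\ge0),\qquad X_t^\varphi=\eta t+\sum_{t<s\le0}\log(1+\varphi\Delta S_s)\ (t<0).$$ $\Phi_L:=\{\varphi\ge0:\int_{(0,\infty)}\log(1+\varphi y)\,\nu_S(dy)<\eta\}$. For $\varphi\in\Phi_L$ the two-sided (stationary) COGARCH process is $V_t^\varphi=\beta\int_{(-\infty,t]}e^{-(X_t^\varphi-X_s^\varphi)}\,ds$,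 $t\in\mathbb R$; all $V^\varphi$ are driven by the same $S$. For $\kappa>0$: $\Phi_L^{(\kappa)}:=[0,\varphi_{\max}^{(\kappa)})$ with $\varphi_{\max}^{(\kappa)}=\sup\{\varphi:\mathbb E[(V_0^\varphi)^\kappa]<\infty\}$. *)

(* Defs.v *)
From HB Require Import structures.
From mathcomp Require Import all_boot all_order all_algebra.
From mathcomp Require Import all_classical all_reals all_analysis.

Set Implicit Arguments.
Unset Strict Implicit.
Unset Printing Implicit Defensive.

Import Order.TTheory GRing.Theory Num.Theory.
Import numFieldNormedType.Exports.

Local Open Scope classical_set_scope.
Local Open Scope ring_scope.

Definition cadlag (R : realType) (f : R -> R) : Prop :=
  forall t, f x @[x --> t^'+] --> f t /\ cvg (f x @[x --> t^'-]).

Definition jump (R : realType) (f : R -> R) (t : R) : R :=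
  f t - lim (f x @[x --> t^'-]).

(* Since some of the B i may be setT, the product rule for the whole finite
   family contains the product rule for all its subfamilies. *)
Definition independent_rvs d (T : measurableType d) (R : realType)
    (P : probability T R) (n : nat) (X : 'I_n -> T -> R) : Prop :=
  forall B : 'I_n -> set R, (forall i, measurable (B i)) ->
    P (\bigcap_(i in [set: 'I_n]) (X i @^-1` B i)) =
    (\prod_(i < n) P (X i @^-1` B i))%E.

(* The index set is the whole real line (two-sided process). *)
Record levy_process d (T : measurableType d) (R : realType)
    (P : probability T R) (L : R -> {RV P >-> R}) : Prop := {
  levy_start : {ae P, forall w, L 0 w = 0} ;
  levy_independent : forall (n : nat) (t : nat -> R),
    {homo t : i j / (i <= j)%N >-> i <= j} ->
    independent_rvs P (fun (i : 'I_n) w => L (t i.+1) w - L (t i) w) ;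
  levy_stationary : forall (s t h : R) (B : set R), s <= t -> measurable B ->
    P [set w | B (L (t + h) w - L (s + h) w)] =
    P [set w | B (L t w - L s w)] ;
  levy_stochastic_continuity : forall t e : R, 0 < e ->
    P [set w | e < `|L s w - L t w|] @[s --> t] --> 0%E ;
  levy_cadlag : {ae P, forall w, cadlag (fun t => L t w)} }.

(* nu is the Levy measure of L: nu A is the expected number of jumps with size
   in A per unit of time, and nu has no atom at 0. *)
Definition is_levy_measure d (T : measurableType d) (R : realType)
    (P : probability T R) (L : R -> {RV P >-> R})
    (nu : {measure set (measurableTypeR R) -> \bar R}) : Prop :=
  nu [set 0] = 0%E /\
  forall A : set (measurableTypeR R), measurable A -> ~ A 0 ->
    nu A = (\int[P]_w
      counting [set s : R | (0 < s <= 1)%R /\ A (jump (fun t => L t w) s)])%E.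

Definition squared_jump_measure (R : realType)
    (nu : {measure set (measurableTypeR R) -> \bar R}) :
    set (measurableTypeR R) -> \bar R :=
  pushforward nu (fun y : measurableTypeR R => (y ^+ 2 : measurableTypeR R)).

(* The sums of nonnegative terms below are taken in [0, +oo]; they are almost
   surely finite, so that fine only changes the processes on a null set. *)
Definition subordinator (T : Type) (R : realType) (L : R -> T -> R)
    (t : R) (w : T) : R :=
  if 0 <= t
  then fine (\esum_(s in [set s : R | (0 < s <= t)%R])
         (jump (fun u => L u w) s ^+ 2)%:E)
  else - fine (\esum_(s in [set s : R | (t < s <= 0)%R])
         (jump (fun u => L u w) s ^+ 2)%:E).

Definition cogarch_exponent (T : Type) (R : realType) (eta : R)
    (S : R -> T -> R) (phi t : R) (w : T) : R :=
  if 0 <= t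
  then eta * t - fine (\esum_(s in [set s : R | (0 < s <= t)%R])
         (ln (1 + phi * jump (fun u => S u w) s))%:E)
  else eta * t + fine (\esum_(s in [set s : R | (t < s <= 0)%R])
         (ln (1 + phi * jump (fun u => S u w) s))%:E).

(* Extended-valued: V^phi_t is almost surely finite for phi in Phi_L. *)
Definition cogarch (T : Type) (R : realType) (beta eta : R)
    (S : R -> T -> R) (phi t : R) (w : T) : \bar R :=
  let X := cogarch_exponent eta S phi in
  (beta%:E * \int[lebesgue_measure]_(s in [set s : R | (s <= t)%R])
    (expR (- (X t w - X s w)))%:E)%E.

(* The set Phi_L of the parameters for which a stationary COGARCH process
   exists; nuS is the Levy measure of the subordinator. *)
Definition cogarch_set (R : realType) (eta : R)
    (nuS : set (measurableTypeR R) -> \bar R) : set (measurableTypeR R) :=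
  [set phi : R | 0 <= phi /\
    (\int[nuS]_(y in [set y : R | (0 < y)%R]) (ln (1 + phi * y))%:E < eta%:E)%E].

(* Phi_L^(kappa) = [0, phi_max^(kappa)[; the supremum may be +oo, and V^phi is
   only defined for phi in Phi_L. *)
Definition cogarch_moment_set d (T : measurableType d) (R : realType)
    (P : probability T R) (beta eta : R) (S : R -> T -> R)
    (nuS : set (measurableTypeR R) -> \bar R) (kappa : R) :
    set (measurableTypeR R) :=
  [set phi : R | 0 <= phi /\
    (phi%:E < ereal_sup [set psi%:E | psi in [set psi : R |
       cogarch_set eta nuS psi /\
       \int[P]_w poweR (cogarch beta eta S psi 0 w) kappa < +oo]])%E].

Definition supcogarch (T : Type) (R : realType) (beta eta : R)
    (S : R -> T -> R) (Phi : set (measurableTypeR R))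
    (mu : set (measurableTypeR R) -> \bar R) (t : R) (w : T) : \bar R :=
  (\int[mu]_(phi in Phi) cogarch beta eta S phi t w)%E.

(* Main.v *)
(* V^phi_t is beta times the integral over s <= t of exp(- eta (t - s) + J(s, t)),
   where J(s, t) is the sum of log (1 + phi x) over the squared jumps x of L in
   ]s, t]. A sum over jumps of a function vanishing near 0 is a limit of sums over
   the increments of L along finer and finer grids; hence jump sums are jointly
   measurable and inherit independence and stationarity of the increments. On a
   grid, exp (sum of log (1 + g)) is a limit of products of 1 + (cell sums of g),
   so its expectation over ]s, t] is exp ((t - s) times the intensity of g). For
   g = phi x the intensity is phi E[S_1]; for two parameters,
   (1 + phi x) (1 + psi x) = 1 + (phi + psi) x + phi psi x^2
   gives the intensity (phi + psi) E[S_1] + phi psi Var[S_1]. Tonelli's theorem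
   turns this into the first and mixed second moments of V, and the finiteness of
   a moment at some psi > phi keeps the intensities at phi below eta and 2 eta.
   Integrating over the parameters is Tonelli's theorem again; almost sure
   finiteness of the superposition at t > 0 follows from that at 0 through
   V_t <= exp (J(0, t)) (V_0 + beta t), and no integrability of the squared
   superposition is needed because the covariances are nonnegative. *)
Require Import Defs.
From HB Require Import structures.
From mathcomp Require Import all_boot all_order all_algebra finmap.
From mathcomp Require Import all_classical all_reals all_analysis.
From mathcomp Require Import measurable_realfun ring lra zify.

Set Implicit Arguments.
Unset Strict Implicit.
Unset Printing Implicit Defensive.

Import Order.TTheory GRing.Theory Num.Theory.
Import numFieldNormedType.Exports.

Local Open Scope classical_set_scope.
Local Open Scope ring_scope.

(** * Integrals up to null sets and monotone approximation *)

(** Independence is given for finitely many increments, while jump sums may be infinite, so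
    independence and stationarity pass through Laplace transforms [expeR (- J)]: these lie in
    [0, 1], are limits of functions of increments and make sense for infinite sums. The limit of n
    (1 - exp (- x / n)) then recovers the unbounded sums, and factors of the form 1 + J keep
    products away from 0 times +oo. Grids with n + 1 cells are not nested, so monotone convergence
    is replaced by Fatou's lemma for approximants lying below their limit. The subordinator is a
    genuine sum only when the squared jumps are summable. A zero-one law decides this, and a scale
    [eps], equal to 1 or 0, covers both alternatives with the same formulas. In (b) the covariance
    subtracts a product of means, which must be finite although x m may approach eta on the
    parameter set. The second moment condition prevents this: it bounds 1 / (eta - x m) by a
    constant independent of x. *)

Section integral_arbitrary_functions.
Local Open Scope ereal_scope.
Context d (T : measurableType d) (R : realType).
Implicit Types (D N : set T) (f g : T -> \bar R).

Import HBNNSimple.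

(** Both negative parts vanish and a simple function below [f] is below [g], so the suprema defining
    the integrals compare. Here [mu] is only a set function, which lets the lemma apply to the image
    of the Levy measure under squaring. *)
Lemma le_integral_of_le (mu : set T -> \bar R) D f g :
  (forall x, D x -> 0 <= f x) -> (forall x, D x -> f x <= g x) ->
  \int[mu]_(x in D) f x <= \int[mu]_(x in D) g x.
Proof.
move=> f0 fg.
have g0 x : D x -> 0 <= g x by move=> Dx; exact: le_trans (f0 _ Dx) (fg _ Dx).
have nz (h : T -> \bar R) : (forall x, D x -> 0 <= h x) -> (h \_ D)^\- = cst 0.
  move=> h0; apply/funext => x; rewrite funenegE /patch; case: ifPn => [|_].
    by rewrite inE => /h0 hx; apply/max_idPr; rewrite leeNl oppe0.
  by rewrite oppe0 maxxx.
rewrite /integral (nz _ f0) (nz _ g0); apply: leeB => //.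
apply: ge_ereal_sup => _ [h /= hf <-]; apply: ereal_sup_ubound.
exists h => // x; apply: le_trans (hf x) _.
rewrite !funeposE ge_max !le_max lexx orbT andbT /patch.
by case: ifPn => [/set_mem/fg ->|_] //; rewrite lexx.
Qed.

Variable mu : {measure set T -> \bar R}.

(** A simple function below the positive part of [f], set to 0 on [N], keeps its integral and lies
    below the positive part of [g]. *)
Let nnint_null N f g : measurable N -> mu N = 0 ->
  (forall x, 0 <= g x) -> (forall x, ~ N x -> f x = g x) ->
  \int[mu]_x (f^\+ x) <= \int[mu]_x (g^\+ x).
Proof.
move=> mN N0 g0 fg; rewrite !ge0_integralTE//.
apply: ge_ereal_sup => _ [h /= hf <-].
pose h' := proj_nnsfun h (measurableC mN).
rewrite (_ : sintegral mu h = sintegral mu h'); last first.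
  rewrite -!integralT_nnsfun; apply: ge0_ae_eq_integral => //.
  - by apply/measurable_EFinP.
  - by apply/measurable_EFinP.
  - by move=> x _; rewrite lee_fin.
  - by move=> x _; rewrite lee_fin.
  exists N; split => // x /= hx; apply: contrapT => Nx; apply: hx => _.
  by rewrite /= mindicE mem_set ?mulr1.
apply: ereal_sup_ubound; exists h' => // x; rewrite /= mindicE.
have [Nx|Nx] := pselect (N x).
  by rewrite memNset ?mulr0 ?funepos_ge0// => -[].
by rewrite mem_set// mulr1 (le_trans (hf x))// !funeposE fg.
Qed.

(* No measurability is required: the integral of an arbitrary function is a
   difference of suprema over simple functions. *)
Lemma eq_integral_null N D f g : measurable N -> mu N = 0 ->
  (forall x, ~ N x -> D x -> f x = g x) ->
  \int[mu]_(x in D) f x = \int[mu]_(x in D) g x.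
Proof.
move=> mN N0 fg.
have key h k : (forall x, 0 <= h x) -> (forall x, 0 <= k x) ->
    (forall x, ~ N x -> h x = k x) -> \int[mu]_x h x = \int[mu]_x k x.
  move=> h0 k0 hk.
  have E u : (forall x, 0 <= u x) -> \int[mu]_x u x = \int[mu]_x u^\+ x.
    by move=> u0; apply: eq_integral => x _; rewrite funeposE; apply/esym/max_idPl.
  rewrite (E h)// (E k)//; apply/eqP; rewrite eq_le; apply/andP; split.
    exact: nnint_null hk.
  by apply: nnint_null N0 h0 _ => // x /hk.
have fgD x : ~ N x -> (f \_ D) x = (g \_ D) x.
  by move=> Nx; rewrite /patch; case: ifPn => //; rewrite inE; exact: fg.
rewrite [LHS]integralE [RHS]integralE.
have eqD h : (forall x, 0 <= h x) ->
  \int[mu]_(x in D) h x = \int[mu]_x (h \_ D) x.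
  move=> h0; rewrite ge0_integralE// ge0_integralTE// => x.
  by rewrite erestrict_ge0.
congr (_ - _); rewrite eqD// [RHS]eqD//; apply: key => [x|x|x Nx].
- by rewrite erestrict_ge0.
- by rewrite erestrict_ge0.
- by rewrite -!funepos_restrict !funeposE fgD.
- by rewrite erestrict_ge0.
- by rewrite erestrict_ge0.
- by rewrite -!funeneg_restrict !funenegE fgD.
Qed.

End integral_arbitrary_functions.

Section integral_sandwich.
Local Open Scope ereal_scope.
Context d (T : measurableType d) (R : realType).
Variable mu : {measure set T -> \bar R}.

(** Fatou's lemma bounds the limit from below and [f_ n <= f] bounds it from above. The approximants
    may oscillate in [n], as those built on non-nested grids do, and the limit may be +oo. *)
Lemma cvg_integral_below (f_ : (T -> \bar R)^nat) (f : T -> \bar R) :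
  (forall n, measurable_fun setT (f_ n)) -> measurable_fun setT f ->
  (forall n x, 0 <= f_ n x) -> (forall n x, f_ n x <= f x) ->
  (forall x, f_ n x @[n --> \oo] --> f x) ->
  \int[mu]_x f_ n x @[n --> \oo] --> \int[mu]_x f x.
Proof.
move=> mf_ mf f_0 f_f cf.
have f0 x : 0 <= f x by exact: le_trans (f_0 0%N x) (f_f 0%N x).
have le n : \int[mu]_x f_ n x <= \int[mu]_x f x.
  by apply: ge0_le_integral.
have lim_f x : limn_einf (f_ ^~ x) = f x.
  by rewrite is_cvg_limn_einfE ?(cvg_lim _ (cf x))//; apply/cvg_ex; exists (f x).
have fat : \int[mu]_x f x <= limn_einf (fun n => \int[mu]_x f_ n x).
  have := fatou mu measurableT mf_ (fun n x _ => f_0 n x).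
  by under eq_integral do rewrite lim_f.
set a := fun n => \int[mu]_x f_ n x in fat *.
have ea : einfs a n @[n --> \oo] --> \int[mu]_x f x.
  have -> : \int[mu]_x f x = limn_einf a.
    apply/eqP; rewrite eq_le fat /= limn_einf_lim.
    apply: lime_le; first exact: is_cvg_einfs.
    apply: nearW => n; apply: le_trans (le n).
    by apply: ereal_inf_lbound; exists n => //=.
  by rewrite limn_einf_lim; exact: is_cvg_einfs.
apply: (squeeze_cvge _ ea (cvg_cst _)); apply: nearW => n.
by rewrite le andbT; apply: ereal_inf_lbound; exists n => //=.
Qed.

End integral_sandwich.

(** * Sums over the jumps of a cadlag function *)

Section cadlag_oscillation.
Context {R : realType}.
Implicit Types (f : R -> R) (a b e : R).

(** A quantitative form of the fact that a cadlag function has finitely many large jumps on a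
    bounded interval: [s] collects exceptional times and [del] is uniform. An exceptional time at
    the right end of ]x, y] counts and one at the left end does not, just as a jump is charged to a
    half-open cell. *)
Definition small_moves f e a b := exists (s : seq R) (del : R), 0 < del /\
  forall x y, a <= x -> x < y -> y <= b -> y - x < del ->
    (forall u, u \in s -> ~~ (x < u <= y)) -> `|f y - f x| < e.

Lemma small_moves_sub f e a b a' b' : a <= a' -> b' <= b ->
  small_moves f e a b -> small_moves f e a' b'.
Proof.
move=> aa bb [s [del [del0 H]]]; exists s, del; split => // x y ax xy yb.
by apply: H => //; [exact: le_trans ax|exact: le_trans bb].
Qed.

(** The meeting point [c] joins the exceptional times, so that no interval under consideration
    crosses it. *)
Lemma small_moves_cat f e a b c :
  small_moves f e a c -> small_moves f e c b -> small_moves f e a b.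
Proof.
move=> [s [d1 [d10 H1]]] [t [d2 [d20 H2]]].
exists (c :: s ++ t), (Num.min d1 d2); split; first by rewrite lt_min d10.
move=> x y ax xy yb; rewrite lt_min => /andP[yx1 yx2] H.
have [yc|cy] := leP y c.
  by apply: H1 => // u us; apply: H; rewrite inE mem_cat us orbT.
have [xc|cx] := ltP x c.
  by have := H c; rewrite mem_head xc ltW// => /(_ isT).
by apply: H2 => // u us; apply: H; rewrite inE mem_cat us !orbT.
Qed.

Lemma cadlag_right f t e : cadlag f -> 0 < e ->
  exists2 r, 0 < r & forall x, t <= x < t + r -> `|f x - f t| < e.
Proof.
move=> /(_ t)[cf _] e0; move/cvgrPdist_lt : cf => /(_ e e0).
move=> /nbhs_ballP[r /= r0 H]; exists r => // x /andP[].
rewrite le_eqVlt => /predU1P[<- _|tx xr]; first by rewrite subrr normr0.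
rewrite distrC; apply: H => //=; rewrite /ball /=.
by rewrite distrC ger0_norm ?subr_ge0 ?ltW// ltrBlDl.
Qed.

Lemma cadlag_left f t e : cadlag f -> 0 < e ->
  exists2 r, 0 < r & forall x, t - r < x < t ->
    `|f x - lim (f y @[y --> t^'-])| < e.
Proof.
move=> /(_ t)[_ cf] e0; move/cvgrPdist_lt : cf => /(_ e e0).
move=> /nbhs_ballP[r /= r0 H]; exists r => // x /andP[tx xt].
rewrite distrC; apply: H => //=; rewrite /ball /=.
by rewrite ger0_norm ?subr_ge0 ?ltW// ltrBlDl -ltrBlDr.
Qed.

Lemma small_moves_locally f e t : cadlag f -> 0 < e ->
  exists2 r, 0 < r & small_moves f e (t - r) (t + r).
Proof.
move=> cf e0; have e20 : 0 < e / 2 by rewrite divr_gt0.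
have [r1 r10 H1] := cadlag_right t cf e20.
have [r2 r20 H2] := cadlag_left t cf e20.
exists (Num.min r1 r2 / 2); first by rewrite divr_gt0// lt_min r10.
exists [:: t], 1; split => // x y ax xy yb _ /(_ t); rewrite mem_head => /(_ isT).
have r12 : 0 < Num.min r1 r2 by rewrite lt_min r10.
have m1 : Num.min r1 r2 <= r1 by rewrite ge_min lexx.
have m2 : Num.min r1 r2 <= r2 by rewrite ge_min lexx orbT.
rewrite negb_and -leNgt -ltNge => /orP[tx|yt].
  have A : `|f y - f t| < e / 2 by apply: H1; apply/andP; split; lra.
  have B : `|f x - f t| < e / 2 by apply: H1; apply/andP; split; lra.
  have -> : f y - f x = (f y - f t) - (f x - f t) by ring.
  by rewrite (le_lt_trans (ler_normB _ _))//; lra.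
set l := lim _ in H2.
have A : `|f y - l| < e / 2 by apply: H2; apply/andP; split; lra.
have B : `|f x - l| < e / 2 by apply: H2; apply/andP; split; lra.
have -> : f y - f x = (f y - l) - (f x - l) by ring.
by rewrite (le_lt_trans (ler_normB _ _))//; lra.
Qed.

(** A continuation argument: the supremum [c] of the points up to which the property holds has a
    neighbourhood with the property, so the property reaches past [c] unless [c = b]. *)
Lemma cadlag_small_moves f e a b : cadlag f -> 0 < e -> a <= b ->
  small_moves f e a b.
Proof.
move=> cf e0 ab.
pose A := [set x | a <= x <= b /\ small_moves f e a x].
have Aa : A a.
  split; first by rewrite lexx.
  by exists [::], 1; split => // x y ax xy ya; exfalso; lra.
have supA : has_sup A.
  by split; [exists a|exists b => x [/andP[]]].
set c := sup A.
have ac : a <= c by apply: sup_upper_bound.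
have [r r0 Hr] := small_moves_locally c cf e0.
have [x [/andP[ax xb] Ax] xc] := sup_adherent r0 supA.
have xc' : x <= c by apply: sup_upper_bound => //; split => //; rewrite ax.
pose y := Num.min b (c + r).
have Ay : A y.
  split; first by rewrite le_min ab/= ge_min lexx /= andbT; lra.
  apply: small_moves_cat Ax _; apply: small_moves_sub Hr; first exact: ltW.
  by rewrite ge_min lexx orbT.
have yc : y <= c by exact: sup_upper_bound.
have yb : y = b.
  by rewrite /y; apply/min_idPl; move: yc; rewrite /y ge_min => /orP[|]; lra.
by case: Ay => _; rewrite yb.
Qed.

End cadlag_oscillation.

Lemma near_all_seq (I : eqType) (U : Type) (F : set_system U) {FF : Filter F}
    (s : seq I) (P : I -> U -> Prop) :
  (forall i, i \in s -> \forall x \near F, P i x) ->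
  \forall x \near F, forall i, i \in s -> P i x.
Proof.
elim: s => [|i s IH] H; first by apply: nearW.
have Hi := H i (mem_head _ _).
have Hs : \forall x \near F, forall j, j \in s -> P j x.
  by apply: IH => j js; apply: H; rewrite inE js orbT.
near=> x => j; rewrite inE => /predU1P[->|js]; first by near: x.
by move: j js; near: x.
Unshelve. all: by end_near. Qed.

Section jump_sums.
Context {R : realType}.
Implicit Types (f g : R -> R) (a b e : R).

(** The sum runs over all times; those without a jump contribute nothing once [g 0 = 0]. For
    nonnegative [g] the value lies in [0, +oo], so additivity over adjacent half-open intervals
    requires no summability. *)
Definition jump_sum f g a b : \bar R :=
  \esum_(u in [set u : R | (a < u <= b)%R]) (g (jump f u))%:E.

Definition grid a b (n k : nat) : R := a + (b - a) * (k%:R / n.+1%:R).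

Lemma grid0 a b n : grid a b n 0 = a.
Proof. by rewrite /grid mul0r mulr0 addr0. Qed.

Lemma grid_last a b n : grid a b n n.+1 = b.
Proof. by rewrite /grid divff ?pnatr_eq0// mulr1 addrC subrK. Qed.

Lemma gridS a b n k : grid a b n k.+1 = grid a b n k + (b - a) / n.+1%:R.
Proof. by rewrite /grid -natr1; field; rewrite addrC natr1 pnatr_eq0. Qed.

Lemma grid_le a b n i j : a <= b -> (i <= j)%N -> grid a b n i <= grid a b n j.
Proof.
move=> ab ij; rewrite /grid lerD2l ler_wpM2l ?subr_ge0//.
by rewrite ler_pM2r ?invr_gt0// ler_nat.
Qed.

Lemma mesh_lt a b e : 0 < e -> \forall n \near \oo, (b - a) / n.+1%:R < e.
Proof.
move=> e0; have : (b - a) * @harmonic R n @[n --> \oo] --> (b - a) * 0.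
  by apply: cvgM; [exact: cvg_cst|exact: cvg_harmonic].
rewrite mulr0 => /cvgrPdist_lt/(_ _ e0); apply: filterS => n /=.
by rewrite sub0r normrN /harmonic => /(le_lt_trans (ler_norm _)).
Qed.

Lemma grid_cell a b n u : a <= b -> a < u <= b ->
  exists2 k : nat, (k < n.+1)%N & grid a b n k < u <= grid a b n k.+1.
Proof.
move=> ab /andP[au ub].
have ex : exists k, u <= grid a b n k.+1 by exists n; rewrite grid_last.
case: (ex_minnP ex) => k uk kmin; exists k.
  by rewrite ltnS; apply: kmin; rewrite grid_last.
rewrite uk andbT; case: k uk kmin => [|k] uk kmin; first by rewrite grid0.
by rewrite ltNge; apply/negP => /kmin; rewrite ltnn.
Qed.

Lemma grid_cell_uniq a b n u i j : a <= b ->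
  grid a b n i < u <= grid a b n i.+1 -> grid a b n j < u <= grid a b n j.+1 ->
  i = j.
Proof.
move=> ab.
wlog ij : i j / (i <= j)%N => [H|] A B.
  by case: (leqP i j) => [/H|/ltnW /H H']; [exact|apply/esym/H'].
apply/eqP; rewrite eqn_leq ij /= leqNgt; apply/negP => ji.
have := @grid_le a b n _ _ ab ji.
by case/andP : A => _ A; case/andP: B => B _; lra.
Qed.

End jump_sums.

(** * Convergence of sums over grid increments to sums over jumps *)

Section grid_sums.
Context {R : realType}.
Implicit Types (f g : R -> R) (a b e : R).

Definition admissible g := [/\ continuous g, forall y, 0 <= g y & g 0 = 0].

(** Such a [g] sees only the finitely many large jumps and ignores the small moves over the other
    cells, so that grid sums converge without an error term. *)
Definition flat_near0 g := exists2 e, 0 < e & forall y, `|y| <= e -> g y = 0.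

Definition grid_sum f g a b n : R :=
  \sum_(k < n.+1) g (f (grid a b n k.+1) - f (grid a b n k)).

(** In the cell ]x, y] containing [u], the end [y] approaches [u] from the right (or equals it) and
    [x] approaches it strictly from the left, so the increment tends to the jump at [u]. *)
Lemma grid_term_cvg f g a b u e : cadlag f -> continuous g -> a <= b -> 0 < e ->
  \forall n \near \oo, forall k, grid a b n k < u <= grid a b n k.+1 ->
    `|g (f (grid a b n k.+1) - f (grid a b n k)) - g (jump f u)| < e.
Proof.
move=> cf cg ab e0.
have /cvgrPdist_lt/(_ _ e0)/nbhs_ballP[d /= d0 Hd] := cg (jump f u).
have d20 : 0 < d / 2 by rewrite divr_gt0.
have [r1 r10 H1] := cadlag_right u cf d20.
have [r2 r20 H2] := cadlag_left u cf d20.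
near=> n => k /andP[ku uk].
have m1 : (b - a) / n.+1%:R < r1 by near: n; exact: mesh_lt.
have m2 : (b - a) / n.+1%:R < r2 by near: n; exact: mesh_lt.
have := @gridS _ a b n k; move: ku uk.
set x := grid a b n k; set y := grid a b n k.+1; set m := _ / _ in m1 m2 *.
move=> xu uy yE.
have A : `|f y - f u| < d / 2 by apply: H1; apply/andP; split; lra.
have B : `|f x - lim (f z @[z --> u^'-])| < d / 2.
  by apply: H2; apply/andP; split; lra.
rewrite distrC; apply: Hd; rewrite /ball /= /jump.
rewrite [X in `|X|](_ : _ = (f x - lim (f z @[z --> u^'-])) - (f y - f u)); last by ring.
by rewrite (le_lt_trans (ler_normB _ _))//; lra.
Unshelve. all: by end_near. Qed.

(** The jump is the limit of [f u - f x] as [x] increases to [u], and for [x] close to [u] the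
    interval ]x, u] avoids [s]. *)
Lemma jump_small f e a b u (s : seq R) del : cadlag f -> 0 < del ->
  (forall x y, a <= x -> x < y -> y <= b -> y - x < del ->
    (forall v, v \in s -> ~~ (x < v <= y)) -> `|f y - f x| < e) ->
  a < u <= b -> u \notin s -> `|jump f u| <= e.
Proof.
move=> cf del0 H /andP[au ub] us.
have cl : `|f u - f x| @[x --> u^'-] --> `|jump f u|.
  apply: cvg_norm; apply: cvgB; first exact: cvg_cst.
  by have [_] := cf u.
apply: (cvgr_to_le cl).
have Hs : \forall x \near u^'-, forall v, v \in s -> ~~ (x < v <= u).
  apply: (@near_all_seq R R _ _ s (fun v x => ~~ (x < v <= u))) => v vs.
  have [uv|vu|uv] := ltgtP u v.
  - by apply: nearW => x; rewrite andbF.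
  - by near=> x; rewrite andbT -leNgt; near: x; exact: nbhs_left_ge.
  - by move: us; rewrite uv vs.
near=> x; apply/ltW/H => //.
- by near: x; exact: nbhs_left_ge.
- have : u - del < x by near: x; apply: nbhs_left_gt; lra.
  by lra.
- by near: x.
Unshelve. all: by end_near. Qed.

(** With [e] the flatness radius of [g], a fine grid has two kinds of cells: those without a point
    of [F], on which [f] moves by less than [e] and [g] returns 0, and those with exactly one such
    point, whose term tends to the value of [g] at the jump there. *)
Lemma grid_sum_cvg f g a b : cadlag f -> admissible g -> flat_near0 g -> a <= b ->
  jump_sum f g a b \is a fin_num /\
  grid_sum f g a b n @[n --> \oo] --> fine (jump_sum f g a b).
Proof.
move=> cf [cg g0 g00] [e e0 ge]; rewrite le_eqVlt => /predU1P[<-|ab].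
  rewrite /jump_sum [X in esum X _](_ : _ = set0); last first.
    by rewrite -subset0 => u /= /andP[]; lra.
  rewrite esum_set0; split => //=; rewrite /grid_sum.
  rewrite [X in X @ _ --> _](_ : _ = cst 0); first exact: cvg_cst.
  by apply/funext => n; rewrite big1// => k _; rewrite /grid !subrr !mul0r !addr0 subrr.
have [s [del [del0 Hs]]] := cadlag_small_moves cf e0 (ltW ab).
pose F := [seq u <- undup s | a < u <= b].
have uF : uniq F by rewrite filter_uniq// undup_uniq.
have inF u : (u \in F) = (a < u <= b) && (u \in s) by rewrite mem_filter mem_undup.
have JE : jump_sum f g a b = (\sum_(u <- F) g (jump f u))%:E.
  rewrite /jump_sum esum_mkcond -sumEFin.
  transitivity (\esum_(u in [set` F]) (g (jump f u))%:E).
    rewrite [RHS]esum_mkcond; apply: eq_esum => u _.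
    have [/set_mem/= uab|/negP uab] := boolP (u \in [set u | a < u <= b]).
      case: ifPn => // uF'; have us : u \notin s.
        by apply: contra uF' => us; apply/mem_set; rewrite /= inF uab.
      by rewrite ge// (jump_small cf del0 Hs).
    case: ifPn => // /set_mem/=; rewrite inF => /andP[uab' _].
    by exfalso; apply: uab; apply/mem_set.
  rewrite esum_fset; first by rewrite -fsbig_seq.
  - exact: finite_seq.
  - by move=> u _; rewrite lee_fin.
rewrite JE; split => //=.
(* The term of the cell containing [u], written as a sum over all cells so that the sums over cells
   and over [F] can be exchanged. *)
pose G n u := \sum_(k < n.+1 | grid a b n k < u <= grid a b n k.+1)
  g (f (grid a b n k.+1) - f (grid a b n k)).
have GE : \forall n \near \oo, grid_sum f g a b n = \sum_(u <- F) G n u.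
  (* The mesh is eventually finer than every gap between points of [F], so that no cell contains two
     of them. *)
  have gap0 : \forall n \near \oo, forall u, u \in F -> forall v, v \in F -> u < v ->
      (b - a) / n.+1%:R < v - u.
    apply: (@near_all_seq R _ _ _ F (fun u n => forall v, v \in F -> u < v ->
      (b - a) / n.+1%:R < v - u)) => u _.
    apply: (@near_all_seq R _ _ _ F (fun v n => u < v ->
      (b - a) / n.+1%:R < v - u)) => v _.
    have [uv|vu] := ltP u v; last by apply: nearW.
    by near=> n => _; near: n; apply: mesh_lt; lra.
  near=> n.
  have gap u v : u \in F -> v \in F -> u < v -> (b - a) / n.+1%:R < v - u.
    by move=> uF' vF'; move: v vF'; move: u uF'; near: n; exact: gap0.
  have md : (b - a) / n.+1%:R < del by near: n; exact: mesh_lt.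
  rewrite /G; under eq_bigr do rewrite big_mkcond /=.
  rewrite exchange_big /=; apply: eq_bigr => k _.
  set t := g _; have := @gridS _ a b n k.
  have ap : a <= grid a b n k.
    by rewrite -{1}(grid0 a b n); apply: grid_le => //; exact: ltW.
  have pb : grid a b n k.+1 <= b.
    by rewrite -[leRHS](grid_last a b n); apply: grid_le => //; exact: ltW.
  have m0 : 0 < (b - a) / n.+1%:R by rewrite divr_gt0// subr_gt0.
  rewrite {}/t; move: ap pb m0 md gap.
  set x := grid a b n k; set y := grid a b n k.+1; set m := _ / _.
  move=> ax yb m0 md gap yE.
  have [[u uF' /andP[xu uy]]|none] := pselect (exists2 u, u \in F & x < u <= y).
    rewrite (bigD1_seq u)//= xu uy /= big_seq_cond big1 ?addr0//.
    move=> v /andP[vF vu]; case: ifPn => // /andP[xv vy].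
    have [uv|vu'|E] := ltgtP u v; last by rewrite E eqxx in vu.
      by have := gap _ _ uF' vF uv; lra.
    by have := gap _ _ vF uF' vu'; lra.
  rewrite big_seq_cond big1 => [|v]; last first.
    rewrite andbT => vF; case: ifPn => // xvy.
    by exfalso; apply: none; exists v.
  apply: ge; apply/ltW/Hs => //; [by lra|by lra|].
  move=> v vs; apply/negP => /andP[xv vy]; apply: none; exists v; last by rewrite xv.
  by rewrite inF vs andbT; apply/andP; split; lra.
have GC u : u \in F -> G n u @[n --> \oo] --> g (jump f u).
  rewrite inF => /andP[uab _]; apply/cvgrPdist_lt => d d0.
  have H := grid_term_cvg u cf cg (ltW ab) d0.
  near=> n; have [k kn ku] := grid_cell n (ltW ab) uab.
  rewrite /G (bigD1 (Ordinal kn))//= big1 ?addr0; last first.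
    move=> j /andP[ju jk]; exfalso; move/eqP: jk; apply; apply/val_inj => /=.
    exact: grid_cell_uniq (ltW ab) ju ku.
  by rewrite distrC; move: k {kn} ku; near: n.
have : \sum_(u <- F) G n u @[n --> \oo] --> \sum_(u <- F) g (jump f u).
  elim: F GC {uF inF JE GE} => [|u s' IH] GC'.
    rewrite big_nil; under eq_fun do rewrite big_nil; exact: cvg_cst.
  rewrite big_cons; under eq_fun do rewrite big_cons.
  apply: cvgD; first by apply: GC'; rewrite mem_head.
  by apply: IH => v vs; apply: GC'; rewrite inE vs orbT.
apply: cvg_trans; apply: near_eq_cvg.
by apply: filterS GE => n ->.
Unshelve. all: by end_near. Qed.

End grid_sums.

Section ereal_limits.
Context {R : realType} {I : Type} {F : set_system I} {FF : Filter F}.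
Local Open Scope ereal_scope.
Implicit Types (u : I -> \bar R) (l : \bar R).

(** Convergence in the order topology, tested on rays; finite and infinite limits are then treated
    alike. *)
Lemma cvge_lt_gt u l : (forall M, M < l -> \forall x \near F, M < u x) ->
  (forall M, l < M -> \forall x \near F, u x < M) -> u x @[x --> F] --> l.
Proof.
case: l => [r| |] lo hi.
- move=> A /nbhs_EFin/nbhs_ballP[e /= e0 He].
  have L : \forall x \near F, (r - e)%:E < u x by apply: lo; rewrite lte_fin; lra.
  have H : \forall x \near F, u x < (r + e)%:E by apply: hi; rewrite lte_fin; lra.
  rewrite /nbhs /=; near=> x.
  have : (r - e)%:E < u x by near: x.
  have : u x < (r + e)%:E by near: x.
  rewrite /preimage /=; case: (u x) => // s; rewrite !lte_fin => h1 h2; apply: He.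
  by rewrite /ball /= distrC ltr_distlC; apply/andP; split; lra.
- by apply/cvgeyPgt => A; apply: lo; rewrite ltry.
- by apply/cvgeNyPlt => A; apply: hi; rewrite ltNyr.
Unshelve. all: by end_near. Qed.

Lemma cvge_gt u l M : u x @[x --> F] --> l -> M < l -> \forall x \near F, M < u x.
Proof. by move=> ul Ml; exact: (ul _ (open_ereal_gt' Ml)). Qed.

Lemma cvge_lt u l M : u x @[x --> F] --> l -> l < M -> \forall x \near F, u x < M.
Proof. by move=> ul Ml; exact: (ul _ (open_ereal_lt' Ml)). Qed.

Lemma cvge_below u l : (forall x, u x <= l) ->
  (forall M, M < l -> \forall x \near F, M < u x) -> u x @[x --> F] --> l.
Proof.
move=> ul lo; apply: cvge_lt_gt => // M lM.
by apply: nearW => x; exact: le_lt_trans lM.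
Qed.

(** Since [lne] inverts [expeR] on [0, +oo], comparing with a nonnegative level means comparing
    exponents; a negative level is always below. *)
Lemma cvg_expeR u l : u x @[x --> F] --> l -> expeR (u x) @[x --> F] --> expeR l.
Proof.
move=> ul; apply: cvge_lt_gt => M.
  move=> Ml; have [M0|M0] := ltP M 0.
    by apply: nearW => x; rewrite (lt_le_trans M0)// expeR_ge0.
  have ME : expeR (lne M) = M by apply/eqP; rewrite lneK_eq.
  move: Ml; rewrite -ME lte_expeR => Ml.
  by apply: filterS (cvge_gt ul Ml) => x; rewrite lte_expeR.
move=> lM; have M0 : 0 <= M by rewrite ltW// (le_lt_trans _ lM)// expeR_ge0.
have ME : expeR (lne M) = M by apply/eqP; rewrite lneK_eq.
move: lM; rewrite -ME lte_expeR => lM.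
by apply: filterS (cvge_lt ul lM) => x; rewrite lte_expeR.
Qed.

End ereal_limits.

Lemma measurable_expeR (R : realType) : measurable_fun setT (@expeR R).
Proof.
apply: (measurability _ (ErealGenOInfty.measurableE R)) => //.
move=> _ [_ [r ->] <-]; rewrite setTI.
have [r0|r0] := ltP r 0.
  rewrite [X in measurable X](_ : _ = setT)//; apply/seteqP; split => // x _ /=.
  by rewrite in_itv /= andbT (lt_le_trans _ (expeR_ge0 _))// lte_fin.
have : expeR (lne r%:E) = r%:E by apply/eqP; rewrite lneK_eq.
move: (lne r%:E) => l lE.
rewrite [X in measurable X](_ : _ = `]l, +oo[%classic); last first.
  by apply/seteqP; split => x /=; rewrite !in_itv /= !andbT -lE lte_expeR.
exact: emeasurable_itv.
Qed.

Lemma cvge_sum_seq (R : realType) (I : choiceType) (s : seq I)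
    (f_ : nat -> I -> \bar R) (f : I -> \bar R) :
  (forall n i, i \in s -> 0 <= f_ n i)%E -> (forall i, i \in s -> 0 <= f i)%E ->
  (forall i, i \in s -> f_ n i @[n --> \oo] --> f i) ->
  (\sum_(i <- s) f_ n i)%E @[n --> \oo] --> (\sum_(i <- s) f i)%E.
Proof.
elim: s => [|j s IH] f_0 f0 cf.
  rewrite big_nil [X in X @ _ --> _](_ : _ = cst 0%E); first exact: cvg_cst.
  by apply/funext => n; rewrite big_nil.
rewrite big_cons.
rewrite [X in X @ _ --> _](_ : _ = fun n => f_ n j + \sum_(i <- s) f_ n i)%E; last first.
  by apply/funext => n; rewrite big_cons.
have sj i : i \in s -> i \in j :: s by rewrite inE => ->; rewrite orbT.
apply: cvgeD.
- apply: ge0_adde_def; rewrite inE; first by rewrite f0 ?mem_head.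
  by rewrite big_seq sume_ge0// => i /sj/f0.
- by apply: cf; rewrite mem_head.
by apply: IH => [n i /sj|i /sj|i /sj]; [exact: f_0|exact: f0|exact: cf].
Qed.

(** A level below the sum is exceeded by a finite partial sum, which converges term by term; the
    bound [f_ n i <= f i] gives the other half. *)
Lemma esum_cvg_below (R : realType) (I : choiceType) (D : set I)
    (f_ : nat -> I -> \bar R) (f : I -> \bar R) :
  (forall n i, D i -> 0 <= f_ n i)%E -> (forall n i, D i -> f_ n i <= f i)%E ->
  (forall i, D i -> f_ n i @[n --> \oo] --> f i) ->
  \esum_(i in D) f_ n i @[n --> \oo] --> \esum_(i in D) f i.
Proof.
move=> f_0 f_f cf; apply: cvge_below => [n|M].
  by apply: le_esum => i; exact: f_f.
move=> /ereal_sup_gt[_ [X [finX XD] <-]] MX.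
have : (\sum_(i \in X) f_ n i)%E @[n --> \oo] --> (\sum_(i \in X) f i)%E.
  have XD' i : i \in (fset_set X : seq I) -> D i by rewrite in_fset_set// inE => /XD.
  rewrite fsbig_finite//=; under eq_fun do rewrite fsbig_finite//=.
  apply: cvge_sum_seq => [n i /XD'|i /XD' Di|i /XD'].
  - exact: f_0.
  - by apply: le_trans (f_f 0%N _ Di); exact: f_0.
  - exact: cf.
move/cvge_gt => /(_ _ MX); apply: filterS => n Mn.
by apply: lt_le_trans Mn _; apply: esum_ge; exists X.
Qed.

Section jump_sum_theory.
Context {R : realType}.
Local Open Scope ereal_scope.
Implicit Types (f g h : R -> R) (a b c : R) (F : seq R).

Lemma jump_sum_ge0 f g a b : (forall y, (0 <= g y)%R) -> 0 <= jump_sum f g a b.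
Proof. by move=> g0; apply: esum_ge0 => u _; rewrite lee_fin. Qed.

Lemma jump_sum_empty f g a b : (b <= a)%R -> jump_sum f g a b = 0.
Proof.
move=> ba; rewrite /jump_sum [X in esum X _](_ : _ = set0) ?esum_set0//.
by rewrite -subset0 => u /= /andP[]; lra.
Qed.

Lemma le_jump_sum f g h a b : (forall y, (g y <= h y)%R) ->
  jump_sum f g a b <= jump_sum f h a b.
Proof. by move=> gh; apply: le_esum => u _; rewrite lee_fin. Qed.

Lemma jump_sumD f g h a b : (forall y, (0 <= g y)%R) -> (forall y, (0 <= h y)%R) ->
  jump_sum f (fun y => g y + h y)%R a b = jump_sum f g a b + jump_sum f h a b.
Proof.
move=> g0 h0; rewrite /jump_sum -esumD; last 2 first.
- by move=> u _; rewrite lee_fin.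
- by move=> u _; rewrite lee_fin.
by apply: eq_esum => u _; rewrite EFinD.
Qed.

Lemma jump_sum_cat f g a b c : (forall y, (0 <= g y)%R) -> (a <= b)%R -> (b <= c)%R ->
  jump_sum f g a c = jump_sum f g a b + jump_sum f g b c.
Proof.
move=> g0 ab bc; rewrite /jump_sum (esumID [set u | (u <= b)%R]); last first.
  by move=> u _; rewrite lee_fin.
congr (_ + _); congr esum; apply/seteqP; split => u /=.
- by move=> [/andP[-> _] ->].
- by move=> /andP[-> ub]; rewrite (le_trans ub bc).
- by move=> [/andP[au ->]] /negP; rewrite -ltNge => ->.
- move=> /andP[bu ->]; rewrite (le_lt_trans ab bu); split => //.
  by apply/negP; rewrite -ltNge.
Qed.

Lemma jump_sum_chain f g (t : nat -> R) n : (forall y, (0 <= g y)%R) ->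
  (forall i j, (i <= j)%N -> (t i <= t j)%R) ->
  \sum_(k < n) jump_sum f g (t k) (t k.+1) = jump_sum f g (t 0%N) (t n).
Proof.
move=> g0 tm; elim: n => [|n IH]; first by rewrite big_ord0 jump_sum_empty.
by rewrite big_ord_recr /= IH -jump_sum_cat//; exact: tm.
Qed.

Lemma jump_sum_ge_seq f g a b F : (forall y, (0 <= g y)%R) -> uniq F ->
  (forall u, u \in F -> (a < u <= b)%R) ->
  (\sum_(u <- F) g (jump f u))%:E <= jump_sum f g a b.
Proof.
move=> g0 uF Fab; apply: esum_ge; exists [set` F].
  by split; [exact: finite_seq|move=> u /= /Fab].
by rewrite -fsbig_seq// sumEFin.
Qed.

Lemma jump_sum_gt f g a b M : M < jump_sum f g a b ->
  exists F, [/\ uniq F, forall u, u \in F -> (a < u <= b)%R &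
    M < (\sum_(u <- F) g (jump f u))%:E].
Proof.
move=> /ereal_sup_gt[_ [X [finX XD] <-]] MX.
exists (fset_set X : seq R); split => //; first exact: fset_uniq.
- by move=> u; rewrite in_fset_set// inE => /XD.
- by rewrite -sumEFin; move: MX; rewrite fsbig_finite.
Qed.

Lemma jump_sum_le f g a b M :
  (forall F, uniq F -> (forall u, u \in F -> (a < u <= b)%R) ->
    (\sum_(u <- F) g (jump f u))%:E <= M) -> jump_sum f g a b <= M.
Proof.
move=> H; rewrite leNgt; apply/negP => /jump_sum_gt[F [uF Fab]].
by rewrite ltNge H.
Qed.

Lemma jump_sum_cvg f (g_ : nat -> R -> R) g a b :
  (forall n y, (0 <= g_ n y)%R) -> (forall n y, (g_ n y <= g y)%R) ->
  (forall y, g_ n y @[n --> \oo] --> g y) ->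
  jump_sum f (g_ n) a b @[n --> \oo] --> jump_sum f g a b.
Proof.
move=> g_0 g_g cg; apply: esum_cvg_below => [n u _|n u _|u _].
- by rewrite lee_fin.
- by rewrite lee_fin.
- by apply: cvg_EFin; [exact: nearW|exact: cg].
Qed.

Definition cell_sum f g a b n k := jump_sum f g (grid a b n k) (grid a b n k.+1).

Lemma cell_sum_ge0 f g a b n k : (forall y, (0 <= g y)%R) -> 0 <= cell_sum f g a b n k.
Proof. exact: jump_sum_ge0. Qed.

Lemma sum_cell_sum f g a b n : (forall y, (0 <= g y)%R) -> (a <= b)%R ->
  \sum_(k < n.+1) cell_sum f g a b n k = jump_sum f g a b.
Proof.
move=> g0 ab; rewrite (@jump_sum_chain f g (grid a b n))// => [|i j ij].
  by rewrite grid0 grid_last.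
exact: grid_le.
Qed.

(** The common source of the lower bounds below: once the mesh is smaller than the gaps of [F], its
    points occupy distinct cells, and a finite family of jumps can be traded for a family of
    cells. *)
Lemma separating_cells f g a b F : (forall y, (0 <= g y)%R) -> (a <= b)%R -> uniq F ->
  (forall u, u \in F -> (a < u <= b)%R) ->
  \forall n \near \oo, exists k : R -> 'I_n.+1, {in F &, injective k} /\
    forall u, u \in F -> (g (jump f u))%:E <= cell_sum f g a b n (k u).
Proof.
move=> g0 ab uF Fab.
have gap0 : \forall n \near \oo, forall u, u \in F -> forall v, v \in F -> (u < v)%R ->
    ((b - a) / n.+1%:R < v - u)%R.
  apply: (@near_all_seq R _ _ _ F (fun u n => forall v, v \in F -> (u < v)%R ->
    ((b - a) / n.+1%:R < v - u)%R)) => u _.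
  apply: (@near_all_seq R _ _ _ F (fun v n => (u < v)%R ->
    ((b - a) / n.+1%:R < v - u)%R)) => v _.
  have [uv|vu] := ltP u v; last by apply: nearW.
  by near=> n => _; near: n; apply: mesh_lt; lra.
near=> n.
have gap u v : u \in F -> v \in F -> (u < v)%R -> ((b - a) / n.+1%:R < v - u)%R.
  by move=> uF' vF'; move: v vF'; move: u uF'; near: n; exact: gap0.
have /choice[k Hk] : forall u, exists k : 'I_n.+1, u \in F ->
    (grid a b n k < u <= grid a b n k.+1)%R.
  move=> u; case: (boolP (u \in F)) => [uF'|_]; last by exists ord0.
  by have [k kn Hk] := grid_cell n ab (Fab _ uF'); exists (Ordinal kn).
exists k; split => [u v uF' vF' kuv|u uF'].
  have /andP[u1 u2] := Hk _ uF'; have := Hk _ vF'; rewrite -kuv => /andP[v1 v2].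
  have := @gridS _ a b n (k u).
  move: u1 u2 v1 v2 (gap _ _ uF' vF') (gap _ _ vF' uF').
  move: (grid a b n _) (grid a b n _) (_ / _)%R => x y m u1 u2 v1 v2 uv vu yE.
  by case: (ltgtP u v) => // [/uv|/vu]; lra.
rewrite /cell_sum; have := @jump_sum_ge_seq f g (grid a b n (k u)) (grid a b n (k u).+1) [:: u] g0 isT.
by rewrite big_seq1; apply => v; rewrite inE => /eqP ->; exact: Hk.
Unshelve. all: by end_near. Qed.

End jump_sum_theory.

Section extended_big_operators.
Context {R : realType}.
Local Open Scope ereal_scope.

Lemma le_prod_ge0 (I : eqType) (s : seq I) (x y : I -> \bar R) :
  (forall i, i \in s -> 0 <= x i) -> (forall i, i \in s -> x i <= y i) ->
  \prod_(i <- s) x i <= \prod_(i <- s) y i.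
Proof.
elim: s => [|j s IH] x0 xy; first by rewrite !big_nil.
have sj i : i \in s -> i \in j :: s by rewrite inE => ->; rewrite orbT.
have p0 : 0 <= \prod_(i <- s) x i.
  by rewrite big_seq; apply: prode_ge0 => i /sj/x0.
rewrite !big_cons; apply: lee_pmul => //.
- by apply: x0; rewrite mem_head.
- by apply: xy; rewrite mem_head.
- by apply: IH => i /sj; [exact: x0|exact: xy].
Qed.

Lemma prod_ge1 (I : finType) (A : pred I) (x : I -> \bar R) :
  (forall i, 1 <= x i) -> 1 <= \prod_(i | A i) x i.
Proof.
move=> x1; elim/big_ind : _ => // u v u1 v1.
by rewrite -[1]mule1; apply: lee_pmul.
Qed.

(** The factors outside the image of [k] are at least 1 and may be inserted freely. *)
Lemma le_prod_inj (I : eqType) (N : nat) (F : seq I) (k : I -> 'I_N)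
    (x : I -> \bar R) (y : 'I_N -> \bar R) :
  uniq F -> {in F &, injective k} -> (forall u, u \in F -> 0 <= x u) ->
  (forall u, u \in F -> x u <= y (k u)) -> (forall i, 1 <= y i) ->
  \prod_(u <- F) x u <= \prod_(i < N) y i.
Proof.
move=> uF ki x0 xy y1; apply: le_trans (le_prod_ge0 x0 xy) _.
rewrite -(big_map k xpredT) big_uniq; last by rewrite map_inj_in_uniq.
rewrite [leRHS](bigID (mem (map k F))) /=.
rewrite -[leLHS]mule1; apply: lee_pmul => //; last exact: prod_ge1.
by apply: prode_ge0 => i _; exact: le_trans (y1 i).
Qed.

Lemma le_sum_inj (I : eqType) (N : nat) (F : seq I) (k : I -> 'I_N)
    (x : I -> \bar R) (y : 'I_N -> \bar R) :
  uniq F -> {in F &, injective k} ->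
  (forall u, u \in F -> x u <= y (k u)) -> (forall i, 0 <= y i) ->
  \sum_(u <- F) x u <= \sum_(i < N) y i.
Proof.
move=> uF ki xy y0; apply: (@le_trans _ _ (\sum_(u <- F) y (k u))).
  by rewrite big_seq [leRHS]big_seq; apply: lee_sum.
rewrite -(big_map k xpredT) big_uniq; last by rewrite map_inj_in_uniq.
rewrite [leRHS](bigID (mem (map k F))) /=.
by rewrite leeDl// sume_ge0.
Qed.

Lemma prod_expeR (I : Type) (s : seq I) (A : pred I) (x : I -> \bar R) :
  \prod_(i <- s | A i) expeR (x i) = expeR (\sum_(i <- s | A i) x i).
Proof. by rewrite (big_morph expeR expeRD expeR0). Qed.

End extended_big_operators.

(** * Grid approximation of exponentials and squares of jump sums *)

Section jump_sum_sandwich.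
Context {R : realType}.
Local Open Scope ereal_scope.
Variables (f g : R -> R) (a b : R).
Hypotheses (g0 : forall y, (0 <= g y)%R) (ab : (a <= b)%R).

Let lng0 y : (0 <= ln (1 + g y))%R.
Proof. by rewrite ln_ge0// lerDl. Qed.

Let prod_lnE (F : seq R) :
  (\prod_(u <- F) (1 + g (jump f u)) = expR (\sum_(u <- F) ln (1 + g (jump f u))))%R.
Proof.
elim: F => [|u F IH]; first by rewrite !big_nil expR0.
by rewrite !big_cons expRD IH lnK// posrE ltr_pwDl.
Qed.

(** Expanding the product of the factors 1 + g over finitely many jumps gives at least 1 plus their
    sum, and this product is the exponential of the sum of logarithms. *)
Lemma jump_sum_le_expeR a' b' :
  1 + jump_sum f g a' b' <= expeR (jump_sum f (fun y => ln (1 + g y))%R a' b').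
Proof.
rewrite -leeBrDl//; apply: jump_sum_le => F uF Fab; rewrite leeBrDl//.
have H := jump_sum_ge_seq f lng0 uF Fab.
apply: (@le_trans _ _ (expeR (\sum_(u <- F) ln (1 + g (jump f u)))%:E)); last first.
  by rewrite lee_expeR.
rewrite /= -prod_lnE -EFinD lee_fin.
elim: F {uF Fab H} => [|u F IH]; first by rewrite !big_nil addr0.
rewrite !big_cons; have := g0 (jump f u); move: IH.
have : (0 <= \sum_(i <- F) g (jump f i))%R by rewrite sumr_ge0.
move: (\sum_(_ <- _) _)%R (\prod_(_ <- _) _)%R (g _) => s p x s0 sp x0.
apply: (@le_trans _ _ ((1 + x) * (1 + s))%R); last by rewrite ler_wpM2l ?addr_ge0.
by rewrite mulrDl mul1r mulrDr mulr1; have := mulr_ge0 x0 s0; lra.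
Qed.

Lemma prod_cells_le n :
  \prod_(k < n.+1) (1 + cell_sum f g a b n k) <=
  expeR (jump_sum f (fun y => ln (1 + g y))%R a b).
Proof.
rewrite -(sum_cell_sum f n lng0 ab) -prod_expeR.
apply: le_prod_ge0 => k _; first by rewrite adde_ge0// cell_sum_ge0.
exact: jump_sum_le_expeR.
Qed.

(** The upper bound holds cell by cell. Conversely, finitely many jumps bring the exponent above any
    smaller level, and a fine grid puts them in different cells. *)
Lemma prod_cells_cvg :
  \prod_(k < n.+1) (1 + cell_sum f g a b n k) @[n --> \oo] -->
  expeR (jump_sum f (fun y => ln (1 + g y))%R a b).
Proof.
apply: cvge_below => [n|M ME]; first exact: prod_cells_le.
have c1 n k : 1 <= 1 + cell_sum f g a b n k by rewrite leeDl// cell_sum_ge0.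
have [M0|M0] := ltP M 0.
  by apply: nearW => n; rewrite (lt_le_trans M0)// (le_trans _ (prod_ge1 _ _)).
have : expeR (lne M) = M by apply/eqP; rewrite lneK_eq.
move: (lne M) ME => {M0} l + lE; rewrite -{M}lE lte_expeR.
move=> /jump_sum_gt[F [uF Fab]]; rewrite -lte_expeR /= -prod_lnE -prodEFin => lF.
apply: filterS (separating_cells f g0 ab uF Fab) => n [k [ki kF]].
apply: (lt_le_trans lF); apply: (le_prod_inj uF ki) => //.
- by move=> u _; rewrite lee_fin addr_ge0.
- by move=> u /kF; rewrite EFinD; exact: leeD2l.
Qed.

(** A one-sided bound for the zero-one law: a cell sum dominates the term of any jump that it
    contains, and 1 - exp (- x) increases with x. *)
Lemma sum_laplace_cells_gt M :
  M < jump_sum f (fun y => 1 - expR (- g y))%R a b ->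
  \forall n \near \oo, M < \sum_(k < n.+1) (1 - expeR (- cell_sum f g a b n k)).
Proof.
move=> /jump_sum_gt[F [uF Fab]]; rewrite -sumEFin => MF.
apply: filterS (separating_cells f g0 ab uF Fab) => n [k [ki kF]].
apply: (lt_le_trans MF); apply: (le_sum_inj uF ki).
  move=> u /kF uk; rewrite EFinB; apply: leeB => //.
  by rewrite -[(expR _)%:E]/(expeR _%:E) lee_expeR EFinN leeN2.
move=> i; rewrite sube_ge0 ?orbT//.
by rewrite -expeR0 lee_expeR oppe_le0 cell_sum_ge0.
Qed.

Let off_diagonal n := \sum_(k < n.+1) \sum_(l < n.+1 | l != k)
  cell_sum f g a b n k * cell_sum f g a b n l.

Let sumr_sq (F : seq R) (x : R -> R) : uniq F ->
  ((\sum_(u <- F) x u) * (\sum_(u <- F) x u) = \sum_(u <- F) x u ^+ 2 +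
    \sum_(u <- F) \sum_(v <- F | v != u) x u * x v)%R.
Proof.
move=> uF; rewrite -big_split /= mulr_suml big_seq [RHS]big_seq.
apply: eq_bigr => u uF'; rewrite mulr_sumr (bigD1_seq u)//= expr2.
Qed.

Lemma jump_sum_sq_le a' b' : jump_sum f (fun y => g y ^+ 2)%R a' b' <=
  jump_sum f g a' b' * jump_sum f g a' b'.
Proof.
apply: jump_sum_le => F uF Fab.
apply: (@le_trans _ _ ((\sum_(u <- F) g (jump f u))%:E * (\sum_(u <- F) g (jump f u))%:E)).
  rewrite -EFinM lee_fin (sumr_sq (fun u => g (jump f u)) uF) lerDl.
  by apply: sumr_ge0 => u _; apply: sumr_ge0 => v _; rewrite mulr_ge0.
have S0 : (0 <= \sum_(u <- F) g (jump f u))%R by apply: sumr_ge0.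
by apply: lee_pmul; rewrite ?lee_fin// jump_sum_ge_seq.
Qed.

Lemma sq_cells_le n : jump_sum f (fun y => g y ^+ 2)%R a b + off_diagonal n <=
  jump_sum f g a b * jump_sum f g a b.
Proof.
have sq0 y : (0 <= g y ^+ 2)%R by rewrite exprn_ge0.
rewrite -(sum_cell_sum f n sq0 ab) -big_split /=.
rewrite -(sum_cell_sum f n g0 ab) ge0_sume_distrl; last first.
  by move=> i _; rewrite cell_sum_ge0.
apply: lee_sum => k _; rewrite ge0_sume_distrr; last first.
  by move=> i _; rewrite cell_sum_ge0.
rewrite [leRHS](bigD1 k)//=; apply: leeD2r; exact: jump_sum_sq_le.
Qed.

(** Compared with the full square, the products of two different jumps in the same cell are missing;
    they become negligible as the grid separates finitely many jumps. What is left off the diagonal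
    are products over disjoint cells, whose expectations factor. *)
Lemma sq_cells_cvg :
  jump_sum f (fun y => g y ^+ 2)%R a b + off_diagonal n @[n --> \oo] -->
  jump_sum f g a b * jump_sum f g a b.
Proof.
have sq0 y : (0 <= g y ^+ 2)%R by rewrite exprn_ge0.
have od0 n : 0 <= off_diagonal n.
  by apply: sume_ge0 => i _; apply: sume_ge0 => j _; rewrite mule_ge0// cell_sum_ge0.
apply: cvge_below => [n|M ME]; first exact: sq_cells_le.
have [M0|M0] := ltP M 0.
  by apply: nearW => n; rewrite (lt_le_trans M0)// adde_ge0// jump_sum_ge0.
have [m mM] : exists m : R, M = m%:E.
  by case: M M0 ME => [m _ _| |//]; [exists m|move=> _; rewrite ltNge leey].
have m0 : (0 <= m)%R by rewrite -lee_fin -mM.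
(* A level for the square becomes a level for the sum itself, where the approximation by finitely
   many jumps applies. *)
have : (Num.sqrt m)%:E < jump_sum f g a b.
  rewrite ltNge; apply/negP => H; move: ME; rewrite ltNge => /negP; apply.
  rewrite mM -[m]sqr_sqrtr// expr2 EFinM.
  by apply: lee_pmul => //; exact: jump_sum_ge0.
move=> /jump_sum_gt[F [uF Fab]]; rewrite lte_fin => lF.
apply: filterS (separating_cells f g0 ab uF Fab) => n [k [ki kF]].
have : M < ((\sum_(u <- F) g (jump f u)) * (\sum_(u <- F) g (jump f u)))%:E.
  rewrite mM lte_fin -[m]sqr_sqrtr// expr2.
  by apply: ltr_pM => //; exact: sqrtr_ge0.
move=> /lt_le_trans; apply.
rewrite (sumr_sq (fun u => g (jump f u)) uF) EFinD; apply: leeD.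
  exact: (jump_sum_ge_seq f sq0 uF Fab).
rewrite -sumEFin; apply: (le_sum_inj uF ki) => [u uF'|i]; last first.
  by apply: sume_ge0 => j _; rewrite mule_ge0// cell_sum_ge0.
rewrite -sumEFin -big_filter.
rewrite [leRHS]big_mkcond /=.
have uFu : uniq [seq v <- F | v != u] by rewrite filter_uniq.
have kiu : {in [seq v <- F | v != u] &, injective k}.
  by move=> x y; rewrite !mem_filter => /andP[_ xF] /andP[_ yF]; exact: ki.
apply: (le_sum_inj uFu kiu) => [v|i]; last first.
  by case: ifP => // _; rewrite mule_ge0// cell_sum_ge0.
rewrite mem_filter => /andP[vu vF].
case: eqVneq => [E|_]; first by move: vu; rewrite (ki _ _ vF uF' E) eqxx.
by rewrite EFinM; apply: lee_pmul; rewrite ?lee_fin// kF.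
Qed.

End jump_sum_sandwich.

(** * Expectations of functions of independent variables *)

Section measurable_big_products.
Context d (T : measurableType d) (R : realType).

Lemma measurable_bigprod (I : Type) (s : seq I) (A : pred I) (f : I -> T -> R) :
  (forall i, A i -> measurable_fun setT (f i)) ->
  measurable_fun setT (fun w => \prod_(i <- s | A i) f i w).
Proof.
move=> mf; elim: s => [|i s IH].
  by under eq_fun do rewrite big_nil; exact: measurable_cst.
under eq_fun do rewrite big_cons; case: (boolP (A i)) => // Ai.
by apply: measurable_funM => //; exact: mf.
Qed.

Lemma emeasurable_bigprod (I : Type) (s : seq I) (A : pred I) (f : I -> T -> \bar R) :
  (forall i, A i -> measurable_fun setT (f i)) ->
  measurable_fun setT (fun w => \prod_(i <- s | A i) f i w)%E.
Proof.
move=> mf; elim: s => [|i s IH].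
  by under eq_fun do rewrite big_nil; exact: measurable_cst.
under eq_fun do rewrite big_cons; case: (boolP (A i)) => // Ai.
by apply: emeasurable_funM => //; exact: mf.
Qed.

End measurable_big_products.

Section independence_of_functions.
Local Open Scope ereal_scope.
Context d (T : measurableType d) (R : realType) (P : probability T R).

Import HBNNSimple.

(** The passage from indicators to nonnegative measurable functions of [X], through simple
    functions. The case of the full set shows that [C] is the integral of [A]. *)
Lemma integral_prodE_indic (A : T -> R) (X : T -> R) (C : R) :
  measurable_fun setT A -> (forall w, (0 <= A w)%R) -> measurable_fun setT X ->
  (forall B, measurable B -> \int[P]_w (A w * \1_B (X w))%:E = C%:E * P (X @^-1` B)) ->
  forall h : R -> R, measurable_fun setT h -> (forall x, (0 <= h x)%R) ->
  \int[P]_w (A w * h (X w))%:E = C%:E * \int[P]_w (h (X w))%:E.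
Proof.
move=> mA A0 mX HB h mh h0.
have meh : measurable_fun setT (EFin \o h) by apply/measurable_EFinP.
pose hn := nnsfun_approx measurableT meh.
have hnX n : measurable_fun setT (hn n \o X) by apply: measurableT_comp.
have hn_cvg x : (hn n x)%:E @[n --> \oo] --> (h x)%:E.
  by apply: (cvg_nnsfun_approx measurableT meh) => // y _; rewrite lee_fin.
have hn_le n x : (hn n x <= h x)%R.
  rewrite -lee_fin; apply: (cvge_to_ge (hn_cvg x)).
  near=> k; rewrite lee_fin; have nk : (n <= k)%N by near: k; exact: nbhs_infty_ge.
  by have /lefP/(_ x) := nd_nnsfun_approx measurableT meh nk.
have H1 : \int[P]_w (A w * hn n (X w))%:E @[n --> \oo] --> \int[P]_w (A w * h (X w))%:E.
  apply: cvg_integral_below => [n| |n w|n w|w].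
  - by apply/measurable_EFinP/measurable_funM => //; exact: hnX.
  - by apply/measurable_EFinP/measurable_funM => //; exact: measurableT_comp.
  - by rewrite lee_fin mulr_ge0.
  - by rewrite lee_fin ler_wpM2l.
  - under eq_fun do rewrite EFinM; rewrite EFinM.
    by apply: cvgeZl.
have H2 : \int[P]_w (hn n (X w))%:E @[n --> \oo] --> \int[P]_w (h (X w))%:E.
  apply: cvg_integral_below => [n| |n w|n w|w].
  - by apply/measurable_EFinP; exact: hnX.
  - by apply/measurable_EFinP; exact: measurableT_comp.
  - by rewrite lee_fin.
  - by rewrite lee_fin.
  - exact: hn_cvg.
have E n : \int[P]_w (A w * hn n (X w))%:E = C%:E * \int[P]_w (hn n (X w))%:E.
  transitivity (\int[P]_w \sum_(r \in range (hn n)) (r * (A w * \1_(hn n @^-1` [set r]) (X w)))%:E).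
    apply: eq_integral => w _; rewrite (fimfunE (hn n) (X w)).
    rewrite !fsbig_finite//= sumEFin mulr_sumr.
    by congr EFin; apply: eq_bigr => r _; rewrite mulrCA.
  have mI r : measurable (X @^-1` (hn n @^-1` [set r])).
    by rewrite -[X in measurable X]setTI; apply: mX.
  have IE r w : \1_(hn n @^-1` [set r]) (X w) = \1_(X @^-1` (hn n @^-1` [set r])) w :> R.
    by rewrite !indicE.
  have rI0 r w : (0 <= r * \1_(X @^-1` (hn n @^-1` [set r])) w)%R.
    rewrite indicE; case: (boolP (w \in _)) => [|_]; last by rewrite mulr0.
    by rewrite inE /= => <-; rewrite mulr1.
  have rP0 r : 0 <= r%:E * P (X @^-1` (hn n @^-1` [set r])).
    have [r0|r0] := leP 0%R r; first by rewrite mule_ge0 ?lee_fin.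
    rewrite (_ : X @^-1` _ = set0) ?measure0 ?mule0// -subset0 => w /= E.
    by have : (0 <= hn n (X w))%R by []; rewrite E leNgt r0.
  have -> : \int[P]_w (hn n (X w))%:E =
      \sum_(r \in range (hn n)) (r%:E * P (X @^-1` (hn n @^-1` [set r]))).
    transitivity (\int[P]_w \sum_(r \in range (hn n))
        (r * \1_(X @^-1` (hn n @^-1` [set r])) w)%:E).
      apply: eq_integral => w _; rewrite (fimfunE (hn n) (X w)).
      by rewrite !fsbig_finite//= sumEFin.
    rewrite ge0_integral_fsum//; last 2 first.
    - by move=> r; apply/measurable_EFinP/measurable_funM => //; exact: measurable_indic.
    - by move=> r w _; rewrite lee_fin.
    apply: eq_fsbigr => r /set_mem[y _ yr].
    have r0 : (0 <= r)%R by rewrite -yr.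
    under eq_integral do rewrite EFinM.
    rewrite ge0_integralZl ?lee_fin//; last first.
      by apply/measurable_EFinP; exact: measurable_indic.
    by rewrite integral_indic// setIT.
  rewrite ge0_integral_fsum//; last 2 first.
  - move=> r; apply/measurable_EFinP/measurable_funM => //; apply: measurable_funM => //.
    by under eq_fun do rewrite IE; exact: measurable_indic.
  - by move=> r w _; rewrite lee_fin mulrCA mulr_ge0// IE.
  rewrite ge0_mule_fsumr//.
  apply: eq_fsbigr => r /set_mem[y _ yr].
  have r0 : (0 <= r)%R by rewrite -yr.
  under eq_integral do rewrite EFinM.
  rewrite ge0_integralZl ?lee_fin//; last 2 first.
  - apply/measurable_EFinP/measurable_funM => //.
    by under eq_fun do rewrite IE; exact: measurable_indic.
  - by move=> w _; rewrite lee_fin mulr_ge0.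
  by rewrite HB// muleCA.
have := H1; under eq_fun do rewrite E.
move=> H1'; have H3 := cvgeZl (isT : C%:E \is a fin_num) H2.
by rewrite -(cvg_lim _ H1')// (cvg_lim _ H3).
Unshelve. all: by end_near. Qed.

Lemma integral_prob_cst (c : \bar R) : \int[P]_w c = c.
Proof.
have -> : \int[P]_w c = c * P setT by rewrite -integral_cst.
by rewrite [X in _ * X](_ : _ = 1) ?mule1//; exact: probability_setT.
Qed.

Lemma integral_prob_le (f : T -> \bar R) (c : \bar R) :
  (forall w, 0 <= f w <= c) -> \int[P]_w f w <= c.
Proof.
move=> f01; rewrite -[leRHS]integral_prob_cst.
by apply: le_integral_of_le => w _; case/andP : (f01 w).
Qed.

Lemma integral_prob_fin_num (f : T -> \bar R) (c : R) :
  (forall w, 0 <= f w <= c%:E) -> \int[P]_w f w \is a fin_num.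
Proof.
move=> f01; rewrite ge0_fin_numE; last first.
  by apply: integral_ge0 => w _; case/andP : (f01 w).
by rewrite (le_lt_trans (integral_prob_le f01))// ltry.
Qed.

Lemma integral_indic_comp (X : T -> R) (B : set R) :
  measurable_fun setT X -> measurable B ->
  \int[P]_w (\1_B (X w))%:E = P (X @^-1` B).
Proof.
move=> mX mB; transitivity (\int[P]_w (\1_(X @^-1` B) w)%:E).
  by apply: eq_integral => w _; rewrite !indicE.
rewrite integral_indic ?setIT// -[X in measurable X]setTI; exact: mX.
Qed.

(** The bound by 1 keeps every integral finite, so that the product over the other indices can serve
    as the real constant [C] of [integral_prodE_indic]. *)
Lemma independent_integral_prod (n : nat) (X : 'I_n -> T -> R) (h : 'I_n -> R -> R) :
  (forall i, measurable_fun setT (X i)) -> independent_rvs P X ->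
  (forall i, measurable_fun setT (h i)) -> (forall i x, (0 <= h i x <= 1)%R) ->
  \int[P]_w (\prod_i h i (X i w))%:E = \prod_i \int[P]_w (h i (X i w))%:E.
Proof.
move=> mX indX.
have mcomp i (g : R -> R) : measurable_fun setT g -> measurable_fun setT (g \o X i).
  by move=> mg; exact: measurableT_comp.
(* Indicators are replaced by general functions one factor at a time. *)
suff H m : forall h : 'I_n -> R -> R, (forall i, measurable_fun setT (h i)) ->
    (forall i x, (0 <= h i x <= 1)%R) ->
    (forall i : 'I_n, (m <= i)%N -> exists2 B, measurable B & h i = \1_B) ->
    \int[P]_w (\prod_i h i (X i w))%:E = \prod_i \int[P]_w (h i (X i w))%:E.
  by move=> mh h01; apply: (H n) => // i; rewrite leqNgt ltn_ord.
elim: m => [|m IH] {}h mh h01 hB.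
  have /choice[B HB] : forall i, exists B : set R, measurable B /\ h i = \1_B.
    by move=> i; have [B mB hE] := hB i isT; exists B.
  have mXB i : measurable (X i @^-1` B i).
    by rewrite -[X in measurable X]setTI; apply: mX => //; exact: (HB i).1.
  transitivity (\int[P]_w (\1_(\bigcap_(i in [set: 'I_n]) (X i @^-1` B i)) w)%:E).
    apply: eq_integral => w _; congr EFin.
    under eq_bigr => i _ do rewrite (HB i).2 indicE.
    rewrite indicE; case: (boolP (w \in _)) => [|nw].
      rewrite inE => Bw; rewrite big1// => i _.
      by rewrite mem_set//; exact: (Bw i).
    have [i nBi] : exists i, ~ B i (X i w).
      apply: contrapT => /forallNP H; move/negP: nw; apply.
      by rewrite inE => i _; apply: contrapT; exact: H.
    by rewrite (bigD1 i)//= memNset// mul0r.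
  rewrite integral_indic//; last first.
    by apply: fin_bigcap_measurable => //; exact: finite_finset.
  rewrite setIT; apply: (eq_trans (indX B (fun i => (HB i).1))).
  apply: eq_bigr => i _; rewrite (HB i).2.
  by rewrite integral_indic_comp//; exact: (HB i).1.
have [nm|mn] := leqP n m.
  by apply: IH => // i; rewrite leqNgt (leq_trans (ltn_ord i) nm).
pose i0 := Ordinal mn.
have int01 i : (\int[P]_w (h i (X i w))%:E) \is a fin_num.
  by apply: (@integral_prob_fin_num _ 1) => w; rewrite !lee_fin.
pose C := (\prod_(i < n | i != i0) fine (\int[P]_w (h i (X i w))%:E))%R.
have CE : \prod_(i < n | i != i0) \int[P]_w (h i (X i w))%:E = C%:E.
  by rewrite /C -prodEFin; apply: eq_bigr => i _; rewrite fineK.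
rewrite (bigD1 i0)//= CE muleC.
under eq_integral do rewrite (bigD1 i0)//= mulrC.
apply: integral_prodE_indic => //.
- by apply: measurable_bigprod => i _; exact: mcomp.
- by move=> w; apply: prodr_ge0 => i _; case/andP : (h01 i (X i w)).
- move=> B mB.
  pose h' i := if i == i0 then \1_B else h i.
  have h'0 : h' i0 = \1_B by rewrite /h' eqxx.
  have h'n i : i != i0 -> h' i = h i by rewrite /h' => /negPf ->.
  transitivity (\int[P]_w (\prod_i h' i (X i w))%:E).
    apply: eq_integral => w _; rewrite [in RHS](bigD1 i0)//= h'0 [in RHS]mulrC; congr (_ * _)%:E.
    by apply: eq_bigr => i /h'n ->.
  rewrite IH; first last.
  + move=> i mi; case: (eqVneq i i0) => [->|ii0]; first by exists B.
    rewrite h'n//; apply: hB; rewrite ltn_neqAle mi andbT; apply: contra ii0 => /eqP E.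
    by apply/eqP/val_inj.
  + move=> i x; rewrite /h'; case: eqP => // _.
    by rewrite indicE; case: (_ \in _); rewrite /= ?lexx ler01.
  + by move=> i; rewrite /h'; case: eqP => // _; exact: measurable_indic.
  rewrite (bigD1 i0)//= h'0 integral_indic_comp// muleC -CE; congr (_ * _).
  by apply: eq_bigr => i /h'n ->.
- by move=> x; case/andP : (h01 i0 x).
Qed.

End independence_of_functions.

(** * Measurability of sums over jumps *)

Section jump_sum_approximation.
Context {R : realType}.
Implicit Types (f g : R -> R).

(** A continuous cutoff multiplies [g]: it is 0 for [|y| <= 1 / (j + 1)], affine in [|y|] up to
    [2 / (j + 1)], and 1 beyond. *)
Definition flatten_near0 g (j : nat) (y : R) : R :=
  g y * Num.min 1 (Num.max 0 (j.+1%:R * `|y| - 1)).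

Let cut (j : nat) (y : R) : R := Num.min 1 (Num.max 0 (j.+1%:R * `|y| - 1)).

Let cut01 j y : 0 <= cut j y <= 1.
Proof. by rewrite /cut le_min ler01 le_max lexx /= ge_min lexx. Qed.

Lemma flatten_near0_admissible g j : admissible g -> admissible (flatten_near0 g j).
Proof.
move=> [cg g0 g00]; split.
- move=> y; apply: cvgM; first exact: cg.
  apply: (@continuous_min _ R (fun=> 1) (fun y => Num.max 0 (j.+1%:R * `|y| - 1))).
    exact: cvg_cst.
  apply: (@continuous_max _ R (fun=> 0) (fun y => j.+1%:R * `|y| - 1)).
    exact: cvg_cst.
  apply: cvgB; last exact: cvg_cst.
  by apply: cvgM; [exact: cvg_cst|apply: norm_continuous].
- by move=> y; rewrite mulr_ge0//; have /andP[] := cut01 j y.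
- by rewrite /flatten_near0 g00 mul0r.
Qed.

Lemma flatten_near0_flat g j : flat_near0 (flatten_near0 g j).
Proof.
exists j.+1%:R^-1 => [|y yj]; first by rewrite invr_gt0.
rewrite /flatten_near0 [Num.max _ _](_ : _ = 0); last first.
  by apply/max_idPl; rewrite subr_le0 mulrC -ler_pdivlMr// div1r.
by rewrite [Num.min _ _](_ : _ = 0) ?mulr0//; apply/min_idPr; rewrite ler01.
Qed.

Lemma flatten_near0_le g j y : 0 <= g y -> flatten_near0 g j y <= g y.
Proof. by move=> g0; rewrite ler_piMr//; have /andP[] := cut01 j y. Qed.

Lemma flatten_near0_cvg g y : g 0 = 0 -> flatten_near0 g j y @[j --> \oo] --> g y.
Proof.
move=> g00; have [->|y0] := eqVneq y 0.
  by rewrite /flatten_near0 g00; under eq_fun do rewrite mul0r; exact: cvg_cst.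
have yp : 0 < `|y| by rewrite normr_gt0.
apply: cvg_near_cst.
have := mesh_lt 0 1 yp; rewrite subr0 => H.
have H2 := @mesh_lt R 0 2 _ yp.
near=> j; have : (2 - 0) / j.+1%:R < `|y| by near: j.
rewrite subr0 ltr_pdivrMr// mulrC => h.
rewrite /flatten_near0 [Num.max _ _](_ : _ = j.+1%:R * `|y| - 1); last first.
  by apply/max_idPr; lra.
by rewrite [Num.min _ _](_ : _ = 1) ?mulr1//; apply/min_idPl; lra.
Unshelve. all: by end_near. Qed.

Lemma jump_sum_flatten_cvg f g a b : admissible g ->
  jump_sum f (flatten_near0 g j) a b @[j --> \oo] --> jump_sum f g a b.
Proof.
move=> ag; have [cg g0 g00] := ag; apply: jump_sum_cvg.
- by move=> n y; have [] := flatten_near0_admissible n ag.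
- by move=> n y; exact: flatten_near0_le.
- by move=> y; exact: flatten_near0_cvg.
Qed.

End jump_sum_approximation.

Section measurable_jump_sums.
Context d (T : measurableType d) (R : realType).
Variable L : R -> T -> R.
Hypotheses (mL : forall t, measurable_fun setT (L t))
           (cadL : forall w, cadlag (L ^~ w)).

(** Each time is replaced by the right end of its grid cell, and right-continuity gives convergence.
    The grid of [-n, n] has n^2 + 1 cells, so that the window grows while the mesh still tends to
    0. *)
Lemma measurable_cadlag_process : measurable_fun setT (fun p : R * T => L p.1 p.2).
Proof.
pose G n k : R := grid (- n%:R) n%:R (n * n) k.
pose L_ n (p : R * T) := \sum_(k < (n * n).+1)
  \1_(`]G n k, G n k.+1]%classic : set R) p.1 * L (G n k.+1) p.2.
apply: (@measurable_fun_cvg _ _ _ _ L_) => [n|p _].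
  apply: measurable_sum => k; apply: measurable_funM.
    by apply: measurableT_comp => //; exact: measurable_indic.
  exact: measurableT_comp.
case: p => u w /=; apply/cvgrPdist_lt => e e0.
have [r r0 Hr] := cadlag_right u (cadL w) e0.
have r20 : 0 < r / 2 by rewrite divr_gt0.
have m2 := @mesh_lt R 0 2 _ r20.
have nu : \forall n \near \oo, `|u| < n%:R.
  near=> n; apply: (lt_le_trans (archi_boundP (normr_ge0 u))).
  by rewrite ler_nat; near: n; exact: nbhs_infty_ge.
near=> n; have un : `|u| < n%:R by near: n.
have uI : - n%:R < u <= n%:R.
  by move: un; rewrite ltr_norml => /andP[-> /ltW ->].
have nn : - n%:R <= n%:R :> R by rewrite (le_trans _ (ler0n _ _))// oppr_le0.
have [k kn uk] := grid_cell (n * n) nn uI.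
rewrite /L_ (bigD1 (Ordinal kn))//= indicE mem_set; last by rewrite /= in_itv.
rewrite mul1r big1 ?addr0 => [|j jk]; last first.
  rewrite indicE memNset ?mul0r//= in_itv/= => uj; move/eqP: jk; apply.
  by apply/val_inj => /=; exact: grid_cell_uniq nn uj uk.
rewrite distrC; apply: Hr; case/andP : uk => ku ->/=.
have n0 : (0 < n)%N by near: n; exact: nbhs_infty_gt.
have : (2 - 0) / n.+1%:R < r / 2 by near: n; exact: m2.
(* The mesh 2n / (n^2 + 1) is at most 4 / (n + 1), which is below [r]. *)
have mesh : (n%:R - - n%:R) / (n * n).+1%:R <= 2 * ((2 - 0) / n.+1%:R) :> R.
  rewrite opprK subr0 mulrA ler_pdivrMr// mulrAC ler_pdivlMr//.
  rewrite -!natrD -!natrM ler_nat; nia.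
rewrite /G gridS; move: ku mesh; rewrite -/(G n k).
by move: (G n k) ((_ - _) / _) (_ / n.+1%:R) => x y z; lra.
Unshelve. all: by end_near. Qed.

(** An iterated limit of finite sums of measurable terms, along the grids and then along the
    cutoffs. The summed function, both ends and the sample point depend on a parameter [a], because
    Tonelli's theorem later asks for joint measurability in times, parameters and paths. *)
Lemma measurable_jump_sum dA (A : measurableType dA) (H : A -> R -> R)
    (s t : A -> R) (w : A -> T) :
  (forall a, admissible (H a)) ->
  measurable_fun setT (fun p : A * R => H p.1 p.2) ->
  measurable_fun setT s -> measurable_fun setT t -> measurable_fun setT w ->
  measurable_fun setT (fun a => jump_sum (L ^~ (w a)) (H a) (s a) (t a)).
Proof.
move=> aH mH ms mt mw.
(* Grid convergence needs ordered ends; an interval with reversed ends is replaced by the degenerate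
   one at [t a]. *)
pose s' a := Num.min (s a) (t a).
have ms' : measurable_fun setT s' by exact: measurable_minr.
have s't a : s' a <= t a by rewrite /s' ge_min lexx orbT.
have -> : (fun a => jump_sum (L ^~ (w a)) (H a) (s a) (t a)) =
    (fun a => jump_sum (L ^~ (w a)) (H a) (s' a) (t a)).
  apply/funext => a; rewrite /s'; have [//|ts] := leP (s a) (t a).
  by rewrite !jump_sum_empty// ltW.
have mg n k : measurable_fun setT (fun a => grid (s' a) (t a) n k).
  apply: measurable_funD => //; apply: measurable_funM => //.
  exact: measurable_funB.
have mLg n k : measurable_fun setT (fun a => L (grid (s' a) (t a) n k) (w a)).
  exact: (measurableT_comp measurable_cadlag_process (measurable_fun_pair (mg n k) mw)).
apply: (@emeasurable_fun_cvg _ _ _ _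
  (fun j a => jump_sum (L ^~ (w a)) (flatten_near0 (H a) j) (s' a) (t a))); last first.
  by move=> a _; exact: jump_sum_flatten_cvg.
move=> j; apply: (@emeasurable_fun_cvg _ _ _ _ (fun n a =>
    (grid_sum (L ^~ (w a)) (flatten_near0 (H a) j) (s' a) (t a) n)%:E)); last first.
  move=> a _; have [fin cv] := grid_sum_cvg (cadL (w a))
    (flatten_near0_admissible j (aH a)) (flatten_near0_flat _ _) (s't a).
  by rewrite -(fineK fin); apply: cvg_EFin => //; exact: nearW.
move=> n; apply/measurable_EFinP/measurable_sum => k.
have mI := measurable_funB (mLg n k.+1) (mLg n k).
apply: measurable_funM.
  exact: (measurableT_comp mH (measurable_fun_pair (@measurable_id _ _ setT) mI)).
apply: measurable_minr => //; apply: measurable_maxr => //.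
apply: measurable_funB => //; apply: measurable_funM => //.
by apply: measurableT_comp => //.
Qed.

End measurable_jump_sums.

(** * Sums over the jumps of a Levy process *)

Lemma cvge_eq_limits (R : realType) (u v : nat -> \bar R) (l l' : \bar R) :
  u n @[n --> \oo] --> l -> v n @[n --> \oo] --> l' -> u =1 v -> l = l'.
Proof.
move=> ul vl /funext uv; rewrite uv in ul.
by rewrite -(cvg_lim _ ul)// (cvg_lim _ vl).
Qed.

Section big_blocks.

(** Euclidean division by [N] lists the pairs (block, cell) in one sequence; independence of
    increments is stated for a single increasing sequence of times. *)
Lemma big_blocks (A : Type) (idx : A) (op : Monoid.law idx) (m N : nat)
    (F : nat -> nat -> A) : (0 < N)%N ->
  \big[op/idx]_(j < m * N) F (j %/ N)%N (j %% N)%N =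
  \big[op/idx]_(i < m) \big[op/idx]_(k < N) F i k.
Proof.
move=> N0; elim: m => [|m IH]; first by rewrite !big_ord0.
rewrite mulSnr big_split_ord big_ord_recr /= IH; congr (op _ _).
apply: eq_bigr => k _.
by rewrite divnMDl// divn_small// addn0 modnMDl modn_small.
Qed.

End big_blocks.

Section levy_functionals.
Local Open Scope ereal_scope.
Context d (T : measurableType d) (R : realType) (P : probability T R).

(** Every path is cadlag, not just almost every one, so that pathwise limits and joint measurability
    hold without exceptional sets; [cadlag_modification] produces such a process. *)
Record cadlag_levy (L : R -> T -> R) : Prop := {
  cadlag_levy_measurable : forall t, measurable_fun setT (L t) ;
  cadlag_levy_cadlag : forall w, cadlag (L ^~ w) ;
  cadlag_levy_independent : forall (n : nat) (t : nat -> R),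
    {homo t : i j / (i <= j)%N >-> (i <= j)%R} ->
    independent_rvs P (fun (i : 'I_n) w => L (t i.+1) w - L (t i) w)%R ;
  cadlag_levy_stationary : forall (s t h : R) (B : set R), (s <= t)%R ->
    measurable B -> P [set w | B (L (t + h) w - L (s + h) w)%R] =
    P [set w | B (L t w - L s w)%R] }.

Lemma bounded_cvg_integral (f_ : nat -> T -> \bar R) (f : T -> \bar R) :
  (forall n, measurable_fun setT (f_ n)) -> (forall n w, 0 <= f_ n w <= 1) ->
  (forall w, f_ n w @[n --> \oo] --> f w) ->
  \int[P]_w f_ n w @[n --> \oo] --> \int[P]_w f w.
Proof.
move=> mf_ f01 cf.
have mf : measurable_fun setT f by apply: (@emeasurable_fun_cvg _ _ _ _ f_) => // w _; exact: cf.
have [] := @dominated_convergence _ _ _ P setT measurableT f_ f (cst 1) mf_ mf.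
- by apply: aeW => w _; exact: cf.
- by apply/integrableP; split=> //; under eq_integral do rewrite /= normr1;
  rewrite integral_prob_cst ltry.
- apply: aeW => w n _; have /andP[f0 f1] := f01 n w.
  by rewrite gee0_abs.
by move=> _ _; apply.
Qed.

Variable L : R -> T -> R.
Hypothesis levL : cadlag_levy L.

Let mL := cadlag_levy_measurable levL.
Let cadL := cadlag_levy_cadlag levL.

Let mincr s t : measurable_fun setT (fun w => L t w - L s w)%R.
Proof. exact: measurable_funB. Qed.

Lemma integral_increment_shift (h : R -> R) s t c : (s <= t)%R ->
  measurable_fun setT h -> (forall x, (0 <= h x)%R) ->
  \int[P]_w (h (L (t + c) w - L (s + c) w)%R)%:E =
  \int[P]_w (h (L t w - L s w)%R)%:E.
Proof.
move=> st mh h0.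
have H s' t' : \int[P]_w (h (L t' w - L s' w)%R)%:E =
    \int[pushforward P (fun w => L t' w - L s' w)%R]_x (h x)%:E.
  rewrite ge0_integral_pushforward//.
    by apply/measurable_EFinP.
  by move=> x _; rewrite lee_fin.
rewrite !H; apply: eq_measure_integral => B mB _.
exact: (cadlag_levy_stationary levL).
Qed.

Let J g a b w := jump_sum (L ^~ w) g a b.

Lemma measurable_levy_jump_sum g a b : admissible g -> measurable_fun setT (J g a b).
Proof.
move=> ag; apply: (@measurable_jump_sum _ _ _ L mL cadL _ _ (fun=> g)) => //.
case: ag => cg _ _.
exact: (measurableT_comp (continuous_measurable_fun cg) measurable_snd).
Qed.

Section refined_times.
Variables (t : nat -> R) (n : nat).
Hypothesis tm : {homo t : i j / (i <= j)%N >-> (i <= j)%R}.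

(** The grids of successive intervals joined end to end: the last point of one grid is the first
    point of the next. *)
Definition refine_times (j : nat) : R :=
  grid (t (j %/ n.+1)%N) (t (j %/ n.+1)%N.+1) n (j %% n.+1)%N.

Lemma refine_timesS j : refine_times j.+1 =
  grid (t (j %/ n.+1)%N) (t (j %/ n.+1)%N.+1) n (j %% n.+1)%N.+1.
Proof.
rewrite /refine_times; have jE := divn_eq j n.+1.
(* After the last cell of a block, [j.+1] opens the next block; [grid_last] and [grid0] identify the
   two descriptions of the common end. *)
have := ltn_pmod j (ltn0Sn n); rewrite ltnS leq_eqVlt => /predU1P[kn|kn].
  have E : j.+1 = ((j %/ n.+1).+1 * n.+1 + 0)%N by rewrite {1}jE kn; lia.
  have Ed : (j.+1 %/ n.+1 = (j %/ n.+1).+1)%N by rewrite {1}E divnMDl// div0n addn0.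
  have Em : (j.+1 %% n.+1 = 0)%N by rewrite E modnMDl mod0n.
  by rewrite Ed Em grid0 kn grid_last.
have E : j.+1 = (j %/ n.+1 * n.+1 + (j %% n.+1).+1)%N by rewrite {1}jE addnS.
have Ed : (j.+1 %/ n.+1 = j %/ n.+1)%N.
  by rewrite {1}E divnMDl// (divn_small (kn : ((j %% n.+1).+1 < n.+1)%N)) addn0.
have Em : (j.+1 %% n.+1 = (j %% n.+1).+1)%N.
  by rewrite {1}E modnMDl (modn_small (kn : ((j %% n.+1).+1 < n.+1)%N)).
by rewrite Ed Em.
Qed.

Lemma refine_times_homo : {homo refine_times : i j / (i <= j)%N >-> (i <= j)%R}.
Proof.
apply: homo_leq => [x|x y z|j]; [exact: lexx|exact: le_trans|].
by rewrite refine_timesS; apply: grid_le => //; exact: tm.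
Qed.

End refined_times.

(** The exponential turns the grid sums of all blocks into one product of [0, 1]-valued functions of
    the increments along [refine_times], to which independence applies. *)
Let blockE (t : nat -> R) n m (g : nat -> R -> R) :
  {homo t : i j / (i <= j)%N >-> (i <= j)%R} -> (forall i, admissible (g i)) ->
  \int[P]_w (\prod_(i < m) expR (- grid_sum (L ^~ w) (g i) (t i) (t i.+1) n))%:E =
  \prod_(i < m) \prod_(k < n.+1) \int[P]_w (expR (- g i
    (L (grid (t i) (t i.+1) n k.+1) w - L (grid (t i) (t i.+1) n k) w)%R))%:E.
Proof.
move=> tm ag; set N := n.+1.
pose F w i k : R := expR (- g i
    (L (grid (t i) (t i.+1) n k.+1) w - L (grid (t i) (t i.+1) n k) w)%R)%R.
transitivity (\int[P]_w (\prod_(j < m * N) F w (j %/ N)%N (j %% N)%N)%:E).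
  apply: eq_integral => w _; rewrite (big_blocks _ _ (F w))//; congr EFin.
  apply: eq_bigr => i _; rewrite /grid_sum -sumrN.
  by rewrite (big_morph expR (@expRD R) (@expR0 R)).
pose h (j : 'I_(m * N)) x := expR (- g (j %/ N)%N x)%R.
transitivity (\int[P]_w (\prod_(j < m * N)
    h j (L (refine_times t n j.+1) w - L (refine_times t n j) w))%:E).
  apply: eq_integral => w _; congr EFin; apply: eq_bigr => j _.
  by rewrite refine_timesS.
rewrite (@independent_integral_prod _ _ _ P _ (fun j w =>
    L (refine_times t n j.+1) w - L (refine_times t n j) w)%R); last 4 first.
- by move=> j; exact: mincr.
- by apply: (cadlag_levy_independent levL); exact: refine_times_homo.
- move=> j; apply: measurableT_comp => //; apply: measurableT_comp => //.
  by apply: continuous_measurable_fun; have [] := ag (j %/ N)%N.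
- move=> j x; rewrite expR_ge0 -[leRHS]expR0 ler_expR oppr_le0.
  by have [_ ->] := ag (j %/ N)%N.
transitivity (\prod_(j < m * N) \int[P]_w (F w (j %/ N)%N (j %% N)%N)%:E).
  by apply: eq_bigr => j _; apply: eq_integral => w _; rewrite refine_timesS.
exact: (@big_blocks _ _ _ m N (fun i k => \int[P]_w (F w i k)%:E)).
Qed.

Let grid_indep (t : nat -> R) n m (g : nat -> R -> R) :
  {homo t : i j / (i <= j)%N >-> (i <= j)%R} -> (forall i, admissible (g i)) ->
  \int[P]_w (\prod_(i < m) expR (- grid_sum (L ^~ w) (g i) (t i) (t i.+1) n))%:E =
  \prod_(i < m) \int[P]_w (expR (- grid_sum (L ^~ w) (g i) (t i) (t i.+1) n))%:E.
Proof.
move=> tm ag; rewrite blockE//; apply: eq_bigr => i _.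
(* A single block, for which [blockE] recognises the product over cells as one expectation. *)
pose t' (j : nat) := if j is 0%N then t i else t i.+1.
have tm' : {homo t' : i j / (i <= j)%N >-> (i <= j)%R}.
  by case=> [|a] [|b] //= _; rewrite ?lexx//; exact: tm.
have := @blockE t' n 1 (fun=> g i) tm' (fun=> ag i).
by rewrite big_ord1 /= => <-; apply: eq_integral => w _; rewrite big_ord1.
Qed.

Let laplace01 (x : \bar R) : 0 <= x -> 0 <= expeR (- x) <= 1.
Proof.
by move=> x0; rewrite expeR_ge0 -[leRHS]expeR0 lee_expeR oppe_le0.
Qed.

Let prod_laplace01 m (x : nat -> \bar R) : (forall i, 0 <= x i) ->
  0 <= \prod_(i < m) expeR (- x i) <= 1.
Proof.
move=> x0; elim: m => [|m /andP[IH0 IH1]]; first by rewrite big_ord0 lexx andbT.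
have /andP[a0 a1] := laplace01 (x0 m).
rewrite big_ord_recr /= mule_ge0//=.
by rewrite -[leRHS]mule1; apply: lee_pmul.
Qed.

Let mlaplace (u : T -> \bar R) : measurable_fun setT u ->
  measurable_fun setT (fun w => expeR (- u w)).
Proof.
move=> mu; apply: (measurableT_comp (@measurable_expeR R)).
exact: (measurableT_comp (@oppe_measurable R setT)).
Qed.

Let cvg_prod01 (m : nat) (f_ : nat -> nat -> \bar R) (f : nat -> \bar R) :
  (forall n i, 0 <= f_ n i <= 1) -> (forall i, f_ n i @[n --> \oo] --> f i) ->
  \prod_(i < m) f_ n i @[n --> \oo] --> \prod_(i < m) f i.
Proof.
move=> f01 cf.
have f01' i : 0 <= f i <= 1.
  apply/andP; split.
    by apply: (cvge_to_ge (cf i)); apply: nearW => n; have /andP[] := f01 n i.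
  by apply: (cvge_to_le (cf i)); apply: nearW => n; have /andP[] := f01 n i.
have fin01 (x : \bar R) : 0 <= x <= 1 -> x \is a fin_num.
  by move=> /andP[x0 x1]; rewrite ge0_fin_numE// (le_lt_trans x1)// ltry.
elim: m => [|m IH].
  by rewrite big_ord0; under eq_fun do rewrite big_ord0; exact: cvg_cst.
rewrite big_ord_recr /=; under eq_fun do rewrite big_ord_recr /=.
apply: cvgeM => //; apply: mule_def_fin.
  by elim/big_ind : _ => // [x y|i _]; [exact: fin_numM|exact: fin01].
exact: fin01.
Qed.

Let laplace_flat (t : nat -> R) m (g : nat -> R -> R) :
  {homo t : i j / (i <= j)%N >-> (i <= j)%R} -> (forall i, admissible (g i)) ->
  (forall i, flat_near0 (g i)) ->
  \int[P]_w \prod_(i < m) expeR (- J (g i) (t i) (t i.+1) w) =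
  \prod_(i < m) \int[P]_w expeR (- J (g i) (t i) (t i.+1) w).
Proof.
move=> tm ag fg.
have g0 i y : (0 <= g i y)%R by have [] := ag i.
pose f_ n i w := expeR (- (grid_sum (L ^~ w) (g i) (t i) (t i.+1) n)%:E).
pose f i w := expeR (- J (g i) (t i) (t i.+1) w).
have f_01 n i w : 0 <= f_ n i w <= 1.
  by apply: laplace01; rewrite lee_fin; apply: sumr_ge0.
have cf i w : f_ n i w @[n --> \oo] --> f i w.
  apply: cvg_expeR; apply: cvgeN.
  have [fin cv] := grid_sum_cvg (cadL w) (ag i) (fg i) (tm _ _ (leqnSn i)).
  by rewrite /J -(fineK fin); apply: cvg_EFin => //; exact: nearW.
have mf_ n i : measurable_fun setT (f_ n i).
  apply: mlaplace; apply/measurable_EFinP; apply: measurable_sum => k.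
  apply: measurableT_comp; last exact: mincr.
  by apply: continuous_measurable_fun; have [] := ag i.
have H1 : \int[P]_w \prod_(i < m) f_ n i w @[n --> \oo] -->
    \int[P]_w \prod_(i < m) f i w.
  apply: bounded_cvg_integral => [n|n w|w].
  - by apply: emeasurable_bigprod.
  - apply: (@prod_laplace01 m (fun i => (grid_sum (L ^~ w) (g i) (t i) (t i.+1) n)%:E)) => i.
    by rewrite lee_fin; apply: sumr_ge0.
  - by apply: (@cvg_prod01 m (fun n i => f_ n i w) (fun i => f i w)).
have H2 : \prod_(i < m) \int[P]_w f_ n i w @[n --> \oo] -->
    \prod_(i < m) \int[P]_w f i w.
  apply: (@cvg_prod01 m (fun n i => \int[P]_w f_ n i w) (fun i => \int[P]_w f i w)) => [n i|i].
    apply/andP; split; last by apply: integral_prob_le => w; exact: f_01.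
    by apply: integral_ge0 => w _; have /andP[] := f_01 n i w.
  by apply: bounded_cvg_integral.
have E n : \int[P]_w \prod_(i < m) f_ n i w = \prod_(i < m) \int[P]_w f_ n i w.
  have := @grid_indep t n m g tm ag.
  by under eq_integral do rewrite -prodEFin.
exact: cvge_eq_limits H1 H2 E.
Qed.

(** The grid limit settles functions flat near 0 and the limit of the cutoffs settles the others.
    Both pass under the expectation because Laplace transforms stay in [0, 1] even where a jump sum
    is infinite. *)
Lemma laplace_independent (t : nat -> R) m (g : nat -> R -> R) :
  {homo t : i j / (i <= j)%N >-> (i <= j)%R} -> (forall i, admissible (g i)) ->
  \int[P]_w \prod_(i < m) expeR (- J (g i) (t i) (t i.+1) w) =
  \prod_(i < m) \int[P]_w expeR (- J (g i) (t i) (t i.+1) w).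
Proof.
move=> tm ag.
have g0 i y : (0 <= g i y)%R by have [] := ag i.
pose gj j i := flatten_near0 (g i) j.
have agj j i : admissible (gj j i) by exact: flatten_near0_admissible.
have gj0 j i y : (0 <= gj j i y)%R by have [] := agj j i.
pose f_ j i w := expeR (- J (gj j i) (t i) (t i.+1) w).
pose f i w := expeR (- J (g i) (t i) (t i.+1) w).
have f_01 n i w : 0 <= f_ n i w <= 1.
  by apply: laplace01; apply: jump_sum_ge0.
have cf i w : f_ n i w @[n --> \oo] --> f i w.
  by apply: cvg_expeR; apply: cvgeN; exact: jump_sum_flatten_cvg.
have mf_ n i : measurable_fun setT (f_ n i).
  by apply: mlaplace; exact: measurable_levy_jump_sum.
have H1 : \int[P]_w \prod_(i < m) f_ n i w @[n --> \oo] -->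
    \int[P]_w \prod_(i < m) f i w.
  apply: bounded_cvg_integral => [n|n w|w].
  - by apply: emeasurable_bigprod.
  - apply: (@prod_laplace01 m (fun i => J (gj n i) (t i) (t i.+1) w)) => i.
    exact: jump_sum_ge0.
  - by apply: (@cvg_prod01 m (fun n i => f_ n i w) (fun i => f i w)).
have H2 : \prod_(i < m) \int[P]_w f_ n i w @[n --> \oo] -->
    \prod_(i < m) \int[P]_w f i w.
  apply: (@cvg_prod01 m (fun n i => \int[P]_w f_ n i w) (fun i => \int[P]_w f i w)) => [n i|i].
    apply/andP; split; last by apply: integral_prob_le => w; exact: f_01.
    by apply: integral_ge0 => w _; have /andP[] := f_01 n i w.
  by apply: bounded_cvg_integral.
have E n : \int[P]_w \prod_(i < m) f_ n i w = \prod_(i < m) \int[P]_w f_ n i w.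
  by apply: (@laplace_flat t m (gj n)) => // i; exact: flatten_near0_flat.
exact: cvge_eq_limits H1 H2 E.
Qed.

Let grid_shift (g : R -> R) a b c n : (a <= b)%R -> admissible g ->
  \int[P]_w (expR (- grid_sum (L ^~ w) g (a + c) (b + c) n))%:E =
  \int[P]_w (expR (- grid_sum (L ^~ w) g a b n))%:E.
Proof.
move=> ab ag.
pose t a' b' (j : nat) : R := if j is 0%N then a' else b'.
have E a' b' : (a' <= b')%R ->
    \int[P]_w (expR (- grid_sum (L ^~ w) g a' b' n))%:E =
    \prod_(k < n.+1) \int[P]_w (expR (- g
      (L (grid a' b' n k.+1) w - L (grid a' b' n k) w)%R))%:E.
  move=> ab'; have tm : {homo t a' b' : i j / (i <= j)%N >-> (i <= j)%R}.
    by case=> [|i] [|j] //= _; rewrite ?lexx.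
  have := @blockE (t a' b') n 1 (fun=> g) tm (fun=> ag).
  by rewrite big_ord1 /=; under eq_integral do rewrite big_ord1 /=.
have abc : (a + c <= b + c)%R by rewrite lerD2r.
apply: (eq_trans (E _ _ abc)); apply: (eq_trans _ (esym (E _ _ ab))).
apply: eq_bigr => k _.
have gs j : grid (a + c) (b + c) n j = (grid a b n j + c)%R by rewrite /grid; ring.
rewrite !gs (@integral_increment_shift (fun y => expR (- g y)))//.
- exact: grid_le.
- apply: measurableT_comp => //; apply: measurableT_comp => //.
  by apply: continuous_measurable_fun; have [] := ag.
Qed.

(** The cells of the shifted grid are the shifted cells, so the expectations agree on every grid;
    the same two limits as for independence carry this over. *)
Lemma laplace_stationary (g : R -> R) a b c : (a <= b)%R -> admissible g ->
  \int[P]_w expeR (- J g (a + c)%R (b + c)%R w) = \int[P]_w expeR (- J g a b w).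
Proof.
move=> ab ag.
have flat (k : R -> R) a' b' : (a' <= b')%R -> admissible k -> flat_near0 k ->
    \int[P]_w (expR (- grid_sum (L ^~ w) k a' b' n))%:E @[n --> \oo] -->
    \int[P]_w expeR (- J k a' b' w).
  move=> ab' ak fk; have k0 y : (0 <= k y)%R by have [] := ak.
  apply: bounded_cvg_integral => [n|n w|w].
  - apply: (@mlaplace (fun w => (grid_sum (L ^~ w) k a' b' n)%:E)).
    apply/measurable_EFinP; apply: measurable_sum => j.
    apply: measurableT_comp; last exact: mincr.
    by apply: continuous_measurable_fun; have [] := ak.
  - apply: (@laplace01 (grid_sum (L ^~ w) k a' b' n)%:E).
    by rewrite lee_fin; apply: sumr_ge0.
  - apply: (@cvg_expeR _ _ _ _ (fun n => - (grid_sum (L ^~ w) k a' b' n)%:E)).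
    apply: cvgeN; have [fin cv] := grid_sum_cvg (cadL w) ak fk ab'.
    by rewrite /J -(fineK fin); apply: cvg_EFin => //; exact: nearW.
have {}flat (k : R -> R) : admissible k -> flat_near0 k ->
    \int[P]_w expeR (- J k (a + c)%R (b + c)%R w) = \int[P]_w expeR (- J k a b w).
  move=> ak fk; have abc : (a + c <= b + c)%R by rewrite lerD2r.
  apply: (cvge_eq_limits (flat k _ _ abc ak fk) (flat k _ _ ab ak fk)) => n.
  exact: grid_shift.
have gen a' b' : \int[P]_w expeR (- J (flatten_near0 g j) a' b' w) @[j --> \oo] -->
    \int[P]_w expeR (- J g a' b' w).
  apply: bounded_cvg_integral => [j|j w|w].
  - by apply: mlaplace; apply: measurable_levy_jump_sum; exact: flatten_near0_admissible.
  - apply: laplace01; apply: jump_sum_ge0.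
    by have [] := flatten_near0_admissible j ag.
  - by apply: cvg_expeR; apply: cvgeN; exact: jump_sum_flatten_cvg.
apply: (cvge_eq_limits (gen _ _) (gen _ _)) => j.
by apply: flat; [exact: flatten_near0_admissible|exact: flatten_near0_flat].
Qed.

End levy_functionals.

(** * From Laplace transforms to expectations of unbounded jump sums *)

Section laplace_approximation.
Context {R : realType}.
Local Open Scope ereal_scope.

Lemma cvge_prod_ge1 (m : nat) (f_ : nat -> nat -> \bar R) (f : nat -> \bar R) :
  (forall n i, 1 <= f_ n i) -> (forall i, f_ n i @[n --> \oo] --> f i) ->
  \prod_(i < m) f_ n i @[n --> \oo] --> \prod_(i < m) f i.
Proof.
move=> f1 cf.
have f1' i : 1 <= f i by apply: (cvge_to_ge (cf i)); exact: nearW.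
elim: m => [|m IH].
  by rewrite big_ord0; under eq_fun do rewrite big_ord0; exact: cvg_cst.
rewrite big_ord_recr /=; under eq_fun do rewrite big_ord_recr /=.
apply: cvgeM => //; apply: neq0_mule_def; rewrite gt_eqF//.
apply: (@lt_le_trans _ _ 1) => //; rewrite -[leLHS]mule1.
by apply: lee_pmul => //; exact: prod_ge1.
Qed.

(** With N = n + 1, this is the difference quotient of h -> 1 - exp (- h x) between 0 and 1 / N,
    whose limit is x. It is bounded by N, affine in a Laplace transform, and equal to N at x =
    +oo. *)
Definition laplace_approx (n : nat) (x : \bar R) : \bar R :=
  n.+1%:R%:E * (1 - expeR (- (n.+1%:R^-1%:E * x))).

Lemma laplace_approx_ge0 n x : 0 <= x -> 0 <= laplace_approx n x.
Proof.
move=> x0; rewrite mule_ge0 ?lee_fin// sube_ge0 ?orbT//.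
by rewrite -[leRHS]expeR0 lee_expeR oppe_le0 mule_ge0// lee_fin invr_ge0.
Qed.

Lemma laplace_approx_le n x : 0 <= x -> laplace_approx n x <= x.
Proof.
case: x => [x| |//] x0; last by rewrite leey.
rewrite /laplace_approx /= -EFinB -EFinM lee_fin.
have := expR_ge1Dx (- (n.+1%:R^-1 * x)).
have : (0 < n.+1%:R :> R)%R by [].
move: n.+1%:R (expR _) => N e N0.
have -> : x = (N * (N^-1 * x))%R by rewrite mulrA mulfV ?mul1r// gt_eqF.
by rewrite mulKf ?gt_eqF// ler_pM2l//; move: (N^-1 * x)%R => z; lra.
Qed.

Lemma laplace_approx_cvg x : 0 <= x -> laplace_approx n x @[n --> \oo] --> x.
Proof.
case: x => [x| |//] x0; last first.
  have E n : laplace_approx n +oo = n.+1%:R%:E.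
    by rewrite /laplace_approx gt0_muley ?lte_fin ?invr_gt0//= sube0 mule1.
  apply/cvgeyPge => A; near=> n; rewrite E lee_fin.
  apply: (@le_trans _ _ n%:R); last by rewrite ler_nat.
  by near: n; exact: nbhs_infty_ger.
have x0' : (0 <= x)%R by rewrite -lee_fin.
(* From exp z >= 1 + z with z = x / (n + 1), the approximation is at least x / (1 + z). *)
have lo : (x * (1 + x / n.+1%:R)^-1)%:E @[n --> \oo] --> x%:E.
  apply: cvg_EFin; first exact: nearW.
  rewrite -[X in _ --> X]mulr1 -[X in (_ * X)%R]invr1.
  apply: cvgM; first exact: cvg_cst.
  apply: cvgV; first exact: oner_neq0.
  rewrite -[X in _ --> X]addr0; apply: cvgD; first exact: cvg_cst.
  rewrite -(mulr0 x); apply: cvgM; first exact: cvg_cst.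
  exact: cvg_harmonic.
apply: (squeeze_cvge _ lo (cvg_cst x%:E)).
apply: nearW => n; rewrite laplace_approx_le// andbT.
rewrite /laplace_approx /= -EFinB -EFinM lee_fin expRN.
have N0 : (0 < n.+1%:R :> R)%R by [].
rewrite -/(x / n.+1%:R)%R; set z := (x / n.+1%:R)%R; have z0 : (0 <= z)%R by rewrite divr_ge0.
have -> : x = (n.+1%:R * z)%R by rewrite mulrC divfK.
rewrite mulKf ?gt_eqF// -mulrA ler_pM2l//.
have e1 : (1 + z <= expR z)%R := expR_ge1Dx z.
have zp : (0 < 1 + z)%R by rewrite ltr_pwDl.
have : ((expR z)^-1 <= (1 + z)^-1)%R by rewrite lef_pV2// posrE (lt_le_trans zp).
have -> : (z * (1 + z)^-1 = 1 - (1 + z)^-1)%R by field; rewrite gt_eqF.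
by lra.
Unshelve. all: by end_near. Qed.

End laplace_approximation.

Lemma jump_sumZ (R : realType) (f g : R -> R) (c a b : R) : 0 < c ->
  (forall y, 0 <= g y) ->
  (jump_sum f (fun y => c * g y)%R a b = c%:E * jump_sum f g a b)%E.
Proof.
have le k h : 0 < k -> (forall y, 0 <= h y) ->
    (jump_sum f (fun y => k * h y)%R a b <= k%:E * jump_sum f h a b)%E.
  move=> k0 h0; apply: jump_sum_le => F uF Fab.
  rewrite -mulr_sumr EFinM lee_wpmul2l ?lee_fin ?(ltW k0)//.
  exact: jump_sum_ge_seq.
move=> c0 g0; apply/eqP; rewrite eq_le le//=.
have cV : 0 < c^-1 by rewrite invr_gt0.
have := le _ (fun y => c * g y) cV; under [X in jump_sum f X _ _]eq_fun do rewrite mulKf ?gt_eqF//.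
move=> /(_ (fun y => mulr_ge0 (ltW c0) (g0 y))) H.
rewrite -[leRHS]mul1e -(divff (lt0r_neq0 c0)) EFinM -muleA.
by apply: lee_wpmul2l => //; rewrite lee_fin ltW.
Qed.

Section affine_products.
Context d (T : measurableType d) (R : realType) (P : probability T R).

Let bounded_int (f : T -> R) : measurable_fun setT f -> (forall w, 0 <= f w <= 1) ->
  P.-integrable setT (EFin \o f).
Proof.
move=> mf f01; apply: measurable_bounded_integrable => //.
  by rewrite (le_lt_trans (probability_le1 P _))// ltry.
exists 1; split => // x x1 w _; have /andP[f0 f1] := f01 w.
by rewrite /= ger0_norm// (le_trans f1)// ltW.
Qed.

(** Expanding the product over subsets of indices leaves products of the [u i] over subsets, so the
    factorization is required for every subset. *)
Lemma Rintegral_affine_prod (m : nat) (u : 'I_m -> T -> R) (al be : R) :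
  (forall i, measurable_fun setT (u i)) -> (forall i w, 0 <= u i w <= 1) ->
  (forall A : {set 'I_m}, \int[P]_w (\prod_(i in A) u i w) =
     \prod_(i in A) \int[P]_w (u i w)) ->
  \int[P]_w (\prod_i (al + be * u i w)) = \prod_i (al + be * \int[P]_w (u i w)).
Proof.
move=> mu u01 uA.
pose c (A : {set 'I_m}) := \prod_(i < m) (if i \in A then al else be).
have E (x : 'I_m -> R) : \prod_i (al + be * x i) =
    \sum_(A in {set 'I_m}) c A * \prod_(i in ~: A) x i.
  rewrite bigA_distr; apply: eq_bigr => A _.
  rewrite [X in _ * X]big_mkcond -big_split; apply: eq_bigr => i _ /=.
  by rewrite inE; case: ifP; rewrite ?mulr1.
have p01 (A : {set 'I_m}) w : 0 <= \prod_(i in A) u i w <= 1.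
  elim/big_ind : _ => [|x y /andP[x0 x1] /andP[y0 y1]|i _]; last exact: u01.
    by rewrite lexx ler01.
  by rewrite mulr_ge0//= mulr_ile1.
have mp (A : {set 'I_m}) : measurable_fun setT (fun w => \prod_(i in A) u i w).
  exact: measurable_bigprod.
have ip (A : {set 'I_m}) r : P.-integrable setT
    (EFin \o (fun w => r * \prod_(i in A) u i w)).
  by under [X in integrable _ _ X]eq_fun do rewrite /= EFinM;
     apply: integrableZl => //; apply: bounded_int.
rewrite E; transitivity (\int[P]_w (\sum_(A in {set 'I_m}) c A * \prod_(i in ~: A) u i w)).
  by apply: eq_Rintegral => w _; exact: E.
have : P.-integrable setT
    (EFin \o (fun w => \sum_(A in {set 'I_m}) c A * \prod_(i in ~: A) u i w)) /\
    \int[P]_w (\sum_(A in {set 'I_m}) c A * \prod_(i in ~: A) u i w) =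
    \sum_(A in {set 'I_m}) c A * \prod_(i in ~: A) \int[P]_w (u i w).
  elim: (index_enum _) => [|A s [IH1 IH2]].
    rewrite big_nil; split.
      by under [X in integrable _ _ X]eq_fun do rewrite /= big_nil; exact: integrable0.
    by under eq_Rintegral do rewrite big_nil; rewrite Rintegral_cst// mul0r.
  have IA : P.-integrable setT (EFin \o (fun w => c A * \prod_(i in ~: A) u i w)).
    exact: ip.
  split.
    under [X in integrable _ _ X]eq_fun do rewrite /= big_cons inE EFinD.
    exact: integrableD.
  rewrite big_cons inE -IH2; under eq_Rintegral do rewrite big_cons inE.
  rewrite RintegralD//; congr (_ + _).
  by rewrite RintegralZl ?uA//; apply: bounded_int.
by case.
Qed.

End affine_products.

Section admissible_functions.
Context {R : realType}.
Implicit Types g h : R -> R.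

Lemma admissible0 : admissible (fun=> 0 : R).
Proof. by split => // y; exact: cvg_cst. Qed.

Lemma admissibleZ (c : R) g : 0 <= c -> admissible g -> admissible (fun y => c * g y).
Proof.
move=> c0 [cg g0 g00]; split => [y|y|]; last by rewrite g00 mulr0.
  by apply: cvgM; [exact: cvg_cst|exact: cg].
by rewrite mulr_ge0.
Qed.

End admissible_functions.

Section levy_expectations.
Local Open Scope ereal_scope.
Context d (T : measurableType d) (R : realType) (P : probability T R).
Variable L : R -> T -> R.
Hypothesis levL : cadlag_levy P L.

Let J g a b w := jump_sum (L ^~ w) g a b.

Let mJ g a b : admissible g -> measurable_fun setT (J g a b).
Proof. exact: (measurable_levy_jump_sum levL). Qed.

Let J0 g a b w : admissible g -> 0 <= J g a b w.
Proof. by move=> [_ g0 _]; exact: jump_sum_ge0. Qed.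

Let N (n : nat) : R := n.+1%:R.

Let u n g a b w : R := fine (expeR (- J (fun y => (N n)^-1 * g y)%R a b w)).

Let Nadm n g : admissible g -> admissible (fun y => (N n)^-1 * g y)%R.
Proof. by move=> ag; apply: admissibleZ => //; rewrite invr_ge0. Qed.

Let laplace01 (x : \bar R) : 0 <= x -> 0 <= expeR (- x) <= 1.
Proof. by move=> x0; rewrite expeR_ge0 -[leRHS]expeR0 lee_expeR oppe_le0. Qed.

Let uE n g a b w : admissible g ->
  (u n g a b w)%:E = expeR (- J (fun y => (N n)^-1 * g y)%R a b w).
Proof.
move=> ag; rewrite /u fineK//.
have /andP[a0 a1] := laplace01 (J0 a b w (Nadm n ag)).
by rewrite ge0_fin_numE// (le_lt_trans a1)// ltry.
Qed.

Let u01 n g a b w : admissible g -> (0 <= u n g a b w <= 1)%R.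
Proof.
move=> ag; have := laplace01 (J0 a b w (Nadm n ag)).
by rewrite -uE// !lee_fin.
Qed.

Let mu n g a b : admissible g -> measurable_fun setT (u n g a b).
Proof.
move=> ag; apply/measurable_EFinP; rewrite (_ : EFin \o _ =
  fun w => expeR (- J (fun y => (N n)^-1 * g y)%R a b w)); last first.
  by apply/funext => w; rewrite /= uE.
apply: (measurableT_comp (@measurable_expeR R)).
by apply: (measurableT_comp (@oppe_measurable R setT)); apply: mJ; exact: Nadm.
Qed.

(** An affine function of the bounded variable [u], of slope - N: the form to which
    [Rintegral_affine_prod] applies. *)
Let approxE n g a b w : admissible g ->
  1 + laplace_approx n (J g a b w) = (1 + N n + - N n * u n g a b w)%:E.
Proof.
move=> ag; rewrite /laplace_approx.
have := uE n a b w ag; rewrite /J jump_sumZ; last 2 first.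
- by rewrite invr_gt0.
- by case: ag.
move=> <-; rewrite -EFinB -EFinM -EFinD; congr EFin; rewrite /N; ring.
Qed.

Let int_u n g a b : admissible g -> P.-integrable setT (EFin \o u n g a b).
Proof.
move=> ag; apply: measurable_bounded_integrable => //.
- by rewrite (le_lt_trans (probability_le1 P _))// ltry.
- exact: mu.
exists 1%R; split => // x x1 w _; have /andP[f0 f1] := u01 n a b w ag.
by rewrite /= ger0_norm// (le_trans f1)// ltW.
Qed.

Let Rint_affine n g a b (al be : R) : admissible g ->
  \int[P]_w (al + be * u n g a b w)%:E = (al + be * Rintegral P setT (u n g a b))%:E.
Proof.
move=> ag; have ib : P.-integrable setT (EFin \o (fun w => be * u n g a b w)%R).
  under [X in integrable _ _ X]eq_fun do rewrite /= EFinM.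
  by apply: integrableZl => //; exact: int_u.
have ia : P.-integrable setT (EFin \o (cst al : T -> R)).
  by apply: finite_measure_integrable_cst.
under eq_integral do rewrite EFinD.
rewrite integralD//= integral_prob_cst.
under eq_integral do rewrite EFinM.
rewrite integralZl//; last exact: int_u.
rewrite EFinD EFinM /Rintegral fineK//.
by apply: integrable_fin_num => //; exact: int_u.
Qed.

Lemma expectation_jump_sum_shift g a b c : (a <= b)%R -> admissible g ->
  \int[P]_w J g (a + c)%R (b + c)%R w = \int[P]_w J g a b w.
Proof.
move=> ab ag.
have E n a' b' w : laplace_approx n (J g a' b' w) = (N n + - N n * u n g a' b' w)%:E.
  rewrite /laplace_approx; have := uE n a' b' w ag; rewrite /J jump_sumZ; last 2 first.
  - by rewrite invr_gt0.
  - by case: ag.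
  by move=> <-; rewrite -EFinB -EFinM; congr EFin; rewrite /N; ring.
have H a' b' : \int[P]_w laplace_approx n (J g a' b' w) @[n --> \oo] -->
    \int[P]_w J g a' b' w.
  apply: cvg_integral_below => [n||n w|n w|w].
  - under eq_fun do rewrite E; apply/measurable_EFinP; apply: measurable_funD => //.
    by apply: measurable_funM => //; exact: mu.
  - exact: mJ.
  - by apply: laplace_approx_ge0; exact: J0.
  - by apply: laplace_approx_le; exact: J0.
  - by apply: laplace_approx_cvg; exact: J0.
apply: (cvge_eq_limits (H _ _) (H _ _)) => n.
under eq_integral do rewrite E.
under [RHS]eq_integral do rewrite E.
apply: (eq_trans (Rint_affine n (a + c)%R (b + c)%R _ _ ag)).
apply: (eq_trans _ (esym (Rint_affine n a b _ _ ag))).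
rewrite /Rintegral.
under eq_integral do rewrite uE//.
under [in RHS]eq_integral do rewrite uE//.
by have := @laplace_stationary _ _ _ P L levL _ a b c ab (Nadm n ag); rewrite /J => ->.
Qed.

Variables (t : nat -> R) (m : nat) (g : nat -> R -> R).
Hypotheses (tm : {homo t : i j / (i <= j)%N >-> (i <= j)%R})
           (ag : forall i, admissible (g i)).

Let U n (i : 'I_m) w := u n (g i) (t i) (t i.+1) w.

(** A subset of the factors is selected by replacing [g] with 0 outside it: the Laplace factor is
    then 1. *)
Let U_indep n (A : {set 'I_m}) :
  Rintegral P setT (fun w => \prod_(i in A) U n i w)%R =
  (\prod_(i in A) Rintegral P setT (U n i))%R.
Proof.
pose inA (j : nat) := [exists i : 'I_m, (i \in A) && (val i == j)].
have inAE (i : 'I_m) : inA i = (i \in A).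
  apply/existsP/idP => [[j /andP[jA /eqP/val_inj <-]]//|iA].
  by exists i; rewrite iA eqxx.
pose g' j := if inA j then (fun y => (N n)^-1 * g j y)%R else (fun=> 0%R).
have ag' j : admissible (g' j).
  by rewrite /g'; case: ifP => _; [exact: Nadm|exact: admissible0].
have EU (i : 'I_m) w : expeR (- jump_sum (L ^~ w) (g' i) (t i) (t i.+1)) =
    if i \in A then (U n i w)%:E else 1.
  rewrite /g' inAE; case: ifP => iA; first by rewrite /U uE.
  by rewrite /jump_sum esum1// oppe0 expeR0.
have lhs : \int[P]_w (\prod_(i in A) U n i w)%:E =
    \int[P]_w \prod_(i < m) expeR (- jump_sum (L ^~ w) (g' i) (t i) (t i.+1)).
  apply: eq_integral => w _; rewrite -prodEFin big_mkcond.
  by apply: eq_bigr => i _; rewrite EU.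
rewrite /Rintegral lhs (@laplace_independent _ _ _ P L levL t m g' tm ag').
transitivity (fine (\prod_(i in A) \int[P]_w (U n i w)%:E)).
  congr fine; rewrite [RHS]big_mkcond; apply: eq_bigr => i _.
  rewrite (eq_integral (fun w => if i \in A then (U n i w)%:E else 1)) => [|w _].
    by case: ifP => // _; exact: integral_prob_cst.
  exact: EU.
rewrite (eq_bigr (fun i => (fine (\int[P]_w (U n i w)%:E))%:E)) ?prodEFin// => i _.
rewrite fineK//; apply: (@integral_prob_fin_num _ _ _ P _ 1) => w.
by rewrite !lee_fin; exact: u01.
Qed.

(** The approximations [V] are bounded and affine in independent variables, so their expectation
    factors, and they converge from below. The summand 1 keeps every factor at least 1, so that
    limits of products are harmless even if a factor tends to +oo. *)
Lemma expectation_prod_jump_sums :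
  \int[P]_w \prod_(i < m) (1 + J (g i) (t i) (t i.+1) w) =
  \prod_(i < m) \int[P]_w (1 + J (g i) (t i) (t i.+1) w).
Proof.
pose V n i w := 1 + laplace_approx n (J (g i) (t i) (t i.+1) w).
have VE n i w : V n i w = (1 + N n + - N n * u n (g i) (t i) (t i.+1) w)%:E.
  exact: approxE.
have V1 n i w : 1 <= V n i w by rewrite leeDl// laplace_approx_ge0// J0.
have Vle n i w : V n i w <= 1 + J (g i) (t i) (t i.+1) w.
  by rewrite leeD2l// laplace_approx_le// J0.
have Vcvg i w : V n i w @[n --> \oo] --> 1 + J (g i) (t i) (t i.+1) w.
  apply: cvgeD => //; last by apply: laplace_approx_cvg; exact: J0.
  exact: cvg_cst.
have mV n i : measurable_fun setT (V n i).
  rewrite (_ : V n i = EFin \o (fun w => 1 + N n + - N n * u n (g i) (t i) (t i.+1) w)%R); last first.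
    by apply/funext => w; rewrite VE.
  by apply/measurable_EFinP; apply: measurable_funD => //; apply: measurable_funM => //; exact: mu.
have V0 n i w : 0 <= V n i w by exact: le_trans (V1 n i w).
have mJ1 i : measurable_fun setT (fun w => 1 + J (g i) (t i) (t i.+1) w).
  by apply: emeasurable_funD => //; exact: mJ.
have H1 : \int[P]_w \prod_(i < m) V n i w @[n --> \oo] -->
    \int[P]_w \prod_(i < m) (1 + J (g i) (t i) (t i.+1) w).
  apply: cvg_integral_below => [n||n w|n w|w].
  - exact: emeasurable_bigprod.
  - exact: emeasurable_bigprod.
  - exact: prode_ge0.
  - exact: le_prod_ge0.
  - exact: (@cvge_prod_ge1 _ m (fun n i => V n i w) (fun i => 1 + J (g i) (t i) (t i.+1) w)).
have int1 (f : T -> \bar R) : (forall w, 1 <= f w) -> 1 <= \int[P]_w f w.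
  by move=> f1; rewrite -[leLHS](integral_prob_cst P); apply: le_integral_of_le.
have H2 : \prod_(i < m) \int[P]_w V n i w @[n --> \oo] -->
    \prod_(i < m) \int[P]_w (1 + J (g i) (t i) (t i.+1) w).
  apply: (@cvge_prod_ge1 _ m (fun n i => \int[P]_w V n i w)
    (fun i => \int[P]_w (1 + J (g i) (t i) (t i.+1) w))) => [n i|i]; first exact: int1.
  exact: cvg_integral_below.
apply: (cvge_eq_limits H1 H2) => n.
have aff := @Rintegral_affine_prod _ _ _ P m (U n) (1 + N n) (- N n)
  (fun i => mu n _ _ (ag i)) (fun i w => u01 n _ _ w (ag i)) (@U_indep n).
transitivity (\int[P]_w (\prod_(i < m) (1 + N n + - N n * U n i w))%:E).
  by apply: eq_integral => w _; rewrite -prodEFin; apply: eq_bigr => i _; rewrite VE.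
transitivity ((\prod_(i < m) (1 + N n + - N n * Rintegral P setT (U n i)))%:E).
  rewrite -aff /Rintegral fineK//.
  apply: (@integral_prob_fin_num _ _ _ P _ (\prod_(i < m) (1 + N n))) => w.
  have h i : (0 <= 1 + N n + - N n * U n i w <= 1 + N n)%R.
    have /andP[U0 U1] := u01 n (t i) (t i.+1) w (ag i).
    have N0 : (0 <= N n)%R by [].
    by rewrite -/(U n i w) in U0 U1; apply/andP; split; nra.
  rewrite !lee_fin; apply/andP; split.
    by apply: prodr_ge0 => i _; have /andP[] := h i.
  by apply: ler_prod => i _; exact: h.
rewrite -prodEFin; apply: eq_bigr => i _; rewrite -Rint_affine//.
by apply: eq_integral => w _; rewrite VE.
Qed.

End levy_expectations.

(** Cauchy's functional equation with values in [0, +oo]: nonnegativity gives monotonicity, which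
    takes the place of continuity. *)
Lemma additive_ge0_linear (R : realType) (F : R -> \bar R) :
  F 0%R = 0%E -> (forall h, 0 <= h -> (0 <= F h)%E) ->
  (forall s t, 0 <= s -> 0 <= t -> F (s + t) = (F s + F t)%E) ->
  forall h, 0 <= h -> F h = (h%:E * F 1%R)%E.
Proof.
move=> F00 F0 FD h h0.
have Fn n x : 0 <= x -> F (n%:R * x) = (n%:R%:E * F x)%E.
  move=> x0; elim: n => [|n IH]; first by rewrite mul0r mul0e.
  rewrite -natr1 mulrDl mul1r FD ?mulr_ge0// IH.
  by rewrite EFinD ge0_muleDl ?lee_fin// mul1e.
have Fle x y : 0 <= x -> x <= y -> (F x <= F y)%E.
  move=> x0 xy; have -> : y = x + (y - x) by rewrite addrC subrK.
  by rewrite FD ?subr_ge0// leeDl// F0// subr_ge0.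
have [hz|hn0] := eqVneq h 0; first by rewrite hz mul0e.
have hp : 0 < h by rewrite lt_def hn0.
have F1 := F0 1 ler01.
case E1 : (F 1) F1 => [r| |] // r0.
  have r0' : 0 <= r by rewrite -lee_fin.
  have FN n : F n%:R = (n%:R * r)%:E by rewrite -[n%:R]mulr1 Fn// E1 mulr1.
  (* Bracketing n h between [k n] and [k n + 1] places both n F(h) and n h F(1) in the same interval
     of length r = F(1). *)
  pose k n := Num.truncn (n%:R * h).
  have kn n : (k n)%:R <= n%:R * h < (k n).+1%:R.
    have : 0 <= n%:R * h by rewrite mulr_ge0.
    exact: Num.Theory.truncn_itv.
  have Fh n : (((k n)%:R * r)%:E <= n%:R%:E * F h <= ((k n).+1%:R * r)%:E)%E.
    have /andP[k1 k2] := kn n.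
    rewrite -!FN -Fn//; apply/andP; split; first exact: Fle.
    by apply: Fle; [exact: mulr_ge0|exact: ltW].
  have [x xE] : exists x, F h = x%:E.
    have := Fh 1%N; rewrite mul1e; have := F0 h h0.
    by case: (F h) => [x _ _|_ /andP[_]|//]; [exists x|rewrite leye_eq].
  rewrite xE -EFinM; congr EFin; apply/eqP; rewrite -subr_eq0 -normr_le0.
  rewrite leNgt; apply/negP => D.
  have [n nD] : exists n, r < n%:R * `|x - h * r|.
    exists (Num.bound (r / `|x - h * r|)).
    by rewrite -ltr_pdivrMr// archi_boundP// divr_ge0.
  move: nD; rewrite ltNge => /negP; apply.
  have n0 : 0 <= n%:R :> R by [].
  rewrite -{1}(ger0_norm n0) -normrM.
  have := Fh n; rewrite xE -EFinM !lee_fin => /andP[a1 a2].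
  have /andP[k1 k2] := kn n; have := ltW k2 => {}k2.
  have b1 := ler_wpM2r r0' k1; have b2 := ler_wpM2r r0' k2.
  move: a2 b2; rewrite -natr1 mulrDl mul1r => a2 b2.
  rewrite ler_norml mulrBr mulrA; apply/andP; split; lra.
rewrite gt0_muley ?lte_fin//.
(* When F(1) = +oo, a multiple of [h] that reaches 1 has infinite value, and hence so does [h]. *)
have [n nh] : exists n, 1 <= n%:R * h.
  exists (Num.bound h^-1); rewrite -ler_pdivrMr// div1r ltW//.
  by rewrite archi_boundP// invr_ge0.
have : F (n%:R * h) = +oo%E.
  by apply/eqP; rewrite -leye_eq -E1 Fle.
rewrite Fn//; have := F0 h h0.
by case: (F h) => [x _| |//] //; rewrite -EFinM.
Qed.

Lemma cvg_compound (R : realType) (x : \bar R) : (0 <= x)%E ->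
  (\prod_(k < n.+1) (1 + n.+1%:R^-1%:E * x))%E @[n --> \oo] --> expeR x.
Proof.
case: x => [x| |//] x0; last first.
  have E n : (\prod_(k < n.+1) (1 + n.+1%:R^-1%:E * +oo) = +oo :> \bar R)%E.
    rewrite gt0_muley ?lte_fin ?invr_gt0//= big_ord_recl gt0_mulye//.
    by rewrite (@lt_le_trans _ _ 1%E)// prod_ge1// => i; exact: leey.
  by under eq_fun do rewrite E; exact: cvg_cst.
have x0' : 0 <= x by rewrite -lee_fin.
have zn n : 0 <= n.+1%:R^-1 * x by rewrite mulr_ge0// invr_ge0.
have E n : (\prod_(k < n.+1) (1 + n.+1%:R^-1%:E * x%:E) =
    ((1 + n.+1%:R^-1 * x) ^+ n.+1)%:E :> \bar R)%E.
  by rewrite -EFinM -EFinD prodEFin prodr_const card_ord.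
under eq_fun do rewrite E.
(* From 1 + z >= exp (z / (1 + z)) with z = x / (n + 1), raised to the power n + 1. *)
have lo : (expR (x / (1 + x / n.+1%:R)))%:E @[n --> \oo] --> expeR x%:E.
  apply: (@cvg_expeR _ _ _ _ (fun n => (x / (1 + x / n.+1%:R))%:E)).
  apply: cvg_EFin; first exact: nearW.
  rewrite -[X in _ --> X]mulr1 -[X in (_ * X)%R]invr1.
  apply: cvgM; first exact: cvg_cst.
  apply: cvgV; first exact: oner_neq0.
  rewrite -[X in _ --> X]addr0; apply: cvgD; first exact: cvg_cst.
  rewrite -(mulr0 x); apply: cvgM; first exact: cvg_cst.
  exact: cvg_harmonic.
apply: (squeeze_cvge _ lo (cvg_cst (expeR x%:E))).
apply: nearW => n /=; rewrite !lee_fin.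
have N0 : n.+1%:R != 0 :> R by rewrite pnatr_eq0.
rewrite [x / n.+1%:R]mulrC; set z := n.+1%:R^-1 * x.
have xE : x = n.+1%:R * z by rewrite /z mulrA mulfV// mul1r.
have z0 : 0 <= z by exact: zn.
apply/andP; split.
  have -> : x / (1 + z) = n.+1%:R * (z / (1 + z)) by rewrite {1}xE mulrA.
  rewrite expRM_natl lerXn2r ?nnegrE ?expR_ge0 ?addr_ge0//.
  have zp : 0 < 1 + z by rewrite ltr_pwDl.
  have := expR_ge1Dx (- (z / (1 + z))).
  have -> : 1 + - (z / (1 + z)) = (1 + z)^-1 by field; rewrite gt_eqF.
  by rewrite expRN lef_pV2// posrE ?expR_gt0.
rewrite xE expRM_natl lerXn2r ?nnegrE ?expR_ge0 ?addr_ge0//.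
exact: expR_ge1Dx.
Qed.

Section admissible_closure.
Context {R : realType}.
Implicit Types g : R -> R.

Lemma admissible_ln g : admissible g -> admissible (fun y => ln (1 + g y)).
Proof.
move=> [cg g0 g00]; split => [y|y|]; last by rewrite g00 addr0 ln1.
  have g1 : 0 < 1 + g y by rewrite ltr_pwDl.
  apply: (@continuous_comp _ _ _ (fun y => 1 + g y) (@ln R)).
    by apply: cvgD; [exact: cvg_cst|exact: cg].
  exact: continuous_ln.
by rewrite ln_ge0// lerDl.
Qed.

Lemma admissible_sqr g : admissible g -> admissible (fun y => g y ^+ 2).
Proof.
move=> [cg g0 g00]; split => [y|y|]; last by rewrite g00 expr0n.
  by apply: cvgM; exact: cg.
by rewrite exprn_ge0.
Qed.

End admissible_closure.

(** * Intensities, the exponential formula and second moments *)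

Section levy_intensity.
Local Open Scope ereal_scope.
Context d (T : measurableType d) (R : realType) (P : probability T R).
Variable L : R -> T -> R.
Hypothesis levL : cadlag_levy P L.

Let J g a b w := jump_sum (L ^~ w) g a b.

Let mJ g a b : admissible g -> measurable_fun setT (J g a b).
Proof. exact: (measurable_levy_jump_sum levL). Qed.

Let J0 g a b w : admissible g -> 0 <= J g a b w.
Proof. by move=> [_ g0 _]; exact: jump_sum_ge0. Qed.

(** For admissible [g] this is the integral of [g] against the Levy measure of [L], taken directly
    as an expected jump sum over unit time. *)
Definition jump_intensity (g : R -> R) := \int[P]_w jump_sum (L ^~ w) g 0%R 1%R.

Lemma jump_intensity_ge0 g : admissible g -> 0 <= jump_intensity g.
Proof. by move=> ag; apply: integral_ge0 => w _; exact: J0. Qed.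

(** By stationarity the expectation depends on the length of the interval alone, and by additivity
    it is a nonnegative additive function of that length, hence linear. *)
Lemma expectation_jump_sum g a b : admissible g -> (a <= b)%R ->
  \int[P]_w jump_sum (L ^~ w) g a b = (b - a)%:E * jump_intensity g.
Proof.
move=> ag ab; pose F h := \int[P]_w J g 0%R h w.
have Fshift s t : (0 <= t)%R -> \int[P]_w J g s (s + t)%R w = F t.
  move=> t0; have := @expectation_jump_sum_shift _ _ _ P L levL g 0%R t s t0 ag.
  by rewrite add0r addrC.
have -> : \int[P]_w jump_sum (L ^~ w) g a b = F (b - a)%R.
  by rewrite -(Fshift a) ?subr_ge0// addrC subrK.
apply: (@additive_ge0_linear _ F) => [|h h0|s t s0 t0|]; last by rewrite subr_ge0.
- rewrite /F /J; under eq_integral do rewrite jump_sum_empty//.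
  exact: integral_prob_cst.
- by apply: integral_ge0 => w _; exact: J0.
rewrite -(Fshift s t)// /F -ge0_integralD//; last 4 first.
- by move=> w _; exact: J0.
- exact: mJ.
- by move=> w _; exact: J0.
- exact: mJ.
apply: eq_integral => w _; rewrite /J (@jump_sum_cat _ _ g 0%R s)//.
- by case: ag.
- by rewrite lerDl.
Qed.

(** The exponential formula for jump sums, over [m] successive intervals at once. On grids with N
    cells the i-th factor has expectation (1 + x i / N)^N, which tends to exp (x i); a common
    refinement makes all cells independent together. *)
Lemma expectation_prod_expeR (t : nat -> R) (m : nat) (g : nat -> R -> R) :
  {homo t : i j / (i <= j)%N >-> (i <= j)%R} -> (forall i, admissible (g i)) ->
  \int[P]_w \prod_(i < m)
     expeR (jump_sum (L ^~ w) (fun y => ln (1 + g i y))%R (t i) (t i.+1)) =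
  \prod_(i < m) expeR ((t i.+1 - t i)%:E * jump_intensity (g i)).
Proof.
move=> tm ag; have g0 i y : (0 <= g i y)%R by have [] := ag i.
have tS i : (t i <= t i.+1)%R by exact: tm.
pose F n i w := \prod_(k < n.+1) (1 + cell_sum (L ^~ w) (g i) (t i) (t i.+1) n k).
pose E i w := expeR (jump_sum (L ^~ w) (fun y => ln (1 + g i y))%R (t i) (t i.+1)).
have mF n i : measurable_fun setT (F n i).
  by apply: emeasurable_bigprod => k _; apply: emeasurable_funD => //; exact: mJ.
have mE i : measurable_fun setT (E i).
  apply: (measurableT_comp (@measurable_expeR R)); apply: mJ.
  exact: admissible_ln.
have F1 n i w : 1 <= F n i w.
  by apply: prod_ge1 => k; rewrite leeDl// cell_sum_ge0.
have F0 n i w : 0 <= F n i w by exact: le_trans (F1 n i w).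
have H1 : \int[P]_w \prod_(i < m) F n i w @[n --> \oo] --> \int[P]_w \prod_(i < m) E i w.
  apply: cvg_integral_below => [n||n w|n w|w].
  - exact: emeasurable_bigprod.
  - exact: emeasurable_bigprod.
  - exact: prode_ge0.
  - by apply: le_prod_ge0 => i _ //; exact: prod_cells_le.
  - apply: (@cvge_prod_ge1 _ m (fun n i => F n i w) (fun i => E i w)) => // i.
    exact: prod_cells_cvg.
pose x i := (t i.+1 - t i)%:E * jump_intensity (g i).
have x0 i : 0 <= x i.
  by rewrite mule_ge0 ?jump_intensity_ge0// lee_fin subr_ge0.
have H2 : \prod_(i < m) \prod_(k < n.+1) (1 + n.+1%:R^-1%:E * x i) @[n --> \oo] -->
    \prod_(i < m) expeR (x i).
  apply: (@cvge_prod_ge1 _ m (fun n i => \prod_(k < n.+1) (1 + n.+1%:R^-1%:E * x i))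
    (fun i => expeR (x i))) => [n i|i]; last exact: cvg_compound.
  by apply: prod_ge1 => k; rewrite leeDl// mule_ge0// lee_fin invr_ge0.
apply: (cvge_eq_limits H1 H2) => n.
pose X w i k := 1 + cell_sum (L ^~ w) (g i) (t i) (t i.+1) n k.
transitivity (\int[P]_w \prod_(j < m * n.+1) X w (j %/ n.+1)%N (j %% n.+1)%N).
  by apply: eq_integral => w _; rewrite (big_blocks _ _ (X w)).
pose tau := refine_times t n.
have XE w (j : 'I_(m * n.+1)) : X w (j %/ n.+1)%N (j %% n.+1)%N =
    1 + J (g (j %/ n.+1)%N) (tau j) (tau j.+1) w.
  by rewrite /J /tau refine_timesS.
transitivity (\prod_(j < m * n.+1) \int[P]_w X w (j %/ n.+1)%N (j %% n.+1)%N).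
  transitivity (\int[P]_w \prod_(j < m * n.+1)
      (1 + J (g (j %/ n.+1)%N) (tau j) (tau j.+1) w)).
    by apply: eq_integral => w _; apply: eq_bigr => j _; rewrite XE.
  rewrite (@expectation_prod_jump_sums _ _ _ P L levL tau (m * n.+1)
    (fun j => g (j %/ n.+1)%N) (@refine_times_homo _ t n tm) (fun j => ag _)).
  by apply: eq_bigr => j _; apply: eq_integral => w _; rewrite XE.
rewrite (@big_blocks _ _ _ m n.+1 (fun i k => \int[P]_w X w i k))//.
apply: eq_bigr => i _; apply: eq_bigr => k _.
rewrite /X ge0_integralD//; last 2 first.
- by move=> w _; exact: cell_sum_ge0.
- exact: mJ.
rewrite integral_prob_cst /cell_sum expectation_jump_sum//; last exact: grid_le.
rewrite gridS addrAC subrr add0r /x muleA -EFinM; congr (1 + _%:E * _).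
by rewrite mulrC.
Qed.

(** The product formula is applied with [g], 0 and [g] on ]a, b], ]b, c] and ]c, e]. In the
    expansion of (1 + x) (1 + y) the terms 1, x and y are then cancelled, which is where the finite
    intensity enters. *)
Lemma expectation_mul_jump_sum g a b c e : admissible g ->
  (a <= b)%R -> (b <= c)%R -> (c <= e)%R -> jump_intensity g \is a fin_num ->
  \int[P]_w (jump_sum (L ^~ w) g a b * jump_sum (L ^~ w) g c e) =
  ((b - a)%:E * jump_intensity g) * ((e - c)%:E * jump_intensity g).
Proof.
move=> ag ab bc ce fin.
pose t (j : nat) : R := match j with 0%N => a | 1%N => b | 2%N => c | _ => e end.
have tm : {homo t : i j / (i <= j)%N >-> (i <= j)%R}.
  apply: homo_leq => [x|x y z|j]; [exact: lexx|exact: le_trans|].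
  by case: j => [|[|[|j]]] //=.
pose g' (j : nat) := if j == 1%N then (fun=> 0%R) else g.
have ag' j : admissible (g' j).
  by rewrite /g'; case: ifP => // _; exact: admissible0.
have := @expectation_prod_jump_sums _ _ _ P L levL t 3 g' tm ag'.
have z w : jump_sum (L ^~ w) (fun=> 0%R) b c = 0 by rewrite /jump_sum esum1.
pose x w := J g a b w; pose y w := J g c e w.
have [x0 y0] : (forall w, 0 <= x w) /\ (forall w, 0 <= y w) by split => w; exact: J0.
have mx : measurable_fun setT x by exact: mJ.
have my : measurable_fun setT y by exact: mJ.
have prodE w : \prod_(i < 3) (1 + jump_sum (L ^~ w) (g' i) (t i) (t i.+1)) =
    1 + (x w + (y w + x w * y w)).
  transitivity ((1 + x w) * (1 + y w)).
    by rewrite !big_ord_recl big_ord0 /= /bump /= z adde0 mul1e mule1.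
  rewrite ge0_muleDl ?adde_ge0// mul1e.
  by rewrite ge0_muleDr// mule1 -!addeA; congr (1 + _); rewrite addeCA.
under eq_integral do rewrite prodE.
have mxy : measurable_fun setT (fun w => x w * y w) by exact: emeasurable_funM.
have xy0 w : 0 <= x w * y w by rewrite mule_ge0.
have myxy : measurable_fun setT (fun w => y w + x w * y w) by exact: emeasurable_funD.
rewrite ge0_integralD//; last 2 first.
- by move=> w _; rewrite !adde_ge0.
- exact: emeasurable_funD.
rewrite ge0_integralD//; last by move=> w _; rewrite adde_ge0.
rewrite ge0_integralD// integral_prob_cst.
rewrite !big_ord_recl big_ord0 /= mule1.
have i1 (f : T -> \bar R) : measurable_fun setT f -> (forall w, 0 <= f w) ->
    \int[P]_w (1 + f w) = 1 + \int[P]_w f w.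
  by move=> mf f0; rewrite ge0_integralD// integral_prob_cst.
rewrite !i1//; last 2 first.
- exact: mJ.
- by move=> w; exact: J0.
have -> : \int[P]_w jump_sum (L ^~ w) (g' (bump 0 0)) b c = 0.
  by under eq_integral do rewrite z; exact: integral_prob_cst.
rewrite adde0 mul1e.
have -> : \int[P]_w x w = (b - a)%:E * jump_intensity g by exact: expectation_jump_sum.
have -> : \int[P]_w y w = (e - c)%:E * jump_intensity g by exact: expectation_jump_sum.
rewrite -(fineK fin) -!EFinM.
move: (_ * fine _)%R (_ * fine _)%R => al be.
have -> : \int[P]_w (jump_sum (L ^~ w) g a b * jump_sum (L ^~ w) g c e) =
  \int[P]_w (x w * y w) by [].
case: (\int[P]_w _) => [r| |] //.
by rewrite -!EFinD => -[] H; congr EFin; lra.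
Qed.

(** The diagonal gives the intensity of the squares. With c the intensity of [g], each of the N (N -
    1) ordered pairs of distinct cells contributes (c / N)^2, in total c^2 (1 - 1 / N). *)
Lemma expectation_sqr_jump_sum g : admissible g -> jump_intensity g \is a fin_num ->
  \int[P]_w (jump_sum (L ^~ w) g 0%R 1%R * jump_sum (L ^~ w) g 0%R 1%R) =
  jump_intensity (fun y => g y ^+ 2)%R + jump_intensity g * jump_intensity g.
Proof.
move=> ag fin; have g0 y : (0 <= g y)%R by have [] := ag.
have ag2 := admissible_sqr ag.
have [c0 cE] : exists c0, jump_intensity g = c0%:E.
  by exists (fine (jump_intensity g)); rewrite fineK.
pose cell n k w := cell_sum (L ^~ w) g 0 1 n k.
have cell0 n k w : 0 <= cell n k w by exact: cell_sum_ge0.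
have mcell n k : measurable_fun setT (cell n k) by exact: mJ.
have gS n k : (grid 0 1 n k.+1 - grid 0 1 n k = n.+1%:R^-1 :> R)%R.
  by rewrite gridS addrAC subrr add0r subr0 mul1r.
have cellM n k l : (k != l)%N ->
    \int[P]_w (cell n k w * cell n l w) = ((n.+1%:R^-1 * c0) ^+ 2)%:E.
  wlog kl : k l / (k < l)%N => [H|_].
    rewrite neq_ltn => /orP[kl|kl].
      by apply: H => //; rewrite ltn_eqF.
    by under eq_integral do rewrite muleC; apply: H => //; rewrite ltn_eqF.
  rewrite /cell /cell_sum expectation_mul_jump_sum//; [|exact: grid_le..].
  by rewrite !gS cE -!EFinM expr2.
pose S w := jump_sum (L ^~ w) (fun y => g y ^+ 2)%R 0%R 1%R.
pose Q n w := \sum_(k < n.+1) \sum_(l < n.+1 | l != k) cell n k w * cell n l w.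
have mQ n : measurable_fun setT (Q n).
  apply: emeasurable_sum => k; under eq_fun do rewrite big_mkcond.
  apply: emeasurable_sum => l; case: (l != k) => //.
  exact: emeasurable_funM.
have Q0 n w : 0 <= Q n w.
  by apply: sume_ge0 => k _; apply: sume_ge0 => l _; rewrite mule_ge0.
have mS : measurable_fun setT S by exact: mJ.
have S0 w : 0 <= S w by exact: J0.
have H1 : \int[P]_w (S w + Q n w) @[n --> \oo] --> \int[P]_w (J g 0%R 1%R w * J g 0%R 1%R w).
  apply: cvg_integral_below => [n||n w|n w|w].
  - exact: emeasurable_funD.
  - by apply: emeasurable_funM; exact: mJ.
  - by rewrite adde_ge0.
  - exact: sq_cells_le.
  - exact: sq_cells_cvg.
have QE n : \int[P]_w Q n w = (c0 ^+ 2 * (1 - n.+1%:R^-1))%:E.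
  rewrite /Q ge0_integral_sum//; last 2 first.
  - move=> k; under eq_fun do rewrite big_mkcond.
    apply: emeasurable_sum => l; case: (l != k) => //.
    exact: emeasurable_funM.
  - by move=> k w _; apply: sume_ge0 => l _; rewrite mule_ge0.
  transitivity (\sum_(k < n.+1) \sum_(l < n.+1 | l != k) ((n.+1%:R^-1 * c0) ^+ 2)%:E).
    apply: eq_bigr => k _; rewrite big_mkcond.
    under eq_integral do rewrite big_mkcond.
    rewrite ge0_integral_sum//; last 2 first.
    - by move=> l; case: (l != k) => //; exact: emeasurable_funM.
    - by move=> l w _; case: ifP => // _; rewrite mule_ge0.
    apply: eq_bigr => l _; case: eqVneq => [_|lk].
      exact: integral_prob_cst.
    by rewrite cellM// eq_sym.
  under eq_bigr do rewrite sumEFin sumr_const.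
  have cardE (k : 'I_n.+1) : #|[pred l : 'I_n.+1 | l != k]| = n.
    by have := cardC1 k; rewrite card_ord.
  under eq_bigr do rewrite cardE.
  rewrite sumEFin sumr_const card_ord; congr EFin.
  have nE : (n%:R = n.+1%:R - 1 :> R)%R by rewrite -natr1 addrK.
  have N0 : (n.+1%:R != 0 :> R)%R by rewrite pnatr_eq0.
  rewrite -[LHS]mulr_natr -[X in (X * _)%R]mulr_natr nE.
  move: (n.+1%:R)%R N0 => K K0.
  by field.
have H2 : \int[P]_w S w + (c0 ^+ 2 * (1 - n.+1%:R^-1))%:E @[n --> \oo] -->
    jump_intensity (fun y => g y ^+ 2)%R + jump_intensity g * jump_intensity g.
  apply: cvgeD.
  - by apply: ge0_adde_def; rewrite inE ?mule_ge0 ?jump_intensity_ge0.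
  - exact: cvg_cst.
  - rewrite cE -EFinM -expr2; apply: cvg_EFin; first exact: nearW.
    rewrite -[X in _ --> X]mulr1; apply: cvgM; first exact: cvg_cst.
    rewrite -[X in _ --> X]subr0; apply: cvgB; first exact: cvg_cst.
    exact: cvg_harmonic.
apply: (cvge_eq_limits H1 H2) => n.
by rewrite ge0_integralD// QE.
Qed.

End levy_intensity.

(** * Summability of the squared jumps *)

Lemma null_bigcup d (T : measurableType d) (R : realType)
    (mu : {measure set T -> \bar R}) (F : nat -> set T) :
  (forall n, measurable (F n)) -> (forall n, mu (F n) = 0%E) ->
  mu (\bigcup_n F n) = 0%E.
Proof.
move=> mF F0; apply/eqP; rewrite eq_le measure_ge0 andbT.
apply: le_trans (measure_sigma_subadditive mu mF (bigcup_measurable (fun n _ => mF n)) _) _ => //.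
by rewrite eseries0// => n _ _; exact: F0.
Qed.

Section square_jumps.
Local Open Scope ereal_scope.
Context d (T : measurableType d) (R : realType) (P : probability T R).
Variable L : R -> T -> R.
Hypothesis levL : cadlag_levy P L.

Lemma jump_sum_sub (f g : R -> R) a b a' b' : (forall y, (0 <= g y)%R) ->
  (a' <= a)%R -> (b <= b')%R -> jump_sum f g a b <= jump_sum f g a' b'.
Proof.
move=> g0 aa bb; have [ba|/ltW ab] := leP b a.
  by rewrite [leLHS]jump_sum_empty// jump_sum_ge0.
rewrite (@jump_sum_cat _ f g a' a b')//; last exact: le_trans bb.
by rewrite (@jump_sum_cat _ f g a b b')// addeCA leeDl// adde_ge0// jump_sum_ge0.
Qed.

Let J g a b w := jump_sum (L ^~ w) g a b.

Let mJ g a b : admissible g -> measurable_fun setT (J g a b).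
Proof. exact: (measurable_levy_jump_sum levL). Qed.

Let sq (y : R) : R := (y ^+ 2)%R.

Let sq0 y : (0 <= sq y)%R. Proof. exact: sqr_ge0. Qed.

Lemma admissible_sq : admissible (fun y : R => y ^+ 2)%R.
Proof.
split => [y|y|]; last by rewrite expr0n.
  by apply: cvgM; exact: cvg_id.
exact: sqr_ge0.
Qed.

(** A bounded substitute for the square, comparable to min (1, y^2); whether its intensity is finite
    decides whether the squared jumps are summable. *)
Let sat (y : R) : R := (1 - expR (- (y ^+ 2)))%R.

Let sat_adm : admissible sat.
Proof.
split => [y|y|]; rewrite /sat.
- apply: cvgB; first exact: cvg_cst.
  apply: (@continuous_comp _ _ _ (fun y : R => - (y ^+ 2))%R (@expR R)).
    by apply: cvgN; apply: cvgM; exact: cvg_id.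
  exact: continuous_expR.
- by rewrite subr_ge0 -[leRHS]expR0 ler_expR oppr_le0 sqr_ge0.
- by rewrite expr0n oppr0 expR0 subrr.
Qed.

Let big (y : R) : R := Num.max (y ^+ 2 - 1)%R 0%R.

Let big_adm : admissible big.
Proof.
split => [y|y|]; rewrite /big.
- apply: (@continuous_max _ R (fun y => y ^+ 2 - 1)%R (fun=> 0%R)).
    by apply: cvgB; [apply: cvgM; exact: cvg_id|exact: cvg_cst].
  exact: cvg_cst.
- by rewrite le_max lexx orbT.
- by rewrite expr0n sub0r; apply/max_idPr; rewrite oppr_le0.
Qed.

Let big_flat : flat_near0 big.
Proof.
exists 1%R => // y y1; apply/max_idPr; rewrite subr_le0 -real_normK ?num_real//.
by rewrite -[leRHS](expr1n _ 2) lerXn2r ?nnegrE.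
Qed.

(** Write z = y^2. For z <= 1 one has 1 - exp (- z) >= z / (1 + z) >= z / 2; for z > 1 the first
    term is at least 1 and the second is z - 1. *)
Let sq_le y : (sq y <= 2 * sat y + big y)%R.
Proof.
rewrite /sq /sat /big; have := sqr_ge0 y; move: (y ^+ 2)%R => z z0.
have e1 := expR_ge1Dx z; have zp : (0 < 1 + z)%R by rewrite ltr_pwDl.
have e2 : ((expR z)^-1 <= (1 + z)^-1)%R by rewrite lef_pV2// posrE ?expR_gt0.
rewrite expRN; have [z1|z1] := leP z 1%R.
  have -> : Num.max (z - 1)%R 0%R = 0%R by apply/max_idPr; rewrite subr_le0.
  have : (z / 2 <= 1 - (1 + z)^-1)%R.
    have -> : (1 - (1 + z)^-1 = z / (1 + z))%R by field; rewrite gt_eqF.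
    by rewrite ler_wpM2l// lef_pV2 ?posrE//; lra.
  by lra.
have -> : Num.max (z - 1)%R 0%R = (z - 1)%R by apply/max_idPl; lra.
have : ((1 + z)^-1 <= 2^-1)%R by rewrite lef_pV2 ?posrE//; lra.
by lra.
Qed.

(** The [sat] sum over each ]-n, n] has finite expectation and so is almost surely finite, while
    [big] picks up only finitely many jumps of a cadlag path. *)
Let sq_finite : jump_intensity P L sat < +oo ->
  exists N, [/\ measurable N, P N = 0 &
    forall w, ~ N w -> forall a b, J sq a b w < +oo].
Proof.
move=> c0; pose Nn (n : nat) := [set w | J sat (- n%:R)%R n%:R w = +oo].
have mNn n : measurable (Nn n).
  have := mJ (- n%:R)%R n%:R sat_adm.
  by move=> /(_ measurableT [set +oo]) /=; rewrite setTI; exact.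
have PNn n : P (Nn n) = 0.
  have nn : (- n%:R <= n%:R :> R)%R by rewrite (le_trans _ (ler0n _ _))// oppr_le0.
  have : P.-integrable setT (J sat (- n%:R)%R n%:R).
    apply/integrableP; split; first exact: mJ.
    have E w : `|J sat (- n%:R)%R n%:R w| = J sat (- n%:R)%R n%:R w.
      by rewrite gee0_abs// jump_sum_ge0//; case: sat_adm.
    under eq_integral do rewrite E.
    rewrite (expectation_jump_sum levL sat_adm nn).
    by rewrite lte_mul_pinfty// lee_fin subr_ge0.
  move=> /(integrable_ae measurableT)[A [mA A0 sA]].
  apply/eqP; rewrite eq_le measure_ge0 andbT -A0 le_measure ?inE//.
  by move=> w /= Nw; apply: sA => /= /(_ I); rewrite Nw.
exists (\bigcup_n Nn n); split.
- exact: bigcup_measurable.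
- exact: null_bigcup.
move=> w Nw a b.
pose n := Num.bound (Num.max `|a| `|b|)%R.
have [an bn] : (- n%:R <= a)%R /\ (b <= n%:R)%R.
  have : (Num.max `|a| `|b| < n%:R)%R by rewrite archi_boundP// le_max normr_ge0.
  rewrite gt_max !ltr_norml => /andP[/andP[h1 _] /andP[_ h2]].
  by split; exact: ltW.
apply: (le_lt_trans (jump_sum_sub _ sq0 an bn)).
have nn : (- n%:R <= n%:R :> R)%R by rewrite (le_trans _ (ler0n _ _))// oppr_le0.
have s0 y : (0 <= 2 * sat y)%R by rewrite mulr_ge0//; have [] := sat_adm.
have b0 y : (0 <= big y)%R by have [] := big_adm.
apply: (le_lt_trans (le_jump_sum _ _ _ sq_le)); rewrite jump_sumD//.
have [fin _] := grid_sum_cvg (cadlag_levy_cadlag levL w) big_adm big_flat nn.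
rewrite lte_add_pinfty//; last by rewrite ltey_eq fin.
rewrite jump_sumZ//; last by case: sat_adm.
rewrite lte_mul_pinfty// ltey; apply/eqP => E; apply: Nw; exists n => //.
Qed.

Let mJneq a b : measurable [set w | J sq a b w != +oo].
Proof.
have mset : measurable [set~ +oo : \bar R] by apply: measurableC; exact: emeasurable_set1.
rewrite (_ : [set w | _] = setT `&` J sq a b @^-1` [set~ +oo]).
  by apply: mJ => //; exact: admissible_sq.
by apply/seteqP; split => w /=; [move=> /eqP; split|case=> _ /eqP].
Qed.

(** By independence E exp (- J) is the product over cells of q = E exp (- cell sum), hence at most
    exp (- sum of (1 - q)). The sum of the 1 - q is the expectation of [G], which asymptotically
    dominates the [sat] sum and therefore tends to +oo in mean. So E exp (- J) = 0 and J is almost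
    surely infinite. *)
Let sq_infinite_on a b : jump_intensity P L sat = +oo -> (a < b)%R ->
  P [set w | J sq a b w != +oo] = 0.
Proof.
move=> c0 ab; have ab' := ltW ab.
have asq := admissible_sq.
pose cell n k w := cell_sum (L ^~ w) sq a b n k.
have cell0 n k w : 0 <= cell n k w by exact: cell_sum_ge0.
have mlap (u : T -> \bar R) : measurable_fun setT u ->
    measurable_fun setT (fun w => expeR (- u w)).
  move=> mu; apply: (measurableT_comp (@measurable_expeR R)).
  exact: (measurableT_comp (@oppe_measurable R setT)).
have lap01 (x : \bar R) : 0 <= x -> 0 <= expeR (- x) <= 1.
  by move=> x0; rewrite expeR_ge0 -[leRHS]expeR0 lee_expeR oppe_le0.
have mcell n k : measurable_fun setT (cell n k) by exact: mJ.
pose q n k := \int[P]_w expeR (- cell n k w).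
have q01 n k : 0 <= q n k <= 1.
  apply/andP; split; last by apply: integral_prob_le => w; exact: lap01.
  by apply: integral_ge0 => w _; exact: expeR_ge0.
have qfin n k : q n k \is a fin_num.
  by have /andP[q0 q1] := q01 n k; rewrite ge0_fin_numE// (le_lt_trans q1)// ltry.
pose p := \int[P]_w expeR (- J sq a b w).
have pE n : p = \prod_(k < n.+1) q n k.
  have tm : {homo grid a b n : i j / (i <= j)%N >-> (i <= j)%R}.
    by move=> i j ij; exact: grid_le.
  have := @laplace_independent _ _ _ P L levL (grid a b n) n.+1 (fun=> sq) tm (fun=> asq).
  move=> <-; apply: eq_integral => w _.
  rewrite (prod_expeR _ xpredT (fun k : 'I_n.+1 => - cell n k w)).
  congr expeR; rewrite /J -(sum_cell_sum (L ^~ w) n sq0 ab').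
  rewrite -sumeN// => i j _ _; apply: ge0_adde_def; rewrite inE; exact: cell0.
pose G n w := \sum_(k < n.+1) (1 - expeR (- cell n k w)).
have D0 n k w : 0 <= 1 - expeR (- cell n k w).
  by rewrite sube_ge0 ?orbT//; have /andP[] := lap01 _ (cell0 n k w).
have mD n k : measurable_fun setT (fun w => 1 - expeR (- cell n k w)).
  by apply: emeasurable_funB => //; exact: mlap.
have mG n : measurable_fun setT (G n) by apply: emeasurable_sum.
have G0 n w : 0 <= G n w by apply: sume_ge0.
have GE n : \int[P]_w G n w = \sum_(k < n.+1) (1 - q n k).
  rewrite ge0_integral_sum//; apply: eq_bigr => k _.
  have ml := mlap _ (mcell n k).
  rewrite integralB//; first by rewrite integral_prob_cst.
  - by apply: finite_measure_integrable_cst.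
  - apply/integrableP; split => //.
    by under eq_integral do rewrite gee0_abs ?expeR_ge0//; rewrite -ge0_fin_numE ?qfin//; case/andP : (q01 n k).
have Jsat0 w : 0 <= J sat a b w by apply: jump_sum_ge0; case: sat_adm.
have Ginf K : \forall n \near \oo, K%:E < \int[P]_w G n w.
  (* What is known about [G] are lower bounds; truncated by the [sat] sum it converges to that sum
     from below. *)
  have H : \int[P]_w mine (G n w) (J sat a b w) @[n --> \oo] --> \int[P]_w J sat a b w.
    apply: cvg_integral_below => [n||n w|n w|w].
    - by apply: measurable_mine => //; exact: mJ.
    - exact: mJ.
    - by rewrite le_min G0 Jsat0.
    - by rewrite ge_min lexx orbT.
    - apply: cvge_below => [n|M MJ]; first by rewrite ge_min lexx orbT.
      have := sum_laplace_cells_gt sq0 ab' MJ.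
      by apply: filterS => n MG; rewrite lt_min MJ andbT.
  rewrite (expectation_jump_sum levL sat_adm ab') c0 gt0_muley ?lte_fin ?subr_gt0// in H.
  have := cvge_gt H (ltry K); apply: filterS => n /lt_le_trans; apply.
  by apply: le_integral_of_le => w _; rewrite ?le_min ?G0 ?Jsat0// ge_min lexx.
have p0 : 0 <= p by apply: integral_ge0 => w _; exact: expeR_ge0.
have p00 : p = 0.
  have := p0; rewrite le_eqVlt => /predU1P[//|pp]; exfalso.
  have lp : expeR (lne p) = p by apply/eqP; rewrite lneK_eq.
  have pfin : p \is a fin_num.
    rewrite ge0_fin_numE// (@le_lt_trans _ _ 1) ?ltry//.
    by apply: integral_prob_le => w; apply: lap01; exact: jump_sum_ge0.
  have [l lE] : exists l : R, lne p = l%:E.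
    case E : (lne p) => [l| |]; first by exists l.
      by move: lp pfin; rewrite E /= => <-.
    by move: lp pp; rewrite E /= => <-; rewrite ltxx.
  have := filter_ex (Ginf (- l)%R) => -[n]; rewrite GE => ln.
  have : p <= expeR (- \sum_(k < n.+1) (1 - q n k)).
    rewrite (pE n) -sumeN; last first.
      move=> i j _ _; apply: ge0_adde_def; rewrite inE sube_ge0 ?orbT//.
        by have /andP[] := q01 n i.
      by have /andP[] := q01 n j.
    rewrite -prod_expeR; apply: le_prod_ge0 => k _.
      by have /andP[] := q01 n k.
    apply: le_trans (expeR_ge1Dx _).
    by rewrite oppeB ?addeA ?subee ?add0e// fin_num_adde_defl.
  rewrite -lp lee_expeR lE leNgt => /negP; apply.
  by rewrite lteNl -EFinN.
have [_] := @ae_eq_integral_abs _ _ _ P setT measurableT (fun w => expeR (- J sq a b w)) (mlap _ (mJ _ _ asq)).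
have [+ _] := @ae_eq_integral_abs _ _ _ P setT measurableT (fun w => expeR (- J sq a b w)) (mlap _ (mJ _ _ asq)).
have -> : \int[P]_w `|expeR (- J sq a b w)| = p.
  by apply: eq_integral => w _; rewrite gee0_abs// expeR_ge0.
move=> /(_ p00)[A [mA A0 sA]] _.
apply/eqP; rewrite eq_le measure_ge0 andbT -A0 le_measure ?inE//.
move=> w /= /eqP Jw; apply: sA => /= /(_ I) /eqP; rewrite expeR_eq0.
by rewrite eqe_oppLR => /eqP.
Qed.

(** Countably many rational intervals contribute one null set each, and every nondegenerate interval
    contains a rational one. *)
Let sq_infinite : jump_intensity P L sat = +oo ->
  exists N, [/\ measurable N, P N = 0 &
    forall w, ~ N w -> forall a b, (a < b)%R -> J sq a b w = +oo].
Proof.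
move=> c0.
pose E (q : rat * rat) := if (ratr q.1 < ratr q.2 :> R)%R
  then [set w | J sq (ratr q.1) (ratr q.2) w != +oo] else set0.
pose F (n : nat) := if choice.unpickle n is Some q then E q else set0.
have mE q : measurable (E q) by rewrite /E; case: ifP => // _; exact: mJneq.
have E0 q : P (E q) = 0.
  by rewrite /E; case: ifPn => qq; rewrite ?measure0//; exact: sq_infinite_on.
exists (\bigcup_n F n); split.
- by apply: bigcup_measurable => n _; rewrite /F; case: (choice.unpickle n).
- apply: null_bigcup => n; rewrite /F; first by case: (choice.unpickle n).
  by case: (choice.unpickle n) => [q|]; [exact: E0|exact: measure0].
move=> w Nw a b ab.
have notE q : ~ E q w.
  move=> Eq; apply: Nw; exists (choice.pickle q); first exact: I.
  by rewrite /F choice.pickleK.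
have [q1 /itvP q1ab] := rat_in_itvoo ab.
have q1b : (ratr q1 < b)%R by rewrite q1ab.
have [q2 /itvP q2ab] := rat_in_itvoo q1b.
apply/eqP; rewrite -leye_eq.
have <- : J sq (ratr q1) (ratr q2) w = +oo.
  apply: contrapT => /eqP JE; apply: (notE (q1, q2)).
  by rewrite /E /= q2ab.
by apply: jump_sum_sub => //; rewrite ltW// ?q1ab ?q2ab.
Qed.

(* Zero-one law: in the second case the subordinator of Defs is identically 0
   because fine (+oo) = 0, so that both cases can be treated alike below. *)
Lemma sum_square_jumps_dichotomy : exists N, [/\ measurable N, P N = 0 &
  (forall w, ~ N w -> forall a b, jump_sum (L ^~ w) (fun y => y ^+ 2)%R a b < +oo) \/
  (forall w, ~ N w -> forall a b, (a < b)%R ->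
    jump_sum (L ^~ w) (fun y => y ^+ 2)%R a b = +oo)].
Proof.
have [c0|c0] := ltP (jump_intensity P L sat) +oo.
  by have [N [mN N0 H]] := sq_finite c0; exists N; split => //; left.
have /eqP {}c0 : jump_intensity P L sat == +oo by rewrite -leye_eq.
by have [N [mN N0 H]] := sq_infinite c0; exists N; split => //; right.
Qed.

End square_jumps.

(** * Paths of the subordinator and of the COGARCH process *)

Section two_sided_sums.
Context {R : realType}.
Implicit Types (f g : R -> R).

Definition two_sided_sum f g (t : R) : R :=
  if 0 <= t then fine (jump_sum f g 0 t) else - fine (jump_sum f g t 0).

Lemma two_sided_sumB f g s t : (forall y, 0 <= g y) ->
  (forall a b, jump_sum f g a b < +oo)%E -> s <= t ->
  two_sided_sum f g t - two_sided_sum f g s = fine (jump_sum f g s t).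
Proof.
move=> g0 fin st.
have fnum a b : jump_sum f g a b \is a fin_num.
  by rewrite ge0_fin_numE// jump_sum_ge0.
have cat a b c : a <= b -> b <= c ->
    fine (jump_sum f g a c) = fine (jump_sum f g a b) + fine (jump_sum f g b c).
  by move=> ab bc; rewrite (@jump_sum_cat _ f g a b c)// fineD.
rewrite /two_sided_sum; have [s0|s0] := leP 0 s.
  by rewrite (le_trans s0 st) (cat 0 s t)// addrAC subrr add0r.
have [t0|t0] := leP 0 t; first by rewrite opprK addrC -cat// ltW.
by rewrite opprK addrC (cat s t 0)// ?addrK// ltW.
Qed.

(** A finite set [F] carries all but [e] of the sum over ]a, u]. For [x] beyond its points other
    than [u], the sum over ]x, u] lies between the term at [u] and that term plus [e]. *)
Lemma jump_sum_left_limit f g a u : (forall y, 0 <= g y) -> a < u ->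
  (jump_sum f g a u < +oo)%E ->
  fine (jump_sum f g x u) @[x --> u^'-] --> g (jump f u).
Proof.
move=> g0 au fin.
have fnum : jump_sum f g a u \is a fin_num by rewrite ge0_fin_numE// jump_sum_ge0.
apply/cvgrPdist_le => e e0.
have : (jump_sum f g a u - e%:E < jump_sum f g a u)%E.
  by rewrite -(fineK fnum) -EFinB lte_fin; lra.
move=> /jump_sum_gt[F [uF Fab]] SF.
have nearF : \forall x \near u^'-, forall v, v \in F -> v != u -> v <= x.
  apply: (@near_all_seq R R _ _ F (fun v x => v != u -> v <= x)) => v vF.
  have [->|vu] := eqVneq v u; first exact: nearW.
  have vu' : v < u by rewrite lt_neqAle vu; case/andP : (Fab v vF).
  by near=> x => _; near: x; exact: nbhs_left_ge.
near=> x.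
have xu : x < u by near: x; exact: nbhs_left_lt.
have ax : a < x by near: x; exact: nbhs_left_gt.
have Fx v : v \in F -> v != u -> v <= x by move: v; near: x.
have JE := @jump_sum_cat _ f g a x u g0 (ltW ax) (ltW xu).
have f1 : jump_sum f g a x \is a fin_num.
  rewrite ge0_fin_numE ?jump_sum_ge0//; apply: le_lt_trans fin.
  by rewrite JE leeDl// jump_sum_ge0.
have f2 : jump_sum f g x u \is a fin_num.
  rewrite ge0_fin_numE ?jump_sum_ge0//; apply: le_lt_trans fin.
  by rewrite JE leeDr// jump_sum_ge0.
have lo : g (jump f u) <= fine (jump_sum f g x u).
  rewrite -lee_fin fineK//.
  have := @jump_sum_ge_seq _ f g x u [:: u] g0 isT; rewrite big_seq1; apply => v.
  by rewrite inE => /eqP ->; rewrite xu lexx.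
have up : \sum_(v <- F) g (jump f v) <= fine (jump_sum f g a x) + g (jump f u).
  have H : \sum_(v <- F | v != u) g (jump f v) <= fine (jump_sum f g a x).
    rewrite -big_filter -lee_fin fineK//; apply: jump_sum_ge_seq => //.
      by rewrite filter_uniq.
    move=> v; rewrite mem_filter => /andP[vu vF]; rewrite Fx// andbT.
    by case/andP : (Fab v vF).
  have [uF'|uF'] := boolP (u \in F).
    by rewrite (bigD1_seq u)//= addrC lerD2r.
  rewrite -[leLHS]addr0 lerD//; apply: le_trans H.
  rewrite big_seq [leRHS]big_mkcond [leRHS]big_seq; apply: ler_sum => v vF.
  by case: eqVneq => [vu|//]; rewrite -vu vF in uF'.
have : fine (jump_sum f g a u) - e < \sum_(v <- F) g (jump f v).
  by rewrite -lte_fin EFinB fineK.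
rewrite JE fineD// => SF'.
by rewrite distrC ger0_norm ?subr_ge0//; lra.
Unshelve. all: by end_near. Qed.

(** Applied to squares, this says that the subordinator jumps exactly by the squared jumps of [L],
    which are the jumps that the COGARCH exponent sees. *)
Lemma jump_two_sided_sum f g u : (forall y, 0 <= g y) ->
  (forall a b, jump_sum f g a b < +oo)%E ->
  jump (two_sided_sum f g) u = g (jump f u).
Proof.
move=> g0 fin; rewrite {1}/jump.
have H : two_sided_sum f g x @[x --> u^'-] --> two_sided_sum f g u - g (jump f u).
  have := @jump_sum_left_limit f g (u - 1) u g0 _ (fin _ _).
  rewrite gtrBl ltr01 => /(_ isT) H.
  have : two_sided_sum f g u - fine (jump_sum f g x u) @[x --> u^'-] -->
      two_sided_sum f g u - g (jump f u).
    by apply: cvgB => //; exact: cvg_cst.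
  apply: cvg_trans; apply: near_eq_cvg; near=> x.
  by rewrite -two_sided_sumB// opprB addrC subrK.
by rewrite (cvg_lim _ H)// opprB addrC subrK.
Unshelve. all: by end_near. Qed.

End two_sided_sums.

Section cogarch_paths.
Context (T : Type) {R : realType}.
Variables (L : R -> T -> R) (w : T).
Let f := L ^~ w.

Lemma subordinatorE t : subordinator L t w = two_sided_sum f (fun y => y ^+ 2) t.
Proof. by []. Qed.

Lemma jump_subordinator u :
  (forall a b, jump_sum f (fun y => y ^+ 2)%R a b < +oo)%E ->
  jump (fun t => subordinator L t w) u = jump f u ^+ 2.
Proof.
by move=> fin; rewrite (_ : (fun t => _) = two_sided_sum f (fun y => y ^+ 2))//
  jump_two_sided_sum// => y; exact: sqr_ge0.
Qed.

Lemma subordinator_infinite :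
  (forall a b, (a < b)%R -> jump_sum f (fun y => y ^+ 2)%R a b = +oo)%E ->
  (fun t => subordinator L t w) = cst 0.
Proof.
move=> inf; apply/funext => t; rewrite subordinatorE /two_sided_sum.
case: ifPn => [|t0]; last by rewrite inf ?oppr0// ltNge.
rewrite le_eqVlt => /predU1P[<-|t0]; last by rewrite inf.
by rewrite jump_sum_empty.
Qed.

Lemma jump_cst0 u : jump (cst 0 : R -> R) u = 0.
Proof. by rewrite /jump lim_cst// subrr. Qed.

Variables (beta eta eps phi : R).
Hypotheses (eps0 : 0 <= eps) (phi0 : 0 <= phi).
Hypothesis jumpS : forall u, jump (fun t => subordinator L t w) u = eps * jump f u ^+ 2.
Hypothesis finS : forall a b, (jump_sum f (fun y => eps * y ^+ 2)%R a b < +oo)%E.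

(* The absolute value makes this function jointly measurable in phi and y. *)
Definition log_jump (e p y : R) : R := ln (1 + `|p| * (e * y ^+ 2)).

Lemma log_jump_ge0 (e p y : R) : 0 <= e -> 0 <= log_jump e p y.
Proof. move=> e0; have H : 0 <= `|p| * (e * y ^+ 2).
  by apply: mulr_ge0 => //; apply: mulr_ge0 => //; exact: sqr_ge0.
by rewrite /log_jump ln_ge0// lerDl. Qed.

Lemma log_jump_finite a b : (jump_sum f (log_jump eps phi) a b < +oo)%E.
Proof.
have g0 y : 0 <= eps * y ^+ 2 by apply: mulr_ge0 => //; exact: sqr_ge0.
have p1 : 0 < phi + 1 by rewrite ltr_wpDl.
(* The factor [phi + 1] is positive even when [phi = 0], as [jump_sumZ] requires. *)
apply: (@le_lt_trans _ _ (jump_sum f (fun y => (phi + 1) * (eps * y ^+ 2))%R a b)).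
  apply: le_jump_sum => y; apply: (@le_trans _ _ (`|phi| * (eps * y ^+ 2))).
    by apply: le_ln1Dx; apply: (lt_le_trans (ltrN10 _)); exact: mulr_ge0.
  by rewrite ger0_norm// ler_wpM2r// lerDl.
by rewrite jump_sumZ// lte_mul_pinfty// lee_fin ltW.
Qed.

Lemma cogarch_exponentE t : cogarch_exponent eta (subordinator L) phi t w =
  eta * t - two_sided_sum f (log_jump eps phi) t.
Proof.
have E a b : \esum_(s in [set s : R | (a < s <= b)%R])
    (ln (1 + phi * jump (fun u => subordinator L u w) s))%:E =
    jump_sum f (log_jump eps phi) a b.
  by apply: eq_esum => u _; rewrite jumpS /log_jump ger0_norm.
rewrite /cogarch_exponent /two_sided_sum !E.
by case: ifP => // _; rewrite opprK.
Qed.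

Lemma cogarchE t : cogarch beta eta (subordinator L) phi t w =
  (beta%:E * \int[lebesgue_measure]_(s in [set s : R | (s <= t)%R])
    ((expR (- (eta * (t - s))))%:E * expeR (jump_sum f (log_jump eps phi) s t)))%E.
Proof.
rewrite /cogarch; congr (_ * _)%E; apply: eq_integral => s; rewrite inE /= => st.
have l0 y : 0 <= log_jump eps phi y by exact: log_jump_ge0.
have fnum : jump_sum f (log_jump eps phi) s t \is a fin_num.
  by rewrite ge0_fin_numE ?jump_sum_ge0// log_jump_finite.
rewrite !cogarch_exponentE -(fineK fnum) /= -EFinM -expRD; congr (expR _)%:E.
have := @two_sided_sumB _ f _ s t l0 log_jump_finite st.
by lra.
Qed.

End cogarch_paths.

(** * Moments of the COGARCH process *)

Section exponential_integrals.
Context {R : realType}.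
Notation mu := (@lebesgue_measure R).
Local Open Scope ereal_scope.

Lemma half_open_itvE (x y : R) : [set s : R | (x < s <= y)%R] = `]x, y]%classic.
Proof. by apply/seteqP; split => s; rewrite /= in_itv. Qed.

Lemma measurable_half_open (x y : R) : measurable [set s : R | (x < s <= y)%R].
Proof. by rewrite half_open_itvE. Qed.

Lemma measurable_half_line (t : R) : measurable [set s : R | (s <= t)%R].
Proof.
by rewrite (_ : [set s | _] = `]-oo, t]%classic)//; apply/seteqP; split => s; rewrite /= in_itv.
Qed.

Lemma continuous_exp_affine (a c : R) : continuous (fun s : R => expR (a * (c - s)))%R.
Proof.
move=> x; apply: (@continuous_comp _ _ _ (fun s => a * (c - s))%R (@expR R)).
  by apply: cvgM; [exact: cvg_cst|apply: cvgB; [exact: cvg_cst|exact: cvg_id]].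
exact: continuous_expR.
Qed.

Lemma measurable_exp_affine (D : set R) (a c : R) :
  measurable_fun D (fun s => (expR (a * (c - s)))%:E).
Proof.
apply/measurable_EFinP; apply: measurable_funTS.
by apply: continuous_measurable_fun; exact: continuous_exp_affine.
Qed.

Lemma integral_exp_interval (a c x y : R) : a != 0%R -> (x <= y)%R ->
  \int[mu]_(s in [set s | (x < s <= y)%R]) (expR (a * (c - s)))%:E =
  ((expR (a * (c - x)) - expR (a * (c - y))) / a)%:E.
Proof.
move=> a0; rewrite le_eqVlt => /predU1P[<-|xy].
  rewrite subrr mul0r (_ : [set s | _] = set0) ?integral_set0//.
  by apply/seteqP; split => // s /= /andP[xs /(lt_le_trans xs)]; rewrite ltxx.
pose F (s : R) := (- (a^-1 * expR (a * (c - s))))%R.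
have dF s : is_derive s (1%R : R) F (expR (a * (c - s)))%R.
  rewrite /F; apply: is_derive_eq.
  by rewrite /= /GRing.scale /=; field.
have cF : continuous F.
  move=> s; apply: cvgN; apply: cvgM; first exact: cvg_cst.
  exact: continuous_exp_affine.
rewrite half_open_itvE integral_itv_obnd_cbnd; last exact: measurable_exp_affine.
rewrite (@continuous_FTC2 _ _ F)//.
- by rewrite -EFinB /F; congr EFin; field.
- by apply: continuous_subspaceT; exact: continuous_exp_affine.
- split.
  + by move=> z _; apply: ex_derive; exact: dF.
  + by apply/cvg_at_right_filter; exact: cF.
  + by apply/cvg_at_left_filter; exact: cF.
- by move=> z _; rewrite derive1E; apply: derive_val; exact: dF.
Qed.

Lemma integral_exp_halfline_cvg (a c t : R) :
  \int[mu]_(s in [set s | (t - n%:R < s <= t)%R]) (expR (a * (c - s)))%:E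
    @[n --> \oo] --> \int[mu]_(s in [set s | (s <= t)%R]) (expR (a * (c - s)))%:E.
Proof.
have -> : [set s : R | (s <= t)%R] =
    \bigcup_n [set s : R | (t - n%:R < s <= t)%R].
  apply/seteqP; split => [s /= st|s [n _ /= /andP[]]//].
  exists (Num.truncn (t - s)).+1 => //=; rewrite st andbT.
  by have := truncnS_gt (t - s)%R; lra.
apply: (@ge0_nondecreasing_set_cvg_integral _ (measurableTypeR R) R
  (fun n => [set s : R | (t - n%:R < s <= t)%R]) _ mu).
- move=> n m nm; rewrite subsetEset => s /= /andP[ns ->]; rewrite andbT.
  by apply: le_lt_trans ns; rewrite lerB// ler_nat.
- by move=> n; exact: measurable_half_open.
- by move=> n; exact: measurable_exp_affine.
- by move=> n s _; rewrite lee_fin expR_ge0.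
Qed.

Lemma integral_exp_halfline (a c t : R) : (a < 0)%R ->
  \int[mu]_(s in [set s | (s <= t)%R]) (expR (a * (c - s)))%:E =
  (expR (a * (c - t)) / - a)%:E.
Proof.
move=> a0; refine (@cvge_eq_limits R _ (fun n : nat =>
  ((expR (a * (c - t + n%:R)) - expR (a * (c - t))) / a)%:E) _ _
  (@integral_exp_halfline_cvg a c t) _ _).
  rewrite (_ : (_ / - a)%R = ((0 - expR (a * (c - t))) / a)%R); last first.
    by rewrite sub0r invrN mulrN mulNr.
  apply: cvg_EFin; first exact: nearW.
  apply: cvgM; last exact: cvg_cst.
  apply: cvgB; last exact: cvg_cst.
  rewrite (_ : (fun n => _) = (fun n : nat => expR (a * (c - t)) * expR a ^+ n)%R); last first.
    by apply/funext => n /=; rewrite -expRM_natl -expRD; congr expR; lra.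
  rewrite -[X in _ --> X](mulr0 (expR (a * (c - t)))).
  apply: cvgM; first exact: cvg_cst.
  by apply: cvg_expr; rewrite ger0_norm ?expR_ge0// expR_lt1.
move=> n; rewrite integral_exp_interval ?lt_eqF//; last by rewrite gerBl.
by congr (((expR (a * _) - _) / a)%:E); lra.
Qed.

Lemma integral_exp_halfline_infinite (a c t : R) : (0 <= a)%R ->
  \int[mu]_(s in [set s | (s <= t)%R]) (expR (a * (c - s)))%:E = +oo.
Proof.
move=> a0; apply/eqP; rewrite -leye_eq leNgt; apply/negP => fin.
set I := integral _ _ _ in fin; pose K := expR (a * (c - t)).
have K0 : (0 < K)%R by exact: expR_gt0.
have I0 : 0 <= I by apply: integral_ge0 => s _; rewrite lee_fin expR_ge0.
have Ifin : I \is a fin_num by rewrite ge0_fin_numE.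
pose n := (Num.truncn (fine I / K)).+1.
have nI : (fine I / K < n%:R)%R by exact: truncnS_gt.
have mD := measurable_half_line t.
have mDn := measurable_half_open (t - n%:R)%R t.
have : (n%:R * K)%:E <= I.
  apply: (@le_trans _ _ (\int[mu]_(s in [set s | (t - n%:R < s <= t)%R]) (expR (a * (c - s)))%:E)); last first.
    apply: ge0_subset_integral => //; first exact: measurable_exp_affine.
    by move=> s /= /andP[].
  apply: (@le_trans _ _ (\int[mu]_(s in [set s | (t - n%:R < s <= t)%R]) (cst K%:E s))).
    rewrite integral_cst// half_open_itvE.
    rewrite [X in _ <= _ * X](lebesgue_measure_itv `]t - n%:R, t]%R).
    rewrite /= lte_fin gtrBl ltr0n /= -EFinB -EFinM lee_fin.
    by rewrite opprB addrC subrK mulrC.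
  apply: ge0_le_integral => //.
  - by move=> s _; rewrite lee_fin ltW.
  - exact: measurable_exp_affine.
  - move=> s /= /andP[_ st]; rewrite lee_fin ler_expR.
    by apply: ler_wpM2l => //; lra.
rewrite -(fineK Ifin) lee_fin => nK.
by move: nI; rewrite ltr_pdivrMr// ltNge nK.
Qed.

(** Turns a finite moment into a strict inequality between rates: for [k >= c] the integrand is at
    least 1 on the whole half-line. *)
Lemma integral_growth_finite (c t : R) (k : \bar R) : 0 <= k ->
  \int[mu]_(s in [set s | (s <= t)%R])
    ((expR (- (c * (t - s))))%:E * expeR ((t - s)%:E * k)) < +oo -> k < c%:E.
Proof.
case: k => [k| |]//; first last.
  move=> _; rewrite (_ : \int[mu]_(s in _) _ = +oo)//.
  apply/eqP; rewrite -leye_eq.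
  (* Stopping at t - 1 keeps [t - s] positive; at s = t the product of 0 and +oo is 0 and the
     integrand would be finite. *)
  apply: (@le_trans _ _ (\int[mu]_(s in [set s | (s <= t - 1)%R]) (expR (0 * (t - s)))%:E)).
    by rewrite integral_exp_halfline_infinite.
  apply: (@le_trans _ _ (\int[mu]_(s in [set s | (s <= t - 1)%R])
    ((expR (- (c * (t - s))))%:E * expeR ((t - s)%:E * +oo)))).
    apply: le_integral_of_le => s /= st; first by rewrite lee_fin expR_ge0.
    by rewrite gt0_muley ?lte_fin /= ?gt0_muley ?lte_fin ?expR_gt0 ?leey//; lra.
  rewrite integral_mkcond [leRHS]integral_mkcond.
  have K0 s : 0 <= (expR (- (c * (t - s))))%:E * expeR ((t - s)%:E * +oo).
    by rewrite mule_ge0 ?expeR_ge0// lee_fin expR_ge0.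
  apply: le_integral_of_le => s _; rewrite !patchE; first by case: ifP.
  case: ifPn => [|_]; last by case: ifP => _; [exact: K0|exact: lexx].
  by rewrite inE /= => st; rewrite ifT// inE /=; lra.
move=> k0 fin; rewrite lte_fin ltNge; apply/negP => ck.
have : \int[mu]_(s in [set s | (s <= t)%R]) (expR ((k - c) * (t - s)))%:E < +oo.
  apply: le_lt_trans fin; rewrite le_eqVlt; apply/orP; left; apply/eqP.
  by apply: eq_integral => s _; rewrite /= -EFinM -expRD; congr (expR _)%:E; lra.
by rewrite integral_exp_halfline_infinite// subr_ge0.
Qed.

End exponential_integrals.

Section discounted_growth.
Local Open Scope ereal_scope.
Context d (T : measurableType d) (R : realType) (P : probability T R).
Variables (L : R -> T -> R) (eta eps : R).
Hypotheses (levL : cadlag_levy P L) (eps0 : (0 <= eps)%R).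
Notation mu := (@lebesgue_measure R).

(** The extension by 0 beyond [t] lets Tonelli's theorem work with integrals over the whole line. *)
Definition growth_kernel (p t s : R) (w : T) : \bar R :=
  if (s <= t)%R
  then (expR (- (eta * (t - s))))%:E * expeR (jump_sum (L ^~ w) (log_jump eps p) s t)
  else 0.

Definition discounted_growth (p t : R) (w : T) : \bar R :=
  \int[mu]_s growth_kernel p t s w.

Lemma discounted_growthE p t w : discounted_growth p t w =
  \int[mu]_(s in [set s | (s <= t)%R])
    ((expR (- (eta * (t - s))))%:E * expeR (jump_sum (L ^~ w) (log_jump eps p) s t)).
Proof.
rewrite [RHS]integral_mkcond; apply: eq_integral => s _; rewrite patchE /growth_kernel.
by rewrite (_ : (s \in _) = (s <= t)%R)//; apply/idP/idP; rewrite inE.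
Qed.

Lemma admissible_jump_size : admissible (fun y : R => eps * y ^+ 2)%R.
Proof. by apply: admissibleZ => //; exact: admissible_sq. Qed.

Lemma admissible_log_jump p : admissible (log_jump eps p).
Proof.
by apply: admissible_ln; apply: admissibleZ => //; exact: admissible_jump_size.
Qed.

Lemma growth_kernel_ge0 p t s w : 0 <= growth_kernel p t s w.
Proof.
by rewrite /growth_kernel; case: ifP => // _; rewrite mule_ge0 ?expeR_ge0// lee_fin expR_ge0.
Qed.

Lemma discounted_growth_ge0 p t w : 0 <= discounted_growth p t w.
Proof. by apply: integral_ge0 => s _; exact: growth_kernel_ge0. Qed.

Lemma measurable_growth_kernel dA (A : measurableType dA) (p t s : A -> R) (w : A -> T) :
  measurable_fun setT p -> measurable_fun setT t -> measurable_fun setT s ->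
  measurable_fun setT w ->
  measurable_fun setT (fun a => growth_kernel (p a) (t a) (s a) (w a)).
Proof.
move=> mp mt ms mw; apply: measurable_fun_ifT => //.
  exact: measurable_fun_ler.
apply: emeasurable_funM.
  apply/measurable_EFinP; apply: (measurableT_comp (@measurable_expR R)).
  apply: measurable_funN; apply: measurable_funM => //.
  exact: measurable_funB.
apply: (measurableT_comp (@measurable_expeR R)).
apply: (@measurable_jump_sum _ _ _ L (cadlag_levy_measurable levL)
  (cadlag_levy_cadlag levL) _ _ (fun a => log_jump eps (p a))) => // [a|].
  exact: admissible_log_jump.
apply: (measurableT_comp (@measurable_ln R)); apply: measurable_funD => //.
apply: measurable_funM.
  apply: measurableT_comp => //.
  exact: (measurableT_comp mp measurable_fst).
by apply: measurable_funM => //; apply: measurable_funX; exact: measurable_snd.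
Qed.

Lemma measurable_discounted_growth dA (A : measurableType dA) (p : A -> R) t (w : A -> T) :
  measurable_fun setT p -> measurable_fun setT w ->
  measurable_fun setT (fun a => discounted_growth (p a) t (w a)).
Proof.
move=> mp mw.
apply: (@measurable_fun_fubini_tonelli_F _ _ A (measurableTypeR R) R mu
  (fun x : A * measurableTypeR R => growth_kernel (p x.1) t x.2 (w x.1))).
  apply: measurable_growth_kernel => //.
  - exact: (measurableT_comp mp measurable_fst).
  - exact: (measurableT_comp mw measurable_fst).
by move=> x; exact: growth_kernel_ge0.
Qed.

Lemma expectation_discounted_growth p t : \int[P]_w discounted_growth p t w =
  \int[mu]_s \int[P]_w growth_kernel p t s w.
Proof.
rewrite /discounted_growth.
rewrite (@fubini_tonelli _ _ T (measurableTypeR R) R P mu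
  (fun x => growth_kernel p t x.2 x.1))// => [|x].
  exact: measurable_growth_kernel.
exact: growth_kernel_ge0.
Qed.

Lemma expectation_discounted_growthM p q t u :
  \int[P]_w (discounted_growth p t w * discounted_growth q u w) =
  \int[mu]_s \int[mu]_r \int[P]_w (growth_kernel p t s w * growth_kernel q u r w).
Proof.
have mK p' t' : measurable_fun setT
    (fun x : measurableTypeR R * T => growth_kernel p' t' x.1 x.2).
  exact: measurable_growth_kernel.
have mKs p' t' w : measurable_fun setT
    (fun s : measurableTypeR R => growth_kernel p' t' s w).
  exact: (@measurable_growth_kernel _ (measurableTypeR R) (cst p') (cst t') id (cst w)).
pose F (x : T * measurableTypeR R) := growth_kernel p t x.2 x.1 * discounted_growth q u x.1.
transitivity (\int[P]_w \int[mu]_s F (w, s)).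
  apply: eq_integral => w _; rewrite muleC -ge0_integralZl//.
  - by apply: eq_integral => s _; rewrite muleC.
  - by move=> s _; exact: growth_kernel_ge0.
  - exact: discounted_growth_ge0.
rewrite (@fubini_tonelli _ _ T (measurableTypeR R) R P mu)//; first last.
- by move=> x; rewrite /F mule_ge0 ?growth_kernel_ge0 ?discounted_growth_ge0.
- apply: emeasurable_funM; first exact: measurable_growth_kernel.
  exact: (measurable_discounted_growth u (measurable_cst q) measurable_fst).
apply: eq_integral => s _.
pose G (x : T * measurableTypeR R) := growth_kernel p t s x.1 * growth_kernel q u x.2 x.1.
transitivity (\int[P]_w \int[mu]_r G (w, r)).
  apply: eq_integral => w _; rewrite /F /= /discounted_growth -ge0_integralZl//.
  - by move=> r _; exact: growth_kernel_ge0.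
  - exact: growth_kernel_ge0.
rewrite (@fubini_tonelli _ _ T (measurableTypeR R) R P mu)//; last first.
  by move=> x; rewrite /G mule_ge0 ?growth_kernel_ge0.
apply: emeasurable_funM; last exact: measurable_growth_kernel.
exact: (measurable_growth_kernel (measurable_cst p) (measurable_cst t)
  (measurable_cst s) measurable_fst).
Qed.

End discounted_growth.

Section growth_moments.
Local Open Scope ereal_scope.
Context d (T : measurableType d) (R : realType) (P : probability T R).
Variables (L : R -> T -> R) (eta eps : R).
Hypotheses (levL : cadlag_levy P L) (eps0 : (0 <= eps)%R).

Let J0 g a b w : admissible g -> 0 <= jump_sum (L ^~ w) g a b.
Proof. by move=> [_ g0 _]; exact: jump_sum_ge0. Qed.

Lemma jump_intensity0 : jump_intensity P L (fun=> 0%R) = 0.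
Proof.
by apply: integral0_eq => w _; rewrite /jump_sum esum1.
Qed.

Lemma jump_intensityD g h : admissible g -> admissible h ->
  jump_intensity P L (fun y => g y + h y)%R = jump_intensity P L g + jump_intensity P L h.
Proof.
move=> ag ah; rewrite /jump_intensity -ge0_integralD//; last 4 first.
- by move=> w _; exact: J0.
- exact: (measurable_levy_jump_sum levL).
- by move=> w _; exact: J0.
- exact: (measurable_levy_jump_sum levL).
by apply: eq_integral => w _; rewrite jump_sumD//; [case: ag|case: ah].
Qed.

Lemma jump_intensityZ c g : (0 <= c)%R -> admissible g ->
  jump_intensity P L (fun y => c * g y)%R = c%:E * jump_intensity P L g.
Proof.
move=> c0 ag; have [->|cn0] := eqVneq c 0%R.
  rewrite mul0e (_ : (fun y => _) = (fun=> 0%R)) ?jump_intensity0//.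
  by apply/funext => y; rewrite mul0r.
rewrite /jump_intensity -ge0_integralZl//; last 2 first.
- exact: (measurable_levy_jump_sum levL).
- by move=> w _; exact: J0.
apply: eq_integral => w _; rewrite jump_sumZ//; first by rewrite lt_def cn0.
by case: ag.
Qed.

Lemma admissibleD (g h : R -> R) : admissible g -> admissible h ->
  admissible (fun y => g y + h y)%R.
Proof.
move=> [cg g0 g00] [ch h0 h00]; split => [y|y|]; last by rewrite g00 h00 addr0.
  by apply: cvgD; [exact: cg|exact: ch].
by rewrite addr_ge0.
Qed.

(** Two growth kernels cut time into at most three blocks: a stretch where one of them runs alone,
    their overlap or the gap between them, and a last stretch. A block where none runs gets the
    function 0. *)
Lemma expectation_three_blocks (g0 g1 g2 : R -> R) (a b c e : R) :
  admissible g0 -> admissible g1 -> admissible g2 ->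
  (a <= b)%R -> (b <= c)%R -> (c <= e)%R ->
  \int[P]_w (expeR (jump_sum (L ^~ w) (fun y => ln (1 + g0 y))%R a b) *
    (expeR (jump_sum (L ^~ w) (fun y => ln (1 + g1 y))%R b c) *
     expeR (jump_sum (L ^~ w) (fun y => ln (1 + g2 y))%R c e))) =
  expeR ((b - a)%:E * jump_intensity P L g0) *
   (expeR ((c - b)%:E * jump_intensity P L g1) *
    expeR ((e - c)%:E * jump_intensity P L g2)).
Proof.
move=> ag0 ag1 ag2 ab bc ce.
pose t (j : nat) : R := match j with 0%N => a | 1%N => b | 2%N => c | _ => e end.
pose g (j : nat) := match j with 0%N => g0 | 1%N => g1 | _ => g2 end.
have tm : {homo t : i j / (i <= j)%N >-> (i <= j)%R}.
  apply: homo_leq => [x|x y z|j]; [exact: lexx|exact: le_trans|].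
  by case: j => [|[|[|j]]] //=.
have ag j : admissible (g j) by case: j => [|[|j]].
have := @expectation_prod_expeR _ _ _ P L levL t 3 g tm ag.
rewrite !big_ord_recl big_ord0 /= mule1 => <-.
by apply: eq_integral => w _; rewrite !big_ord_recl big_ord0 /= mule1.
Qed.

Definition growth_rate (p : R) : \bar R := jump_intensity P L (fun y => `|p| * (eps * y ^+ 2))%R.

(** This is (1 + [|p|] x) (1 + [|q|] x) - 1 with x = eps y^2, so that its logarithmic jump is the
    sum of those of [p] and [q]. *)
Definition joint_growth (p q y : R) : R :=
  (`|p| * (eps * y ^+ 2) + (`|q| * (eps * y ^+ 2) + `|p| * `|q| * (eps * y ^+ 2) ^+ 2))%R.

Definition joint_growth_rate (p q : R) : \bar R := jump_intensity P L (joint_growth p q).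

Let m1 := jump_intensity P L (fun y => eps * y ^+ 2)%R.
Let m2 := jump_intensity P L (fun y => (eps * y ^+ 2) ^+ 2)%R.

Let asize := admissible_jump_size eps0.

Lemma growth_rateE (p : R) : growth_rate p = `|p|%:E * m1.
Proof. by rewrite /growth_rate jump_intensityZ. Qed.

Lemma admissible_joint_growth p q : admissible (joint_growth p q).
Proof.
apply: admissibleD; first exact: admissibleZ.
apply: admissibleD; first exact: admissibleZ.
by apply: admissibleZ; [exact: mulr_ge0|exact: admissible_sqr].
Qed.

Lemma joint_growth_rateE (p q : R) :
  joint_growth_rate p q = `|p|%:E * m1 + (`|q|%:E * m1 + (`|p| * `|q|)%:E * m2).
Proof.
have [? ? ?] : [/\ admissible (fun y => `|p| * (eps * y ^+ 2))%R,
    admissible (fun y => `|q| * (eps * y ^+ 2))%R &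
    admissible (fun y => `|p| * `|q| * (eps * y ^+ 2) ^+ 2)%R].
  split; [exact: admissibleZ|exact: admissibleZ|].
  by apply: admissibleZ; [exact: mulr_ge0|exact: admissible_sqr].
rewrite /joint_growth_rate jump_intensityD//; last exact: admissibleD.
rewrite jump_intensityD//; congr (_ + (_ + _)); apply: jump_intensityZ => //.
exact: admissible_sqr.
Qed.

Lemma log_jumpD p q y : (log_jump eps p y + log_jump eps q y)%R =
  ln (1 + joint_growth p q y).
Proof.
have g0 x : (0 <= `|x| * (eps * y ^+ 2))%R by case: (admissibleZ (normr_ge0 x) asize).
rewrite /log_jump -lnM ?posrE ?ltr_pwDl//; congr ln; rewrite /joint_growth; ring.
Qed.

Let cat p a b c w : (a <= b)%R -> (b <= c)%R ->
  expeR (jump_sum (L ^~ w) (log_jump eps p) a c) =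
  expeR (jump_sum (L ^~ w) (log_jump eps p) a b) *
  expeR (jump_sum (L ^~ w) (log_jump eps p) b c).
Proof.
move=> ab bc; have l0 y : (0 <= log_jump eps p y)%R by exact: log_jump_ge0.
by rewrite (@jump_sum_cat _ _ _ a b c)// expeRD// ?ge0_adde_def ?inE ?jump_sum_ge0.
Qed.

Let joint p q a b w :
  expeR (jump_sum (L ^~ w) (log_jump eps p) a b) *
  expeR (jump_sum (L ^~ w) (log_jump eps q) a b) =
  expeR (jump_sum (L ^~ w) (fun y => ln (1 + joint_growth p q y))%R a b).
Proof.
have l0 x y : (0 <= log_jump eps x y)%R by exact: log_jump_ge0.
rewrite -expeRD// ?ge0_adde_def ?inE ?jump_sum_ge0// -jump_sumD//.
by congr (expeR (jump_sum _ _ _ _)); apply/funext => y; exact: log_jumpD.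
Qed.

Let agr (p : R) : admissible (fun y => `|p| * (eps * y ^+ 2))%R.
Proof. exact: admissibleZ. Qed.

Lemma expectation_growth_kernel p t s : (s <= t)%R ->
  \int[P]_w growth_kernel L eta eps p t s w =
  (expR (- (eta * (t - s))))%:E * expeR ((t - s)%:E * growth_rate p).
Proof.
move=> st; rewrite /growth_kernel st ge0_integralZl//; last 2 first.
- apply: (measurableT_comp (@measurable_expeR R)); apply: (measurable_levy_jump_sum levL).
  exact: admissible_log_jump.
- by move=> w _; exact: expeR_ge0.
congr (_ * _); have := @expectation_three_blocks _ _ _ s t t t (agr p)
  (@admissible0 R) (@admissible0 R) st (lexx _) (lexx _).
rewrite subrr !mul0e expeR0 !mule1 => <-; apply: eq_integral => w _.
by rewrite (@jump_sum_empty _ _ _ t t)// expeR0 !mule1.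
Qed.

Let expectation_kernelM p q t s u r : (s <= t)%R -> (r <= u)%R ->
  \int[P]_w (growth_kernel L eta eps p t s w * growth_kernel L eta eps q u r w) =
  (expR (- (eta * (t - s + (u - r)))))%:E *
  \int[P]_w (expeR (jump_sum (L ^~ w) (log_jump eps p) s t) *
    expeR (jump_sum (L ^~ w) (log_jump eps q) r u)).
Proof.
move=> st ru; rewrite -ge0_integralZl//; last 2 first.
- apply: emeasurable_funM; apply: (measurableT_comp (@measurable_expeR R));
    apply: (measurable_levy_jump_sum levL); exact: admissible_log_jump.
- by move=> w _; rewrite mule_ge0 ?expeR_ge0.
apply: eq_integral => w _; rewrite /growth_kernel st ru muleACA -EFinM -expRD.
by congr ((expR _)%:E * _); ring.
Qed.

(** Here and in the next two lemmas the start [r] of the second kernel lies before [s], between [s]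
    and [t], or after [t]. The joint rate governs the overlap, the single rates govern the stretches
    where one kernel runs alone. *)
Lemma expectation_growth_kernelM_ge p q r s t u :
  (r <= s)%R -> (s <= t)%R -> (t <= u)%R ->
  \int[P]_w (growth_kernel L eta eps p t s w * growth_kernel L eta eps q u r w) =
  (expR (- (eta * (t - s + (u - r)))))%:E *
  (expeR ((s - r)%:E * growth_rate q) * (expeR ((t - s)%:E * joint_growth_rate p q) *
   expeR ((u - t)%:E * growth_rate q))).
Proof.
move=> rs st tu; rewrite expectation_kernelM//; last by rewrite (le_trans rs)// (le_trans st).
congr (_ * _).
rewrite -(expectation_three_blocks (agr q) (admissible_joint_growth p q) (agr q))//.
apply: eq_integral => w _; rewrite -joint.
rewrite (@cat q r s u)//; last exact: le_trans tu.
by rewrite (@cat q s t u)// !muleA; congr (_ * _ * _); rewrite muleC.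
Qed.

Lemma expectation_growth_kernelM_mid p q s r t u :
  (s <= r)%R -> (r <= t)%R -> (t <= u)%R ->
  \int[P]_w (growth_kernel L eta eps p t s w * growth_kernel L eta eps q u r w) =
  (expR (- (eta * (t - s + (u - r)))))%:E *
  (expeR ((r - s)%:E * growth_rate p) * (expeR ((t - r)%:E * joint_growth_rate p q) *
   expeR ((u - t)%:E * growth_rate q))).
Proof.
move=> sr rt tu; rewrite expectation_kernelM//; last 2 first.
- exact: le_trans rt.
- exact: le_trans tu.
congr (_ * _).
rewrite -(expectation_three_blocks (agr p) (admissible_joint_growth p q) (agr q))//.
apply: eq_integral => w _; rewrite -joint.
by rewrite (@cat p s r t)// (@cat q r t u)// !muleA.
Qed.

Lemma expectation_growth_kernelM_le p q s t r u :
  (s <= t)%R -> (t <= r)%R -> (r <= u)%R ->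
  \int[P]_w (growth_kernel L eta eps p t s w * growth_kernel L eta eps q u r w) =
  (expR (- (eta * (t - s + (u - r)))))%:E *
  (expeR ((t - s)%:E * growth_rate p) * expeR ((u - r)%:E * growth_rate q)).
Proof.
move=> st tr ru; rewrite expectation_kernelM//; congr (_ * _).
have := expectation_three_blocks (agr p) (@admissible0 R) (agr q) st tr ru.
rewrite jump_intensity0 mule0 expeR0 mul1e => <-.
apply: eq_integral => w _; congr (_ * _).
rewrite (_ : jump_sum _ (fun y => ln (1 + 0))%R t r = 0) ?expeR0 ?mul1e//.
by rewrite /jump_sum esum1// => v _; rewrite addr0 ln1.
Qed.

End growth_moments.

Lemma integral_expZ (R : realType) (D : set (measurableTypeR R)) (k a c : R) :
  measurable D -> 0 <= k ->
  (\int[@lebesgue_measure R]_(s in D) (k * expR (a * (c - s)))%:E =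
   k%:E * \int[@lebesgue_measure R]_(s in D) (expR (a * (c - s)))%:E)%E.
Proof.
move=> mD k0; rewrite -ge0_integralZl//.
exact: measurable_exp_affine.
Qed.

Section stationary_moments.
Local Open Scope ereal_scope.
Context d (T : measurableType d) (R : realType) (P : probability T R).
Variables (L : R -> T -> R) (eta eps : R).
Hypotheses (levL : cadlag_levy P L) (eps0 : (0 <= eps)%R).
Notation mu := (@lebesgue_measure R).
Notation K := (growth_kernel L eta eps).
Notation W := (discounted_growth L eta eps).
Notation k1 := (growth_rate P L eps).
Notation k2 := (joint_growth_rate P L eps).

Let integral_half_line (t : R) (f : R -> \bar R) : (forall s, (t < s)%R -> f s = 0) ->
  \int[mu]_s f s = \int[mu]_(s in [set s | (s <= t)%R]) f s.
Proof.
move=> f0; rewrite [RHS]integral_mkcond; apply: eq_integral => s _; rewrite patchE.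
case: ifPn => //; rewrite notin_setE /= => /negP; rewrite -ltNge; exact: f0.
Qed.

Let K0 p t s w : (t < s)%R -> K p t s w = 0.
Proof. by rewrite /growth_kernel ltNge => /negbTE ->. Qed.

Lemma growth_rate_ge0 p : 0 <= k1 p.
Proof. by apply: jump_intensity_ge0; apply: admissibleZ => //; exact: admissible_jump_size. Qed.

Lemma joint_growth_rate_ge0 p q : 0 <= k2 p q.
Proof. by apply: jump_intensity_ge0; exact: admissible_joint_growth. Qed.

Lemma expectation_discounted_growth_rate p t : \int[P]_w W p t w =
  \int[mu]_(s in [set s | (s <= t)%R])
    ((expR (- (eta * (t - s))))%:E * expeR ((t - s)%:E * k1 p)).
Proof.
rewrite expectation_discounted_growth// (@integral_half_line t) => [|s ts]; last first.
  by apply: integral0_eq => w _; rewrite K0.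
by apply: eq_integral => s; rewrite inE /= => st; rewrite expectation_growth_kernel.
Qed.

Lemma growth_rate_lt p t : \int[P]_w W p t w < +oo -> k1 p < eta%:E.
Proof.
by rewrite expectation_discounted_growth_rate; apply: integral_growth_finite; exact: growth_rate_ge0.
Qed.

Lemma expectation_discounted_growth_eq p t k : k1 p = k%:E -> (k < eta)%R ->
  \int[P]_w W p t w = ((eta - k)^-1)%:E.
Proof.
move=> kE keta; rewrite expectation_discounted_growth_rate kE.
transitivity (\int[mu]_(s in [set s | (s <= t)%R]) (expR ((k - eta) * (t - s)))%:E).
  by apply: eq_integral => s _; rewrite /= -EFinM -expRD; congr (expR _)%:E; ring.
rewrite integral_exp_halfline; last by rewrite subr_lt0.
by rewrite subrr mulr0 expR0 opprB div1r.
Qed.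

Lemma expectation_discounted_growthM_ge p q t u : \int[P]_w (W p t w * W q u w) =
  \int[mu]_(s in [set s | (s <= t)%R]) \int[mu]_(r in [set r | (r <= u)%R])
    \int[P]_w (K p t s w * K q u r w).
Proof.
apply: (eq_trans (expectation_discounted_growthM eta levL eps0 p q t u)).
rewrite (@integral_half_line t) => [|s ts]; last first.
  apply: integral0_eq => r _; apply: integral0_eq => w _.
  by rewrite (K0 _ _ ts) mul0e.
apply: eq_integral => s _; rewrite (@integral_half_line u)// => r ur.
by apply: integral0_eq => w _; rewrite (K0 _ _ ur) mule0.
Qed.

Let KM0 p q t u s r : 0 <= \int[P]_w (K p t s w * K q u r w).
Proof. by apply: integral_ge0 => w _; rewrite mule_ge0 ?growth_kernel_ge0. Qed.

Let mKM p q t u s : measurable_fun setT (fun r : measurableTypeR R =>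
  \int[P]_w (K p t s w * K q u r w)).
Proof.
apply: (@measurable_fun_fubini_tonelli_F _ _ (measurableTypeR R) T R P
  (fun x : measurableTypeR R * T => K p t s x.2 * K q u x.1 x.2)) => [|x].
  have mK q' u' (f : measurableTypeR R * T -> R) : measurable_fun setT f ->
      measurable_fun setT (fun x : measurableTypeR R * T => K q' u' (f x) x.2).
    by move=> mf; apply: (measurable_growth_kernel eta levL eps0).
  by apply: emeasurable_funM; [exact: (mK p t (cst s))|exact: (mK q u fst)].
by rewrite mule_ge0 ?growth_kernel_ge0.
Qed.

(** On the part r <= s of the double integral, the integral over [r] equals 1 / (eta - k) times an
    exponential in t - s with rate k2 - 2 eta. A finite second moment thus bounds a growth integral,
    and [integral_growth_finite] applies. *)
Lemma joint_growth_rate_lt p t : k1 p < eta%:E ->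
  \int[P]_w (W p t w * W p t w) < +oo -> k2 p p < (2 * eta)%:E.
Proof.
move=> k1eta fin; apply: (@integral_growth_finite R (2 * eta) t) => //.
  exact: joint_growth_rate_ge0.
have [k kE] : exists k, k1 p = k%:E.
  by move: (growth_rate_ge0 p) k1eta; case: (k1 p) => [k| |]//; exists k.
have keta : (k < eta)%R by rewrite -lte_fin -kE.
set I := integral _ _ _.
suff le : ((eta - k)^-1)%:E * I <= \int[P]_w (W p t w * W p t w).
  rewrite ltey; apply/negP => /eqP IE; move: (le_lt_trans le fin).
  by rewrite IE gt0_muley ?ltxx// lte_fin invr_gt0 subr_gt0.
have k2m : measurable_fun [set s : R | (s <= t)%R]
    (fun s : measurableTypeR R => (expR (- (2 * eta * (t - s))))%:E * expeR ((t - s)%:E * k2 p p)).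
  apply: measurable_funTS; apply: emeasurable_funM.
    apply/measurable_EFinP; apply: (measurableT_comp (@measurable_expR R)).
    by apply: measurable_funN; apply: measurable_funM => //; apply: measurable_funB.
  apply: (measurableT_comp (@measurable_expeR R)); apply: emeasurable_funM => //.
  by apply/measurable_EFinP; apply: measurable_funB.
rewrite expectation_discounted_growthM_ge /I -ge0_integralZl//; last 3 first.
- exact: measurable_half_line.
- by move=> s _; rewrite mule_ge0 ?expeR_ge0// lee_fin expR_ge0.
- by rewrite lee_fin invr_ge0 subr_ge0 ltW.
apply: le_integral_of_le => s /= st.
  by rewrite !mule_ge0 ?expeR_ge0// lee_fin ?expR_ge0// invr_ge0 subr_ge0 ltW.
apply: (@le_trans _ _ (\int[mu]_(r in [set r | (r <= s)%R]) \int[P]_w (K p t s w * K p t r w))); last first.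
  apply: ge0_subset_integral => //.
  - exact: measurable_half_line.
  - exact: measurable_half_line.
  - by apply: measurable_funTS; exact: mKM.
  - by move=> r /= rs; exact: le_trans st.
rewrite le_eqVlt; apply/orP; left; apply/eqP.
transitivity (((expR (- (2 * eta * (t - s))))%:E * expeR ((t - s)%:E * k2 p p)) *
    \int[mu]_(r in [set r | (r <= s)%R]) (expR ((k - eta) * (s - r)))%:E).
  rewrite integral_exp_halfline; last by rewrite subr_lt0.
  by rewrite subrr mulr0 expR0 opprB div1r muleC.
rewrite -ge0_integralZl//; last 3 first.
- exact: measurable_half_line.
- exact: measurable_exp_affine.
- by rewrite mule_ge0 ?expeR_ge0// lee_fin expR_ge0.
apply: eq_integral => r; rewrite inE /= => rs.
rewrite expectation_growth_kernelM_ge// kE subrr mul0e expeR0 mule1 /=.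
rewrite [RHS]muleA [LHS]muleAC -!EFinM -!expRD; congr ((expR _)%:E * _); ring.
Qed.

(** The range of [r] is cut at [s] and at [t]. The pieces are exponential integrals with the
    negative exponents A and B of the single rates and C of the joint rate. *)
Lemma expectation_discounted_growthM_eq p q t u a b c :
  k1 p = a%:E -> (a < eta)%R -> k1 q = b%:E -> (b < eta)%R ->
  k2 p q = c%:E -> (c < 2 * eta)%R -> (t <= u)%R ->
  \int[P]_w (W p t w * W q u w) =
  (expR ((b - eta) * (u - t)) * (((a - eta) + (b - eta)) /
     ((a - eta) * (b - eta) * (c - 2 * eta))) +
   (1 - expR ((b - eta) * (u - t))) / ((a - eta) * (b - eta)))%:E.
Proof.
move=> aE aeta bE beta cE ceta tu.
set A := (a - eta)%R; set B := (b - eta)%R; set C := (c - 2 * eta)%R.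
have [A0 B0 C0] : [/\ (A < 0)%R, (B < 0)%R & (C < 0)%R] by split; rewrite subr_lt0.
have mhl := @measurable_half_line R.
have mho := @measurable_half_open R.
have mexpZ k x y D : measurable_fun D (fun s : measurableTypeR R => (k * expR (x * (y - s)))%:E).
  apply/measurable_EFinP; apply: measurable_funM => //; apply/measurable_EFinP.
  exact: measurable_exp_affine.
pose H (s r : R) := \int[P]_w (K p t s w * K q u r w).
pose X := [set x : R | (x <= t)%R].
have H0 s r : 0 <= H s r by exact: KM0.
have mH s (D : set R) : measurable_fun D (fun r : measurableTypeR R => H s r).
  by apply: measurable_funTS; exact: mKM.
have split1 s : X s -> \int[mu]_(r in [set r | (r <= u)%R]) H s r =
  \int[mu]_(r in [set r | (r <= s)%R]) H s r +
  (\int[mu]_(r in [set r | (s < r <= t)%R]) H s r +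
   \int[mu]_(r in [set r | (t < r <= u)%R]) H s r).
  move=> /= st; rewrite -ge0_integral_setU//=; last 4 first.
  - exact: mho.
  - exact: mho.
  - exact: mH.
  - by apply/disj_setPS => x /= [/andP[_ h1] /andP[/lt_le_trans/(_ h1)]]; rewrite ltxx.
  rewrite -ge0_integral_setU//=; last 4 first.
  - exact: mhl.
  - by apply: measurableU; exact: mho.
  - exact: mH.
  - apply/disj_setPS => x /= [h1 [/andP[/lt_le_trans/(_ h1)]|/andP[tx _]]].
      by rewrite ltxx.
    by have := lt_le_trans (le_lt_trans st tx) h1; rewrite ltxx.
  congr (integral _ _ _); apply/seteqP; split => x /=.
    move=> xu; have [?|?] := leP x s; first by left.
    by have [?|?] := leP x t; right; [left|right]; apply/andP.
  by move=> [h|[/andP[_ h]|/andP[_ //]]]; rewrite (le_trans h)// (le_trans st).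
pose E1 s := \int[mu]_(r in [set r | (r <= s)%R]) H s r.
pose E2 s := \int[mu]_(r in [set r | (s < r <= t)%R]) H s r.
pose E3 s := \int[mu]_(r in [set r | (t < r <= u)%R]) H s r.
have E1E s : X s -> E1 s = (expR (B * (u - t)) / - B * expR (C * (t - s)))%:E.
  move=> /= st.
  transitivity ((expR (B * (u - t)) * expR (C * (t - s)))%:E *
      \int[mu]_(r in [set r | (r <= s)%R]) (expR (B * (s - r)))%:E).
    rewrite -integral_expZ ?mulr_ge0 ?expR_ge0//; last exact: mhl.
    apply: eq_integral => r; rewrite inE /= => rs.
    rewrite /H expectation_growth_kernelM_ge// bE cE /= -!EFinM -!expRD.
    by congr (expR _)%:E; rewrite /B /C; ring.
  rewrite integral_exp_halfline// subrr mulr0 expR0 -EFinM; congr EFin.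
  by rewrite div1r mulrAC.
have E3E s : X s -> E3 s = ((expR (B * (u - t)) - 1) / B * expR (A * (t - s)))%:E.
  move=> /= st.
  transitivity ((expR (A * (t - s)))%:E *
      \int[mu]_(r in [set r | (t < r <= u)%R]) (expR (B * (u - r)))%:E).
    rewrite -integral_expZ ?mulr_ge0 ?expR_ge0//; last exact: mho.
    apply: eq_integral => r; rewrite inE /= => /andP[tr ru].
    rewrite /H expectation_growth_kernelM_le//; last exact: ltW.
    rewrite aE bE /= -!EFinM -!expRD.
    by congr (expR _)%:E; rewrite /A /B; ring.
  rewrite integral_exp_interval ?lt_eqF// subrr mulr0 expR0 -EFinM; congr EFin.
  by rewrite mulrC.
pose G (x : measurableTypeR R * measurableTypeR R) : \bar R :=
  if (x.1 < x.2)%R && (x.2 <= t)%R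
  then (expR (B * (u - t) + C * (t - x.2) + A * (x.2 - x.1)))%:E else 0.
have G0 x : 0 <= G x by rewrite /G; case: ifP => // _; rewrite lee_fin expR_ge0.
have mG : measurable_fun setT G.
  apply: measurable_fun_ifT => //.
    apply: measurable_and; [exact: measurable_fun_ltr|exact: measurable_fun_ler].
  apply/measurable_EFinP; apply: (measurableT_comp (@measurable_expR R)).
  apply: measurable_funD.
    apply: measurable_funD => //; apply: measurable_funM => //.
    by apply: measurable_funB.
  by apply: measurable_funM => //; exact: measurable_funB.
have E2E s : X s -> E2 s = \int[mu]_r G (s, r).
  move=> /= st; rewrite /E2 integral_mkcond; apply: eq_integral => r _.
  rewrite patchE /G /=; case: ifPn; rewrite ?inE ?notin_setE /=.
    move=> /andP[sr rt]; rewrite sr rt /=.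
    rewrite /H expectation_growth_kernelM_mid//; last exact: ltW.
    rewrite aE bE cE /= -!EFinM -!expRD.
    by congr (expR _)%:E; rewrite /A /B /C; ring.
  by move=> /negP/negbTE ->.
(* The order of integration is exchanged: integrating over [r] before [s] would produce the
   denominator C - A, which may vanish. *)
have IE2 : \int[mu]_(s in X) E2 s = (expR (B * (u - t)) / (A * C))%:E.
  transitivity (\int[mu]_s \int[mu]_r G (s, r)).
    rewrite (@integral_half_line t) => [|s ts].
      by apply: eq_integral => s; rewrite inE => /E2E.
    by apply: integral0_eq => r _; rewrite /G /= ifF//; apply/negbTE/negP => /andP[]; lra.
  rewrite (@fubini_tonelli _ _ (measurableTypeR R) (measurableTypeR R) R mu mu G)//.
  transitivity (\int[mu]_(r in X) (expR (B * (u - t)) / - A * expR (C * (t - r)))%:E).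
    rewrite (@integral_half_line t) => [|r tr]; last first.
      by apply: integral0_eq => s _; rewrite /G /= ifF//; apply/negbTE/negP => /andP[]; lra.
    apply: eq_integral => r; rewrite inE /= => rt.
    transitivity ((expR (B * (u - t)) * expR (C * (t - r)))%:E *
        \int[mu]_(s in [set s | (s <= r)%R]) (expR (A * (r - s)))%:E); last first.
      rewrite integral_exp_halfline// subrr mulr0 expR0 -!EFinM; congr EFin.
      by rewrite div1r mulrAC.
    rewrite -integral_expZ ?mulr_ge0 ?expR_ge0//; last exact: mhl.
    rewrite (@integral_half_line r) => [|s rs]; last first.
      by rewrite /G /= ltNge (ltW rs).
    rewrite (_ : [set s : R | (s <= r)%R] = `]-oo, r]%classic); last first.
      by apply/seteqP; split => s; rewrite /= in_itv.
    rewrite -!integral_itv_bndo_bndc; last 2 first.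
    - exact: mexpZ.
    - apply: measurable_funTS; exact: (measurableT_comp mG (pair2_measurable r)).
    apply: eq_integral => s; rewrite inE /= in_itv /= => sr.
    by rewrite /G /= sr rt /= !expRD.
  rewrite integral_expZ; [|exact: mhl|by rewrite mulr_ge0 ?expR_ge0// invr_ge0 oppr_ge0 ltW].
  rewrite integral_exp_halfline// subrr mulr0 expR0 -EFinM; congr EFin.
  by field; rewrite !lt_eqF.
rewrite expectation_discounted_growthM_ge.
transitivity (\int[mu]_(s in X) (E1 s + (E2 s + E3 s))).
  by apply: eq_integral => s; rewrite inE => Xs; exact: split1.
have mX : measurable X by exact: mhl.
have cvtE (k x : R) (f : measurableTypeR R -> \bar R) : (forall s, X s -> f s = (k * expR (x * (t - s)))%:E) ->
    (0 <= k)%R -> (x < 0)%R ->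
    [/\ \int[mu]_(s in X) f s = (k / - x)%:E, measurable_fun X f &
      forall s, X s -> 0 <= f s].
  move=> fE k0 x0.
  have fE' : {in X, f =1 (fun s : measurableTypeR R => (k * expR (x * (t - s)))%:E)}.
    by move=> s; rewrite inE => /fE ->.
  split.
  - transitivity (\int[mu]_(s in X) (k * expR (x * (t - s)))%:E).
      by apply: eq_integral => s /fE' ->.
    rewrite integral_expZ//.
    by rewrite integral_exp_halfline// subrr mulr0 expR0 -EFinM div1r.
  - apply: (eq_measurable_fun (fun s : measurableTypeR R => (k * expR (x * (t - s)))%:E)).
      by move=> s /fE' ->.
    exact: mexpZ.
  - by move=> s /fE ->; rewrite lee_fin mulr_ge0 ?expR_ge0.
have eB1 : (expR (B * (u - t)) <= 1)%R.
  by rewrite -expR0 ler_expR; rewrite nmulr_rle0// subr_ge0.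
have [|//|I1 mE1 E1ge0] := cvtE _ _ E1 E1E.
  by rewrite mulr_ge0 ?expR_ge0// invr_ge0 oppr_ge0 ltW.
have [|//|I3 mE3 E3ge0] := cvtE _ _ E3 E3E.
  by rewrite mulr_le0// ?subr_le0// invr_le0 ltW.
have mE2 : measurable_fun X E2.
  apply: (eq_measurable_fun (fun s : measurableTypeR R => \int[mu]_r G (s, r))).
    by move=> s; rewrite inE => /E2E ->.
  apply: measurable_funTS.
  exact: (@measurable_fun_fubini_tonelli_F _ _ _ (measurableTypeR R) R mu G).
have E2ge0 s : 0 <= E2 s by apply: integral_ge0 => r _; exact: H0.
clearbody E1 E2 E3; rewrite ge0_integralD//; last 2 first.
- by move=> s Xs; rewrite adde_ge0// E3ge0.
- exact: emeasurable_funD.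
rewrite ge0_integralD// I1 IE2 I3 -!EFinD; congr EFin.
by field; rewrite !lt_eqF.
Qed.

End stationary_moments.

(** * Expectations and covariances up to null sets *)

Lemma null_setU d (T : measurableType d) (R : realType)
    (mu : {measure set T -> \bar R}) (A B : set T) :
  measurable A -> measurable B -> mu A = 0%E -> mu B = 0%E -> mu (A `|` B) = 0%E.
Proof.
move=> mA mB A0 B0; apply/negligibleP; first exact: measurableU.
by apply: negligibleU; apply/negligibleP.
Qed.

Section covariance_up_to_null_sets.
Local Open Scope ereal_scope.
Context d (T : measurableType d) (R : realType) (P : probability T R).
Variable N : set T.
Hypotheses (mN : measurable N) (N0 : P N = 0).

Lemma expectation_null (X : T -> R) (X' : T -> \bar R) : (forall w, ~ N w -> (X w)%:E = X' w) ->
  'E_P[X] = \int[P]_w X' w.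
Proof.
by move=> XX'; rewrite unlock; apply: (eq_integral_null mN N0) => w Nw _; exact: XX'.
Qed.

Lemma expectationM_null (X Y : T -> R) (X' Y' : T -> \bar R) :
  (forall w, ~ N w -> (X w)%:E = X' w) -> (forall w, ~ N w -> (Y w)%:E = Y' w) ->
  'E_P[(fun w => X w * Y w)%R] = \int[P]_w (X' w * Y' w).
Proof. by move=> XE YE; apply: expectation_null => w Nw; rewrite EFinM XE// YE. Qed.

(** The usual formula remains true when the product has infinite expectation. Since (x - a) (y - b)
    + (a y + b x) = x y + a b, the negative part of (x - a) (y - b) is at most a y + b x, hence
    integrable. *)
Lemma covariance_null (X Y : T -> R) (X' Y' : T -> \bar R) (a b : R) :
  (forall w, ~ N w -> (X w)%:E = X' w) -> (forall w, ~ N w -> (Y w)%:E = Y' w) ->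
  measurable_fun setT X' -> measurable_fun setT Y' ->
  (forall w, 0 <= X' w) -> (forall w, 0 <= Y' w) ->
  \int[P]_w X' w = a%:E -> \int[P]_w Y' w = b%:E ->
  covariance P X Y = \int[P]_w (X' w * Y' w) - (a * b)%:E.
Proof.
move=> XE YE mX' mY' X0 Y0 IX IY.
pose x w := fine (X' w); pose y w := fine (Y' w).
have x0 w : (0 <= x w)%R by exact: fine_ge0.
have y0 w : (0 <= y w)%R by exact: fine_ge0.
have mx : measurable_fun setT x by exact: (measurableT_comp (fine_measurable measurableT) mX').
have my : measurable_fun setT y by exact: (measurableT_comp (fine_measurable measurableT) mY').
have Xx w : ~ N w -> X w = x w by move=> Nw; rewrite /x -XE.
have Yy w : ~ N w -> Y w = y w by move=> Nw; rewrite /y -YE.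
have a0 : (0 <= a)%R by rewrite -lee_fin -IX; apply: integral_ge0 => w _.
have b0 : (0 <= b)%R by rewrite -lee_fin -IY; apply: integral_ge0 => w _.
have Ix : \int[P]_w (x w)%:E = a%:E.
  rewrite -IX; apply: (eq_integral_null mN N0) => w Nw _.
  by rewrite /x -XE.
have Iy : \int[P]_w (y w)%:E = b%:E.
  rewrite -IY; apply: (eq_integral_null mN N0) => w Nw _.
  by rewrite /y -YE.
have Ixy : \int[P]_w (X' w * Y' w) = \int[P]_w (x w * y w)%:E.
  by apply: (eq_integral_null mN N0) => w Nw _; rewrite EFinM /x /y -XE// -YE.
pose phi w := ((x w - a) * (y w - b))%R.
have cE : covariance P X Y = \int[P]_w (phi w)%:E.
  rewrite covariance.unlock (expectation_null XE) (expectation_null YE) IX IY /=.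
  by apply: expectation_null => w Nw; rewrite /= /phi -Xx// -Yy.
have mphi : measurable_fun setT phi.
  by apply: measurable_funM; apply: measurable_funB.
pose p w := Num.max (phi w) 0%R; pose n w := Num.max (- phi w)%R 0%R.
have mp : measurable_fun setT p by exact: measurable_maxr.
have mn : measurable_fun setT n by apply: measurable_maxr => //; exact: measurable_funN.
have p0 w : (0 <= p w)%R by rewrite /p le_max lexx orbT.
have n0 w : (0 <= n w)%R by rewrite /n le_max lexx orbT.
have pn w : (p w - n w = phi w)%R.
  rewrite /p /n; case: (leP (phi w) 0%R) => h.
    by rewrite max_l ?oppr_ge0// sub0r opprK.
  by rewrite max_r ?oppr_le0 1?ltW// subr0.
have Dint (f g : T -> R) : measurable_fun setT f -> measurable_fun setT g ->
    (forall w, (0 <= f w)%R) -> (forall w, (0 <= g w)%R) ->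
    \int[P]_w (f w + g w)%:E = \int[P]_w (f w)%:E + \int[P]_w (g w)%:E.
  move=> mf mg f0 g0; under eq_integral do rewrite EFinD.
  by apply: ge0_integralD => //; do ?[by move=> w _; rewrite lee_fin|exact/measurable_EFinP].
have Zint (k : R) (f : T -> R) : (0 <= k)%R -> measurable_fun setT f ->
    (forall w, (0 <= f w)%R) ->
    \int[P]_w (k * f w)%:E = k%:E * \int[P]_w (f w)%:E.
  move=> k0 mf f0; under eq_integral do rewrite EFinM.
  by apply: ge0_integralZl => //; do ?[by move=> w _; rewrite lee_fin|exact/measurable_EFinP].
pose h w := (a * y w + b * x w)%R.
have h0 w : (0 <= h w)%R by rewrite addr_ge0// mulr_ge0.
have mh : measurable_fun setT h by apply: measurable_funD; exact: measurable_funM.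
have Ih : \int[P]_w (h w)%:E = (a * b + a * b)%:E.
  rewrite Dint//; try exact: measurable_funM; try by move=> w; exact: mulr_ge0.
  by rewrite !Zint// Ix Iy -!EFinM -EFinD (mulrC b).
have Iab : \int[P]_w (x w * y w + a * b)%:E = \int[P]_w (x w * y w)%:E + (a * b)%:E.
  rewrite Dint//; last 3 first.
  - exact: measurable_funM.
  - by move=> w; exact: mulr_ge0.
  - by move=> w; exact: mulr_ge0.
  by congr (_ + _); exact: integral_prob_cst.
(* The product of X' and Y' need not be integrable, so only nonnegative parts
   are moved across the equality. *)
have key : \int[P]_w (p w)%:E + (a * b + a * b)%:E =
    \int[P]_w (n w)%:E + (\int[P]_w (x w * y w)%:E + (a * b)%:E).
  rewrite -Ih -Iab -!Dint//; last 2 first.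
  - by apply: measurable_funD => //; exact: measurable_funM.
  - by move=> w; rewrite addr_ge0// mulr_ge0.
  apply: eq_integral => w _; congr EFin.
  by have := pn w; rewrite /phi /h; lra.
have nh : \int[P]_w (n w)%:E <= (a * b + a * b)%:E.
  rewrite -Ih; apply: le_integral_of_le => w _; rewrite lee_fin//.
  rewrite /n ge_max h0 andbT /phi /h.
  have := mulr_ge0 (x0 w) (y0 w); have := mulr_ge0 a0 b0; lra.
have n00 : 0 <= \int[P]_w (n w)%:E by apply: integral_ge0 => w _; rewrite lee_fin.
have p00 : 0 <= \int[P]_w (p w)%:E by apply: integral_ge0 => w _; rewrite lee_fin.
have xy0 : 0 <= \int[P]_w (x w * y w)%:E.
  by apply: integral_ge0 => w _; rewrite lee_fin mulr_ge0.
rewrite cE Ixy integralE.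
have -> : \int[P]_w ((fun w => (phi w)%:E)^\+ w) = \int[P]_w (p w)%:E.
  by apply: eq_integral => w _; rewrite funeposE -EFin_max.
have -> : \int[P]_w ((fun w => (phi w)%:E)^\- w) = \int[P]_w (n w)%:E.
  by apply: eq_integral => w _; rewrite funenegE -EFinN -EFin_max.
move: key nh n00 p00 xy0.
case: (\int[P]_w (p w)%:E) => [q| |]//; case: (\int[P]_w (n w)%:E) => [s| |]//;
  case: (\int[P]_w (x w * y w)%:E) => [z| |]//.
by rewrite -!EFinD => -[] H _ _ _ _; congr EFin; lra.
Qed.

End covariance_up_to_null_sets.

(** * Superposition *)

Section supcogarch_moments.
Local Open Scope ereal_scope.
Context d (T : measurableType d) (R : realType) (P : probability T R).
Variables (L S : R -> T -> R) (beta eta eps : R) (N : set T).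
Hypotheses (beta0 : (0 < beta)%R) (eta0 : (0 < eta)%R) (eps0 : (0 <= eps)%R).
Hypotheses (levL : cadlag_levy P L) (mN : measurable N) (N0 : P N = 0).
Hypothesis finS : forall w, ~ N w -> forall a b,
  jump_sum (L ^~ w) (fun y => eps * y ^+ 2)%R a b < +oo.
Hypothesis S1E : forall w, ~ N w ->
  (S 1%R w)%:E = jump_sum (L ^~ w) (fun y => eps * y ^+ 2)%R 0%R 1%R.
Notation mu := (@lebesgue_measure R).
Notation W := (discounted_growth L eta eps).
Hypothesis cogarch_growth : forall w, ~ N w -> forall phi t, (0 <= phi)%R ->
  cogarch beta eta S phi t w = beta%:E * W phi t w.
Notation V := (fun phi t w => fine (cogarch beta eta S phi t w)).
Notation m1 := (jump_intensity P L (fun y => eps * y ^+ 2)%R).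
Notation m2 := (jump_intensity P L (fun y => (eps * y ^+ 2) ^+ 2)%R).
Notation m := (fine 'E_P[S 1%R]).
Notation v := (fine 'V_P[S 1%R]).

Let asize := admissible_jump_size eps0.

Let m1_ge0 : 0 <= m1. Proof. exact: jump_intensity_ge0. Qed.

Let m2_ge0 : 0 <= m2.
Proof. by apply: jump_intensity_ge0; exact: admissible_sqr. Qed.

Lemma expectation_subordinator : 'E_P[S 1%R] = m1.
Proof. exact: (expectation_null mN N0 S1E). Qed.

(** Subtracting the squared mean from the second moment formula for jump sums leaves the intensity
    of the squared jumps of [S]. *)
Lemma variance_subordinator : m1 \is a fin_num -> 'V_P[S 1%R] = m2.
Proof.
move=> m1fin; rewrite /variance.
have mE : m1 = (fine m1)%:E by rewrite fineK.
have Y0 w : 0 <= jump_sum (L ^~ w) (fun y => eps * y ^+ 2)%R 0%R 1%R.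
  by apply: jump_sum_ge0; case: asize.
rewrite (covariance_null mN N0 S1E S1E _ _ Y0 Y0 mE mE); last 2 first.
- exact: (measurable_levy_jump_sum levL).
- exact: (measurable_levy_jump_sum levL).
rewrite (expectation_sqr_jump_sum levL asize m1fin) EFinM -mE addeK//.
by rewrite mE -EFinM.
Qed.

Lemma mean_ge0 : (0 <= m)%R.
Proof. by rewrite expectation_subordinator; exact: fine_ge0. Qed.

Lemma variance_ge0 : m1 \is a fin_num -> (0 <= v)%R.
Proof. by move=> m1fin; rewrite variance_subordinator//; exact: fine_ge0. Qed.

Let WW x t w : 0 <= W x t w. Proof. exact: discounted_growth_ge0. Qed.

Let mW x t : measurable_fun setT (W x t).
Proof. exact: (@measurable_discounted_growth _ _ _ P L eta eps levL eps0 _ T (cst x) t id). Qed.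

Lemma growth_rate_mean x : m1 \is a fin_num -> (0 <= x)%R ->
  growth_rate P L eps x = (x * m)%:E.
Proof.
move=> m1fin x0.
by rewrite (growth_rateE levL eps0) ger0_norm// expectation_subordinator EFinM fineK.
Qed.

Lemma joint_growth_rate_mean x y : m1 \is a fin_num -> m2 \is a fin_num ->
  (0 <= x)%R -> (0 <= y)%R ->
  joint_growth_rate P L eps x y = ((x + y) * m + x * y * v)%:E.
Proof.
move=> m1fin m2fin x0 y0; rewrite (joint_growth_rateE levL eps0) !ger0_norm//.
rewrite expectation_subordinator variance_subordinator//.
rewrite -{1 2}(fineK m1fin) -{1}(fineK m2fin) -!EFinM -!EFinD; congr EFin; ring.
Qed.

Lemma integral_cogarch psi : (0 <= psi)%R ->
  \int[P]_w poweR (cogarch beta eta S psi 0%R w) 1 = \int[P]_w (beta%:E * W psi 0%R w).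
Proof.
move=> psi0; apply: (eq_integral_null mN N0) => w Nw _.
by rewrite cogarch_growth// poweRe1// mule_ge0// lee_fin ltW.
Qed.

Lemma integral_cogarch_sqr psi : (0 <= psi)%R ->
  \int[P]_w poweR (cogarch beta eta S psi 0%R w) 2 =
  \int[P]_w ((beta%:E * W psi 0%R w) * (beta%:E * W psi 0%R w)).
Proof.
move=> psi0; apply: (eq_integral_null mN N0) => w Nw _.
rewrite cogarch_growth//.
have : 0 <= beta%:E * W psi 0%R w by rewrite mule_ge0// lee_fin ltW.
case: (beta%:E * W psi 0%R w) => [r| |]//=; last by rewrite pnatr_eq0 mulyy.
by rewrite lee_fin -EFinM => r0; rewrite powR_mulrn// expr2.
Qed.

(** The growth rate is [psi] times the mean of [S 1]; since [psi > 0], a finite bound on the rate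
    makes this mean finite. *)
Lemma moment1_rate psi : (0 < psi)%R ->
  \int[P]_w poweR (cogarch beta eta S psi 0%R w) 1 < +oo ->
  m1 \is a fin_num /\ (psi * m < eta)%R.
Proof.
move=> psi0; rewrite integral_cogarch ?ltW//.
rewrite ge0_integralZl//; last by rewrite lee_fin ltW.
move=> fin; have {}fin : \int[P]_w W psi 0%R w < +oo.
  rewrite ltey; apply/negP => /eqP WE; move: fin.
  by rewrite WE gt0_muley// ltxx.
have kl := growth_rate_lt levL eps0 fin.
have m1fin : m1 \is a fin_num.
  rewrite ge0_fin_numE// ltey; apply/negP => /eqP mE; move: kl.
  by rewrite (growth_rateE levL eps0) mE gt0_muley// ?lte_fin ?normr_gt0 ?gt_eqF.
by split => //; move: kl; rewrite growth_rate_mean ?ltW.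
Qed.

Lemma moment2_rate psi : (0 < psi)%R ->
  \int[P]_w poweR (cogarch beta eta S psi 0%R w) 2 < +oo ->
  [/\ m1 \is a fin_num, m2 \is a fin_num, (psi * m < eta)%R &
    ((psi + psi) * m + psi * psi * v < 2 * eta)%R].
Proof.
move=> psi0; rewrite integral_cogarch_sqr ?ltW// => fin.
have fin1 : \int[P]_w poweR (cogarch beta eta S psi 0%R w) 1 < +oo.
  rewrite integral_cogarch ?ltW//.
  have bW0 w : 0 <= beta%:E * W psi 0%R w by rewrite mule_ge0// lee_fin ltW.
  have mbW : measurable_fun setT (fun w => beta%:E * W psi 0%R w).
    exact: emeasurable_funM.
  (* The second moment controls the first through r <= 1 + r^2. *)
  apply: (@le_lt_trans _ _ (\int[P]_w (1 + (beta%:E * W psi 0%R w) * (beta%:E * W psi 0%R w)))).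
    apply: le_integral_of_le => w _ //; move: (bW0 w).
    case: (beta%:E * W psi 0%R w) => [r| |]//.
    by rewrite lee_fin -EFinM -EFinD lee_fin => r0; nra.
  rewrite ge0_integralD//.
  - by rewrite integral_prob_cst lte_add_pinfty// ltry.
  - by move=> w _; rewrite mule_ge0.
  - exact: emeasurable_funM.
have [m1fin pm] := moment1_rate psi0 fin1.
have {}fin : \int[P]_w (W psi 0%R w * W psi 0%R w) < +oo.
  move: fin; rewrite (_ : \int[P]_w _ = (beta * beta)%:E * \int[P]_w (W psi 0%R w * W psi 0%R w)).
    move=> fin; rewrite ltey; apply/negP => /eqP WE; move: fin.
    by rewrite WE gt0_muley ?ltxx// lte_fin mulr_gt0.
  rewrite -ge0_integralZl//.
  - by apply: eq_integral => w _; rewrite muleACA -EFinM.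
  - exact: emeasurable_funM.
  - by move=> w _; rewrite mule_ge0.
  - by rewrite lee_fin mulr_ge0// ltW.
have kl : joint_growth_rate P L eps psi psi < (2 * eta)%:E.
  apply: (joint_growth_rate_lt levL eps0 _ fin).
  by rewrite growth_rate_mean ?ltW// lte_fin.
have m2fin : m2 \is a fin_num.
  rewrite ge0_fin_numE// ltey; apply/negP => /eqP mE; move: kl.
  rewrite (joint_growth_rateE levL eps0) mE gt0_muley//; last first.
    by rewrite lte_fin mulr_gt0 ?normr_gt0 ?gt_eqF.
  by rewrite addey// ?addey// -(fineK m1fin).
by split => //; move: kl; rewrite joint_growth_rate_mean ?ltW.
Qed.

Section finite_moments.
Hypothesis m1fin : m1 \is a fin_num.

Let den x := (eta - x * m)%R.

Lemma expectation_growth x t : (0 <= x)%R -> (x * m < eta)%R ->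
  \int[P]_w W x t w = ((den x)^-1)%:E.
Proof.
move=> x0 xm; apply: (expectation_discounted_growth_eq levL eps0) => //.
exact: growth_rate_mean.
Qed.

Lemma expectation_growth_scaled x t : (0 <= x)%R -> (x * m < eta)%R ->
  \int[P]_w (beta%:E * W x t w) = (beta / den x)%:E.
Proof.
move=> x0 xm; rewrite ge0_integralZl//; last by rewrite lee_fin ltW.
by rewrite expectation_growth// -EFinM.
Qed.

(** A finite mean makes the extended-valued process finite off a null set, where [fine] changes
    nothing. *)
Lemma fine_cogarch_null x t : (0 <= x)%R -> (x * m < eta)%R ->
  exists M, [/\ measurable M, P M = 0 &
    forall w, ~ M w -> (V x t w)%:E = beta%:E * W x t w].
Proof.
move=> x0 xm.
have WI : P.-integrable setT (W x t).
  apply/integrableP; split => //.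
  under eq_integral do rewrite gee0_abs//.
  by rewrite expectation_growth// ltry.
have [A [mA A0 HA]] := integrable_ae measurableT WI.
exists (N `|` A); split; first exact: measurableU.
  exact: null_setU.
move=> w /not_orP[Nw Aw]; have Wfin : W x t w \is a fin_num.
  by apply: contrapT => Wn; apply: Aw; apply: HA => /(_ Logic.I).
by rewrite cogarch_growth// fineK// -(fineK Wfin).
Qed.

Lemma expectation_cogarch x t : (0 <= x)%R -> (x * m < eta)%R ->
  'E_P[V x t] = (beta / den x)%:E.
Proof.
move=> x0 xm; have [M [mM M0 HM]] := fine_cogarch_null t x0 xm.
by rewrite (expectation_null mM M0 HM) expectation_growth_scaled.
Qed.

Lemma cogarch_pair x y t u : (0 <= x)%R -> (x * m < eta)%R ->
  (0 <= y)%R -> (y * m < eta)%R ->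
  'E_P[(fun w => V x t w * V y u w)%R] =
    \int[P]_w ((beta%:E * W x t w) * (beta%:E * W y u w)) /\
  covariance P (V x t) (V y u) =
    \int[P]_w ((beta%:E * W x t w) * (beta%:E * W y u w)) -
    (beta / den x * (beta / den y))%:E.
Proof.
move=> x0 xm y0 ym; have [M [mM M0 HM]] := fine_cogarch_null t x0 xm.
have [M' [mM' M'0 HM']] := fine_cogarch_null u y0 ym.
have mU : measurable (M `|` M') by exact: measurableU.
have U0 : P (M `|` M') = 0.
  exact: null_setU.
have HX w : ~ (M `|` M') w -> (V x t w)%:E = beta%:E * W x t w by move=> /not_orP[/HM].
have HY w : ~ (M `|` M') w -> (V y u w)%:E = beta%:E * W y u w by move=> /not_orP[_ /HM'].
split; first exact: (expectationM_null mU U0 HX HY).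
have bW0 z s w : 0 <= beta%:E * W z s w by rewrite mule_ge0// lee_fin ltW.
have mbW z s : measurable_fun setT (fun w => beta%:E * W z s w) by exact: emeasurable_funM.
apply: (covariance_null mU U0 HX HY) => //; exact: expectation_growth_scaled.
Qed.

Hypothesis m2fin : m2 \is a fin_num.

Lemma expectation_growthM x y t u : (0 <= x)%R -> (x * m < eta)%R ->
  (0 <= y)%R -> (y * m < eta)%R -> ((x + y) * m + x * y * v < 2 * eta)%R -> (t <= u)%R ->
  \int[P]_w ((beta%:E * W x t w) * (beta%:E * W y u w)) =
  (beta ^+ 2 * (expR ((u - t) * (y * m - eta)) *
     (((x + y) * m - 2 * eta) /
      ((x * m - eta) * (y * m - eta) * ((x + y) * m + x * y * v - 2 * eta))) +
   (1 - expR ((u - t) * (y * m - eta))) / ((x * m - eta) * (y * m - eta))))%:E.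
Proof.
move=> x0 xm y0 ym xy tu.
transitivity ((beta * beta)%:E * \int[P]_w (W x t w * W y u w)).
  rewrite -ge0_integralZl//.
  - by apply: eq_integral => w _; rewrite muleACA -EFinM.
  - exact: emeasurable_funM.
  - by move=> w _; rewrite mule_ge0.
  - by rewrite lee_fin mulr_ge0// ltW.
rewrite (expectation_discounted_growthM_eq levL eps0 (growth_rate_mean m1fin x0) xm
  (growth_rate_mean m1fin y0) ym (joint_growth_rate_mean m1fin m2fin x0 y0) xy tu).
rewrite -EFinM -expr2 (mulrC (y * m - eta)%R); congr (_ * (_ * (_ / _) + _))%:E.
by lra.
Qed.

End finite_moments.

Section superposition.
Variable rho : probability (measurableTypeR R) R.
Variables Phi G : set (measurableTypeR R).
Hypotheses (mPhi : measurable Phi) (mG : measurable G).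
Hypotheses (rhoPhi : rho Phi = 1) (rhoG : rho G = 1).
Hypothesis Phi_ge0 : forall x, Phi x -> (0 <= x)%R.
Hypothesis m1fin : m1 \is a fin_num.
Hypothesis G_ge0 : forall x, G x -> (0 <= x)%R.
Hypothesis G_rate : forall x, G x -> (x * m < eta)%R.

Let compl_null (A : set (measurableTypeR R)) : measurable A -> rho A = 1 -> rho (~` A) = 0.
Proof. by move=> mA A1; rewrite probability_setC// A1 subee. Qed.

(** Both [Phi] and [G] carry the full mass, so values outside [G], where the moment formulas may
    fail, do not count. Later [G] is one of the moment sets. *)
Lemma integral_Phi (f g : R -> \bar R) : (forall x, G x -> f x = g x) ->
  \int[rho]_(x in Phi) f x = \int[rho]_x g x.
Proof.
move=> fg; rewrite integral_mkcond.
apply: (@eq_integral_null _ _ _ rho (~` Phi `|` ~` G)).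
- by apply: measurableU; exact: measurableC.
- by apply: null_setU; [exact: measurableC|exact: measurableC|exact: compl_null|exact: compl_null].
- move=> x /not_orP[/contrapT Px /contrapT Gx] _; rewrite patchE ifT ?inE//.
  exact: fg.
Qed.

Definition superposed_growth t w : \bar R := \int[rho]_p (beta%:E * W p t w).

Lemma supcogarch_growth t w : ~ N w ->
  supcogarch beta eta S Phi rho t w = superposed_growth t w.
Proof.
move=> Nw; rewrite /supcogarch integral_mkcond.
apply: (@eq_integral_null _ _ _ rho (~` Phi)).
- exact: measurableC.
- exact: compl_null.
- move=> x /contrapT Px _; rewrite patchE ifT ?inE//.
  by rewrite cogarch_growth//; exact: Phi_ge0.
Qed.

Let bW0 x t w : 0 <= beta%:E * W x t w.
Proof. by rewrite mule_ge0// lee_fin ltW. Qed.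

Let mbW dA (A : measurableType dA) (p : A -> R) t (w : A -> T) :
  measurable_fun setT p -> measurable_fun setT w ->
  measurable_fun setT (fun a => beta%:E * W (p a) t (w a)).
Proof.
by move=> mp mw; apply: emeasurable_funM => //; exact: (measurable_discounted_growth eta levL eps0).
Qed.

Lemma superposed_growth_ge0 t w : 0 <= superposed_growth t w.
Proof. by apply: integral_ge0 => p _. Qed.

Lemma measurable_superposed_growth t : measurable_fun setT (superposed_growth t).
Proof.
apply: (@measurable_fun_fubini_tonelli_F _ _ T (measurableTypeR R) R rho
  (fun x => beta%:E * W x.2 t x.1)) => [|x]; last exact: bW0.
by apply: mbW.
Qed.

Lemma expectation_superposed_growth t :
  \int[P]_w superposed_growth t w = \int[rho]_p \int[P]_w (beta%:E * W p t w).
Proof.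
apply: (@fubini_tonelli _ _ T (measurableTypeR R) R P rho
  (fun x => beta%:E * W x.2 t x.1)) => [|x]; last exact: bW0.
by apply: mbW.
Qed.

Lemma expectation_superposed_growthM t u :
  \int[P]_w (superposed_growth t w * superposed_growth u w) =
  \int[rho]_y \int[rho]_x \int[P]_w ((beta%:E * W x t w) * (beta%:E * W y u w)).
Proof.
pose F (z : T * measurableTypeR R) := superposed_growth t z.1 * (beta%:E * W z.2 u z.1).
transitivity (\int[P]_w \int[rho]_y F (w, y)).
  apply: eq_integral => w _; rewrite -ge0_integralZl//.
  - by apply: (@mbW _ (measurableTypeR R) id u (cst w)).
  - exact: superposed_growth_ge0.
rewrite (@fubini_tonelli _ _ T (measurableTypeR R) R P rho)//; first last.
- by move=> z; rewrite /F mule_ge0// superposed_growth_ge0.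
- apply: emeasurable_funM; last by apply: mbW.
  exact: (measurableT_comp (measurable_superposed_growth t) measurable_fst).
apply: eq_integral => y _.
pose H (z : T * measurableTypeR R) := (beta%:E * W z.2 t z.1) * (beta%:E * W y u z.1).
have integralZr (k : \bar R) (f : measurableTypeR R -> \bar R) :
    0 <= k -> measurable_fun setT f -> (forall x, 0 <= f x) ->
    (\int[rho]_x f x) * k = \int[rho]_x (f x * k).
  move=> k0 mf f0; rewrite muleC -ge0_integralZl//.
  by apply: eq_integral => x _; rewrite muleC.
transitivity (\int[P]_w \int[rho]_x H (w, x)).
  apply: eq_integral => w _; apply: integralZr => //.
  by apply: (@mbW _ (measurableTypeR R) id t (cst w)).
rewrite (@fubini_tonelli _ _ T (measurableTypeR R) R P rho)//; last first.
  by move=> z; rewrite /H mule_ge0.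
apply: emeasurable_funM; first by apply: mbW.
exact: (@mbW _ _ (cst y) u fst).
Qed.

Lemma fine_supcogarch_null t M : measurable M -> P M = 0 ->
  (forall w, ~ M w -> superposed_growth t w < +oo) ->
  exists M', [/\ measurable M', P M' = 0 & forall w, ~ M' w ->
    (fine (supcogarch beta eta S Phi rho t w))%:E = superposed_growth t w].
Proof.
move=> mM M0 HM; exists (N `|` M); split; [exact: measurableU|exact: null_setU|].
move=> w /not_orP[Nw Mw]; rewrite supcogarch_growth// fineK// ge0_fin_numE ?HM//.
exact: superposed_growth_ge0.
Qed.

(** For a start s <= 0 the growth splits at time 0, and discounting further only decreases the
    kernel. For a start in ]0, t] the kernel is at most the growth over ]0, t], which accounts for
    the summand [t]. *)
Lemma discounted_growth_le x t w : (0 <= t)%R ->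
  W x t w <= expeR (jump_sum (L ^~ w) (log_jump eps x) 0%R t) * (W x 0%R w + t%:E).
Proof.
move=> t0; set C := expeR _; have C0 : 0 <= C by exact: expeR_ge0.
have l0 y : (0 <= log_jump eps x y)%R by exact: log_jump_ge0.
pose I (s : measurableTypeR R) : \bar R := (\1_[set s : R | (0 < s <= t)%R] s)%:E.
have mI : measurable_fun setT I.
  by apply/measurable_EFinP; apply: measurable_indic; exact: measurable_half_open.
have I0 s : 0 <= I s by rewrite lee_fin.
have mK : measurable_fun setT (fun s : measurableTypeR R => growth_kernel L eta eps x 0%R s w).
  exact: (@measurable_growth_kernel _ _ _ _ L eta eps levL eps0 _ (measurableTypeR R)
    (cst x) (cst 0%R) id (cst w)).
have K0 t' s : 0 <= growth_kernel L eta eps x t' s w by exact: growth_kernel_ge0.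
have IE : \int[mu]_s I s = t%:E.
  rewrite integral_indic//; last exact: measurable_half_open.
  rewrite setIT half_open_itvE.
  apply: (eq_trans (lebesgue_measure_itv `]0%R, t]%R)); rewrite /= lte_fin.
  by case: ltP => [_|h]; rewrite ?sube0//; congr EFin; apply/eqP; rewrite eq_le t0 h.
have -> : C * (W x 0%R w + t%:E) =
    \int[mu]_s (C * (growth_kernel L eta eps x 0%R s w + I s)).
  rewrite ge0_integralZl//; last 2 first.
  - exact: emeasurable_funD.
  - by move=> s _; rewrite adde_ge0.
  by rewrite ge0_integralD// IE.
apply: le_integral_of_le => s _ //.
have [st|st] := leP s t; last by rewrite {1}/growth_kernel ifN -?ltNge// mule_ge0 ?adde_ge0.
have e1 r : (0 <= r)%R -> (expR (- (eta * r)))%:E <= 1.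
  by move=> r0; rewrite lee_fin -expR0 ler_expR oppr_le0 mulr_ge0// ltW.
rewrite {1}/growth_kernel ifT//; have [s0|s0] := leP s 0%R.
  rewrite (@jump_sum_cat _ _ _ s 0%R t)// expeRD.
  rewrite /growth_kernel ifT// -/C.
  set E := expeR _; have E0 : 0 <= E by exact: expeR_ge0.
  apply: (@le_trans _ _ (C * ((expR (- (eta * (0 - s))))%:E * E))); last first.
    by rewrite lee_wpmul2l// leeDl.
  rewrite [leRHS]muleC -muleA; apply: lee_wpmul2r; first exact: mule_ge0.
  by rewrite lee_fin ler_expR lerN2 ler_pM2l// lerB.
apply: (@le_trans _ _ C).
  apply: (@le_trans _ _ (1 * expeR (jump_sum (L ^~ w) (log_jump eps x) s t))).
    by apply: lee_wpmul2r; [exact: expeR_ge0|apply: e1; rewrite subr_ge0].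
  rewrite mul1e lee_expeR (@jump_sum_cat _ _ _ 0%R s t)//; last exact: ltW.
  by rewrite leeDr// jump_sum_ge0.
rewrite -[leLHS]mule1 lee_wpmul2l//.
by rewrite /I indicE mem_set ?leeDr//= s0.
Qed.

(** The constant is uniform in the parameter: the exponent is at most x Y, with Y the jump sum of
    [S] over ]0, t], and x < eta / m. If m = 0 this bound on x is lost, but then Y = 0 almost surely
    and [c = 1] serves. *)
Lemma growth_bound t : (0 <= t)%R -> exists M, [/\ measurable M, P M = 0 &
  forall w, ~ M w -> exists c : R, (0 <= c)%R /\ forall x, G x ->
    expeR (jump_sum (L ^~ w) (log_jump eps x) 0%R t) <= c%:E].
Proof.
move=> t0; pose Y w := jump_sum (L ^~ w) (fun y => eps * y ^+ 2)%R 0%R t.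
have g0 y : (0 <= eps * y ^+ 2)%R by case: asize.
have Y0 w : 0 <= Y w by exact: jump_sum_ge0.
have mY : measurable_fun setT Y by exact: (measurable_levy_jump_sum levL).
have JY x w : (0 <= x)%R -> ~ N w ->
    jump_sum (L ^~ w) (log_jump eps x) 0%R t <= x%:E * Y w.
  move=> x0 Nw; have [->|xn0] := eqVneq x 0%R.
    rewrite mul0e /jump_sum esum1// => u _.
    by rewrite /log_jump normr0 mul0r addr0 ln1.
  rewrite -jump_sumZ//; last by rewrite lt_def xn0.
  apply: le_jump_sum => y.
  rewrite /log_jump ger0_norm//; apply: le_ln1Dx.
  by apply: (lt_le_trans (ltrN10 _)); exact: mulr_ge0.
have [mz|mn0] := eqVneq m 0%R.
  have IY : \int[P]_w Y w = 0.
    rewrite expectation_jump_sum// -expectation_subordinator.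
    by rewrite -[X in _ * X]fineK ?mz ?mule0// expectation_subordinator.
  have IY' : \int[P]_w `|Y w| = 0 by under eq_integral do rewrite gee0_abs//.
  have [A [mA A0 HA]] := (ae_eq_integral_abs P measurableT mY).1 IY'.
  exists (N `|` A); split; [exact: measurableU|exact: null_setU|].
  move=> w /not_orP[Nw Aw]; exists 1%R; split => // x Gx.
  have Yw : Y w = 0 by apply: contrapT => Yw; apply: Aw; apply: HA => /(_ Logic.I).
  by rewrite -[leRHS](@expeR0 R) lee_expeR (le_trans (JY _ _ (G_ge0 Gx) Nw))// Yw mule0.
have mp : (0 < m)%R by rewrite lt_def mn0 mean_ge0.
exists N; split => // w Nw; exists (expR (eta / m * fine (Y w))).
have Yfin : Y w \is a fin_num by rewrite ge0_fin_numE// finS.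
split; first exact: expR_ge0.
move=> x Gx; rewrite -[leRHS]/(expeR (eta / m * fine (Y w))%:E) lee_expeR.
apply: le_trans (JY _ _ (G_ge0 Gx) Nw) _.
rewrite -(fineK Yfin) -EFinM lee_fin ler_wpM2r ?fine_ge0//.
by rewrite ler_pdivlMr// ltW// G_rate.
Qed.

Let integral_G (f g : R -> \bar R) : (forall x, G x -> f x = g x) ->
  \int[rho]_x f x = \int[rho]_x g x.
Proof.
move=> fg; apply: (@eq_integral_null _ _ _ rho (~` G)).
- exact: measurableC.
- exact: compl_null.
- by move=> x /contrapT Gx _; exact: fg.
Qed.

Let den x := (eta - x * m)%R.

Let den_gt0 x : G x -> (0 < den x)%R.
Proof. by move=> /G_rate; rewrite subr_gt0. Qed.

Let mbWx t w : measurable_fun setT (fun x : measurableTypeR R => beta%:E * W x t w).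
Proof. by apply: (@mbW _ (measurableTypeR R) id t (cst w)). Qed.

Let mean_growth t x := \int[P]_w (beta%:E * W x t w).

Let mean_growth_ge0 t x : 0 <= mean_growth t x.
Proof. exact: integral_ge0. Qed.

Let measurable_mean_growth t : measurable_fun setT (mean_growth t : measurableTypeR R -> \bar R).
Proof.
apply: (@measurable_fun_fubini_tonelli_F _ _ (measurableTypeR R) T R P
  (fun x => beta%:E * W x.1 t x.2)) => [|x]; last exact: bW0.
by apply: mbW.
Qed.

Let mean_growthE t x : G x -> mean_growth t x = (beta / den x)%:E.
Proof. by move=> Gx; apply: expectation_growth_scaled; [|exact: G_ge0|exact: G_rate]. Qed.

Lemma superposed_growth_finite t M0 : (0 <= t)%R -> measurable M0 -> P M0 = 0 ->
  (forall w, ~ M0 w -> superposed_growth 0%R w < +oo) ->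
  exists M, [/\ measurable M, P M = 0 & forall w, ~ M w -> superposed_growth t w < +oo].
Proof.
move=> t0 mM0 M00 fin0; have [M [mM M00' HM]] := growth_bound t0.
exists (M0 `|` M); split; [exact: measurableU|exact: null_setU|].
move=> w /not_orP[M0w /HM[c [c0 Hc]]].
apply: (@le_lt_trans _ _ (c%:E * (superposed_growth 0%R w + (beta * t)%:E))); last first.
  rewrite lte_mul_pinfty ?lee_fin//; apply: lte_add_pinfty; first exact: fin0.
  exact: ltry.
pose g (x : measurableTypeR R) := c%:E * (beta%:E * W x 0%R w + (beta * t)%:E).
have bt0 : 0 <= (beta * t)%:E by rewrite lee_fin mulr_ge0// ltW.
have g0 x : 0 <= g x by rewrite mule_ge0 ?adde_ge0 ?lee_fin.
have -> : c%:E * (superposed_growth 0%R w + (beta * t)%:E) = \int[rho]_x g x.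
  rewrite /g ge0_integralZl ?lee_fin//; last 2 first.
  - by apply: emeasurable_funD => //; exact: mbWx.
  - by move=> x _; rewrite adde_ge0.
  rewrite ge0_integralD//.
  by rewrite integral_prob_cst.
rewrite /superposed_growth (@integral_G _ (fun x => if x \in G then beta%:E * W x t w else 0)) => [|x Gx]; last first.
  by rewrite ifT// inE.
apply: le_integral_of_le => x _; case: ifPn => // Gx.
apply: (@le_trans _ _ (beta%:E * (c%:E * (W x 0%R w + t%:E)))).
  apply: lee_wpmul2l; first by rewrite lee_fin ltW.
  apply: le_trans (@discounted_growth_le x t w t0) _.
  apply: lee_wpmul2r; first by rewrite adde_ge0 ?lee_fin.
  by apply: Hc; rewrite inE in Gx.
by rewrite /g muleCA ge0_muleDr ?lee_fin// EFinM.
Qed.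

Lemma expectation_supcogarch t M : measurable M -> P M = 0 ->
  (forall w, ~ M w -> superposed_growth t w < +oo) ->
  'E_P[(fun w => fine (supcogarch beta eta S Phi rho t w))] =
    \int[rho]_(x in Phi) 'E_P[V x 0%R].
Proof.
move=> mM M0 fin; have [M' [mM' M'0 HM']] := fine_supcogarch_null mM M0 fin.
rewrite (expectation_null mM' M'0 HM') expectation_superposed_growth.
apply/esym/integral_Phi => x Gx.
rewrite (expectation_cogarch m1fin _ (G_ge0 Gx) (G_rate Gx)).
by rewrite -/(mean_growth t x) mean_growthE.
Qed.

Lemma integral_expectation_cogarch :
  \int[rho]_(x in Phi) 'E_P[V x 0%R] =
  beta%:E * \int[rho]_(x in Phi) ((eta - x * m)^-1)%:E.
Proof.
pose e x := \int[P]_w W x 0%R w.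
rewrite (@integral_Phi _ (fun x => beta%:E * e x)) => [|x Gx]; last first.
  rewrite (expectation_cogarch m1fin _ (G_ge0 Gx) (G_rate Gx)) /e.
  by rewrite (expectation_growth m1fin _ (G_ge0 Gx) (G_rate Gx)).
rewrite (@integral_Phi (fun x => ((eta - x * m)^-1)%:E) e) => [|x Gx]; last first.
  by rewrite /e (expectation_growth m1fin _ (G_ge0 Gx) (G_rate Gx)).
rewrite ge0_integralZl//; last 3 first.
- apply: (@measurable_fun_fubini_tonelli_F _ _ (measurableTypeR R) T R P
    (fun x => W x.1 0%R x.2)) => [|x]; last exact: WW.
  by apply: (measurable_discounted_growth eta levL eps0).
- by move=> x _; apply: integral_ge0 => w _; exact: WW.
- by rewrite lee_fin ltW.
Qed.

Section second_order.
Hypothesis m2fin : m2 \is a fin_num.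
Hypothesis G_joint : forall x y, G x -> G y -> ((x + y) * m + x * y * v < 2 * eta)%R.
Variable C : R.
Hypothesis G_den : forall x, G x -> ((den x)^-1 <= C)%R.

Lemma expectation_cogarchM (x y : R) : G x -> G y ->
  'E_P[(fun w => V x 0%R w * V y 0%R w)%R] =
  (beta ^+ 2 * ((x + y) * m - 2 * eta) /
     ((x * m - eta) * (y * m - eta) * ((x + y) * m + x * y * v - 2 * eta)))%:E.
Proof.
move=> Gx Gy.
have [-> _] := cogarch_pair m1fin 0%R 0%R (G_ge0 Gx) (G_rate Gx) (G_ge0 Gy) (G_rate Gy).
rewrite (expectation_growthM m1fin m2fin (G_ge0 Gx) (G_rate Gx) (G_ge0 Gy) (G_rate Gy) (G_joint Gx Gy))//.
by rewrite subrr mul0r expR0 subrr mul0r addr0 mul1r mulrA.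
Qed.

Lemma covariance_cogarch (x y h : R) : G x -> G y -> (0 <= h)%R ->
  covariance P (V x 0%R) (V y h) =
  (expR (h * (y * m - eta)) * ((beta ^+ 2 * x * y * v) /
     ((x * m - eta) * (y * m - eta) * (2 * eta - (x + y) * m - x * y * v))))%:E.
Proof.
move=> Gx Gy h0.
have [_ ->] := cogarch_pair m1fin 0%R h (G_ge0 Gx) (G_rate Gx) (G_ge0 Gy) (G_rate Gy).
rewrite (expectation_growthM m1fin m2fin (G_ge0 Gx) (G_rate Gx) (G_ge0 Gy) (G_rate Gy) (G_joint Gx Gy))//.
rewrite subr0 -EFinB; congr EFin; rewrite /den.
have dx := G_rate Gx; have dy := G_rate Gy; have dxy := G_joint Gx Gy.
move: (expR _) => E; field.
by do ?[apply/andP; split]; apply/negP => /eqP; lra.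
Qed.

Let covariance_cogarch_ge0 (x y h : R) : G x -> G y -> (0 <= h)%R ->
  0 <= covariance P (V x 0%R) (V y h).
Proof.
move=> Gx Gy h0; rewrite covariance_cogarch// lee_fin.
have dx := G_rate Gx; have dy := G_rate Gy; have dxy := G_joint Gx Gy.
have v0 := variance_ge0 m1fin; have x0 := G_ge0 Gx; have y0 := G_ge0 Gy.
apply: mulr_ge0; first exact: expR_ge0.
apply: mulr_ge0; first by rewrite !mulr_ge0// ltW.
rewrite invr_ge0 mulr_ge0//; last lra.
by rewrite mulr_le0// subr_le0 ltW.
Qed.

Let M := \int[rho]_x mean_growth 0%R x.

Let mean_superposed t : \int[P]_w superposed_growth t w = M.
Proof.
rewrite expectation_superposed_growth; apply: integral_G => x Gx.
by rewrite -/(mean_growth t x) !mean_growthE.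
Qed.

(** The constant [C] bounds the means of all components at once, so the superposition has finite
    mean, at negative times as well. *)
Let M_fin : M = (fine M)%:E.
Proof.
rewrite fineK// ge0_fin_numE; last by apply: integral_ge0 => x _.
apply: (@le_lt_trans _ _ (beta * `|C|)%:E); last exact: ltry.
rewrite /M (@integral_G _ (fun x => if x \in G then (beta / den x)%:E else 0)) => [|x Gx]; last first.
  by rewrite ifT ?inE// mean_growthE.
rewrite -[leRHS](integral_prob_cst rho); apply: le_integral_of_le => x _; case: ifPn => //; rewrite ?inE => Gx.
- by rewrite lee_fin divr_ge0 ?ltW// den_gt0.
- rewrite lee_fin; apply: ler_wpM2l; first exact: ltW.
  exact: le_trans (G_den Gx) (ler_norm _).
- by rewrite lee_fin mulr_ge0// ltW.
Qed.

Let superposed_null t : exists A, [/\ measurable A, P A = 0 & forall w, ~ A w ->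
    (fine (supcogarch beta eta S Phi rho t w))%:E = superposed_growth t w].
Proof.
have UI : P.-integrable setT (superposed_growth t).
  apply/integrableP; split; first exact: measurable_superposed_growth.
  under eq_integral do rewrite (gee0_abs (superposed_growth_ge0 _ _)).
  by rewrite mean_superposed M_fin ltry.
have [A [mA A0 HA]] := integrable_ae measurableT UI.
apply: (@fine_supcogarch_null t A mA A0) => w Aw.
have Ufin : superposed_growth t w \is a fin_num.
  by apply: contrapT => Wn; apply: Aw; apply: HA => /(_ Logic.I).
by rewrite -(fineK Ufin) ltry.
Qed.

(** Stationarity at second order, read off the explicit formula, in which the two times enter only
    through their difference. *)
Let growthM_shift (x y t u : R) : G x -> G y -> (t <= u)%R ->
  \int[P]_w ((beta%:E * W x 0%R w) * (beta%:E * W y (u - t)%R w)) =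
  \int[P]_w ((beta%:E * W x t w) * (beta%:E * W y u w)).
Proof.
move=> Gx Gy tu; have h0 : (0 <= u - t)%R by rewrite subr_ge0.
have EM a b (ab : (a <= b)%R) := expectation_growthM m1fin m2fin (G_ge0 Gx)
  (G_rate Gx) (G_ge0 Gy) (G_rate Gy) (G_joint Gx Gy) ab.
by apply: (eq_trans (EM _ _ h0)); rewrite subr0; apply/esym; exact: EM.
Qed.

Notation Vbar := (fun t w => fine (supcogarch beta eta S Phi rho t w)).

Lemma expectation_supcogarchM t u : (t <= u)%R ->
  'E_P[(fun w => Vbar t w * Vbar u w)%R] =
  \int[rho]_(y in Phi) \int[rho]_(x in Phi) 'E_P[(fun w => V x 0%R w * V y (u - t) w)%R].
Proof.
move=> tu; have [A [mA A0 HA]] := superposed_null t.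
have [B [mB B0 HB]] := superposed_null u.
rewrite (@expectationM_null _ _ _ P (A `|` B) _ _ (Vbar t) (Vbar u) (superposed_growth t) (superposed_growth u)).
- rewrite expectation_superposed_growthM; apply/esym/integral_Phi => y Gy.
  apply: integral_Phi => x Gx.
  have [-> _] := cogarch_pair m1fin 0%R (u - t)%R (G_ge0 Gx) (G_rate Gx) (G_ge0 Gy) (G_rate Gy).
  exact: growthM_shift.
- exact: measurableU.
- exact: null_setU.
- by move=> w /not_orP[/HA].
- by move=> w /not_orP[_ /HB].
Qed.

Lemma covariance_supcogarch t u : (t <= u)%R ->
  covariance P (Vbar t) (Vbar u) =
  \int[rho]_(y in Phi) \int[rho]_(x in Phi) covariance P (V x 0%R) (V y (u - t)%R).
Proof.
move=> tu; have [A [mA A0 HA]] := superposed_null t.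
have [B [mB B0 HB]] := superposed_null u.
have mAB : measurable (A `|` B) by exact: measurableU.
have AB0 : P (A `|` B) = 0 by exact: null_setU.
have IM s : \int[P]_w superposed_growth s w = (fine M)%:E by rewrite mean_superposed -M_fin.
rewrite (covariance_null mAB AB0 (X' := superposed_growth t) (Y' := superposed_growth u) _ _ _ _ _ _ (IM t) (IM u)); first last.
- by move=> w; exact: superposed_growth_ge0.
- by move=> w; exact: superposed_growth_ge0.
- exact: measurable_superposed_growth.
- exact: measurable_superposed_growth.
- by move=> w /not_orP[_ /HB].
- by move=> w /not_orP[/HA].
pose e := mean_growth 0%R.
pose q (x y : R) := \int[P]_w ((beta%:E * W x t w) * (beta%:E * W y u w)).
(* The covariance is nonnegative on [G], so the absolute value agrees with it there, while on the
   whole plane it is a nonnegative jointly measurable function. *)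
pose c (x y : R) := `|q x y - e x * e y|.
have mq : measurable_fun setT (fun z : measurableTypeR R * measurableTypeR R => q z.1 z.2).
  apply: (@measurable_fun_fubini_tonelli_F _ _ (measurableTypeR R * measurableTypeR R)%type T R P
    (fun z => (beta%:E * W z.1.1 t z.2) * (beta%:E * W z.1.2 u z.2))) => [|z].
    apply: emeasurable_funM; apply: mbW => //.
      exact: (measurableT_comp measurable_fst measurable_fst).
    exact: (measurableT_comp measurable_snd measurable_fst).
  by rewrite mule_ge0.
have mc : measurable_fun setT (fun z : measurableTypeR R * measurableTypeR R => c z.1 z.2).
  apply: measurableT_comp; first exact: abse_measurable.
  apply: emeasurable_funB => //; apply: emeasurable_funM.
    exact: (measurableT_comp (measurable_mean_growth 0%R) measurable_fst).
  exact: (measurableT_comp (measurable_mean_growth 0%R) measurable_snd).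
have qE x y : G x -> G y -> covariance P (V x 0%R) (V y (u - t)%R) = q x y - e x * e y /\ e x * e y \is a fin_num.
  move=> Gx Gy; split; last by rewrite /e !mean_growthE// -EFinM.
  have [_ ->] := cogarch_pair m1fin 0%R (u - t)%R (G_ge0 Gx) (G_rate Gx) (G_ge0 Gy) (G_rate Gy).
  apply: (congr2 (fun a b => a - b)); first exact: growthM_shift.
  by rewrite /e (mean_growthE 0%R Gx) (mean_growthE 0%R Gy).
have covE x y : G x -> G y -> covariance P (V x 0%R) (V y (u - t)%R) = c x y.
  move=> Gx Gy; have [E _] := qE x y Gx Gy.
  by rewrite /c -E gee0_abs// covariance_cogarch_ge0// subr_ge0.
have cE x y : G x -> G y -> q x y = c x y + e x * e y.
  by move=> Gx Gy; have [E F] := qE x y Gx Gy; rewrite -covE// E subeK.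
have -> : \int[rho]_(y in Phi) \int[rho]_(x in Phi) covariance P (V x 0%R) (V y (u - t)%R) =
    \int[rho]_y \int[rho]_x c x y.
  by apply: integral_Phi => y Gy; apply: integral_Phi => x Gx; exact: covE.
have mc1 y : measurable_fun setT (fun x : measurableTypeR R => c x y).
  exact: (measurableT_comp mc (pair2_measurable y)).
have c0 x y : 0 <= c x y by exact: abse_ge0.
have e0 x : 0 <= e x by exact: mean_growth_ge0.
have me : measurable_fun setT (e : measurableTypeR R -> \bar R) by exact: measurable_mean_growth.
have mC : measurable_fun setT (fun y : measurableTypeR R => \int[rho]_x c x y).
  exact: (@measurable_fun_fubini_tonelli_G _ _ (measurableTypeR R) (measurableTypeR R) R rho
    (fun z => c z.1 z.2)).
have IeM k : 0 <= k -> \int[rho]_x (e x * k) = M * k.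
  move=> k0; rewrite muleC -ge0_integralZl//.
  by apply: eq_integral => x _; rewrite muleC.
have M0 : 0 <= M by apply: integral_ge0 => x _.
have eM : \int[rho]_x e x = M by [].
have QE : \int[P]_w (superposed_growth t w * superposed_growth u w) =
    \int[rho]_y \int[rho]_x q x y by exact: expectation_superposed_growthM.
clearbody c q e.
apply: (eq_trans (congr1 (fun a => a - (fine M * fine M)%:E) QE)).
(* Sums of nonnegative terms are integrated: a mixed moment is a covariance plus a product of means.
   The latter integrates to the finite number M^2, which can then be subtracted. *)
have -> : \int[rho]_y \int[rho]_x q x y =
    \int[rho]_y (\int[rho]_x c x y + M * e y).
  apply: integral_G => y Gy.
  rewrite (@integral_G _ (fun x => c x y + e x * e y)) => [|x Gx]; last exact: cE.
  rewrite ge0_integralD//; last 2 first.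
  - by move=> x _; rewrite mule_ge0.
  - by apply: emeasurable_funM.
  by rewrite IeM.
rewrite ge0_integralD//; last 3 first.
- by move=> y _; apply: integral_ge0 => x _.
- by move=> y _; rewrite mule_ge0.
- by apply: emeasurable_funM.
by rewrite ge0_integralZl// eM M_fin -EFinM addeK.
Qed.

End second_order.
End superposition.
End supcogarch_moments.

(** * Reduction to a process with cadlag paths *)

Lemma measure_eq_off_null d (T : measurableType d) (R : realType)
    (mu : {measure set T -> \bar R}) (A X Y : set T) :
  measurable A -> mu A = 0%E -> measurable X -> measurable Y ->
  (forall w, ~ A w -> X w <-> Y w) -> mu X = mu Y.
Proof.
move=> mA A0 mX mY XY; rewrite -(setIT X) -(setIT Y) -!integral_indic//.
apply: (eq_integral_null mA A0) => w Aw _; rewrite !indicE; congr (_%:R)%:E.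
by congr nat_of_bool; apply/idP/idP; rewrite !inE; apply XY.
Qed.

Lemma cadlag_cst (R : realType) (c : R) : cadlag (cst c : R -> R).
Proof. by move=> t; split; [exact: cvg_cst|exact: is_cvg_cst]. Qed.

(** Paths in a measurable null set are replaced by the zero path, which leaves the joint laws of the
    increments unchanged. *)
Lemma cadlag_modification d (T : measurableType d) (R : realType)
    (P : probability T R) (L : R -> {RV P >-> R}) : levy_process L ->
  exists (A : set T) (L' : R -> T -> R), [/\ measurable A, P A = 0%E,
    cadlag_levy P L' & forall w, ~ A w -> L' ^~ w = (fun t => L t w)].
Proof.
move=> levL; have [A [mA A0 HA]] := levy_cadlag levL.
pose L' t w : R := if w \in A then 0 else L t w.
have L'E w : ~ A w -> L' ^~ w = (fun t => L t w).
  by move=> Aw; apply/funext => t; rewrite /L' memNset.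
have L'A t w : ~ A w -> L' t w = L t w by move=> Aw; rewrite /L' memNset.
have mL' t : measurable_fun setT (L' t).
  apply: measurable_fun_ifT => //.
  by apply: (measurable_fun_bool true); rewrite setTI preimage_mem_true.
have mD (s t : R) (B : set R) (X : R -> T -> R) : (forall t, measurable_fun setT (X t)) ->
    measurable B -> measurable ((fun w => X t w - X s w) @^-1` B).
  move=> mX mB; rewrite -[X in measurable X]setTI.
  by apply: (measurable_funB (mX t) (mX s)).
have mL t : measurable_fun setT (L t) by [].
have L'D s t (B : set R) : measurable B ->
    P [set w | B (L' t w - L' s w)] = P [set w | B (L t w - L s w)].
  move=> mB; apply: (measure_eq_off_null mA A0).
  - exact: mD.
  - exact: (mD _ _ _ (fun t => L t)).
  - by move=> w Aw /=; rewrite !L'A.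
exists A, L'; split => //; split => //.
- move=> w; have [Aw|Aw] := pselect (A w).
    rewrite (_ : L' ^~ w = cst 0); first exact: cadlag_cst.
    by apply/funext => t; rewrite /L' mem_set.
  rewrite (L'E w Aw); apply: contrapT => nc; apply: Aw; exact: HA.
- move=> n t tm B mB.
  have := levy_independent levL tm mB.
  rewrite -(@measure_eq_off_null _ _ _ P A
    (\bigcap_(i in [set: 'I_n]) ((fun w => L' (t i.+1) w - L' (t i) w) @^-1` B i))) //.
  + move=> ->; apply: eq_bigr => i _; apply/esym; exact: L'D.
  + by apply: fin_bigcap_measurable => // i _; exact: mD.
  + by apply: fin_bigcap_measurable => // i _; exact: (mD _ _ _ (fun t => L t)).
  + by move=> w Aw; split => H i _ /=; have := H i Logic.I; rewrite /= !L'A.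
- move=> s t h B st mB; rewrite !L'D//.
  exact: (levy_stationary levL h st mB).
Qed.

Section model.
Local Open Scope ereal_scope.
Context d (T : measurableType d) (R : realType) (P : probability T R).
Variables (L : R -> {RV P >-> R}) (beta eta : R).
Hypothesis levL : levy_process L.

(* eps is 1 when the squared jumps are summable and 0 otherwise. *)
Lemma cogarch_model : exists (L' : R -> T -> R) (eps : R) (N : set T),
  [/\ (0 <= eps)%R, cadlag_levy P L', measurable N, P N = 0 &
   forall w, ~ N w ->
   [/\ forall a b, jump_sum (L' ^~ w) (fun y => eps * y ^+ 2)%R a b < +oo,
     (subordinator L 1%R w)%:E = jump_sum (L' ^~ w) (fun y => eps * y ^+ 2)%R 0%R 1%R &
     forall phi t, (0 <= phi)%R -> cogarch beta eta (subordinator L) phi t w =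
       beta%:E * discounted_growth L' eta eps phi t w]].
Proof.
have [A [L' [mA A0 levL' L'E]]] := cadlag_modification levL.
have [B [mB B0 dich]] := sum_square_jumps_dichotomy levL'.
have sE w t : ~ A w -> subordinator L t w = subordinator L' t w.
  by move=> Aw; rewrite /subordinator (L'E w Aw).
have cE w phi t : ~ A w -> cogarch beta eta (subordinator L) phi t w =
    cogarch beta eta (subordinator L') phi t w.
  move=> Aw; rewrite /cogarch /cogarch_exponent.
  by rewrite (_ : (fun u => subordinator L u w) = (fun u => subordinator L' u w))//;
    apply/funext => u; exact: sE.
have mN : measurable (A `|` B) by exact: measurableU.
have N0 : P (A `|` B) = 0 by exact: null_setU.
have sqD a b w : jump_sum (L' ^~ w) (fun y => 0 * y ^+ 2)%R a b = 0.
  by rewrite /jump_sum esum1// => u _; rewrite mul0r.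
have one : (fun y : R => 1 * y ^+ 2)%R = (fun y => y ^+ 2)%R.
  by apply/funext => y; rewrite mul1r.
case: dich => [fin|inf].
  exists L', 1%R, (A `|` B); split => // w /not_orP[Aw Bw].
  have finw a b : jump_sum (L' ^~ w) (fun y => 1 * y ^+ 2)%R a b < +oo.
    by rewrite one; exact: fin.
  split => // [|phi t phi0].
    rewrite sE// subordinatorE /two_sided_sum ler01.
    rewrite one fineK// ge0_fin_numE ?fin//.
    by apply: jump_sum_ge0 => y; exact: sqr_ge0.
  rewrite cE// (@cogarchE _ _ _ w _ _ 1%R)// ?discounted_growthE// => u.
  by rewrite mul1r; apply: jump_subordinator; exact: fin.
exists L', 0%R, (A `|` B); split => // w /not_orP[Aw Bw].
have finw a b : jump_sum (L' ^~ w) (fun y => 0 * y ^+ 2)%R a b < +oo by rewrite sqD.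
have s0 := subordinator_infinite (inf w Bw).
split => // [|phi t phi0].
  by rewrite sqD sE// [subordinator _ _ _](congr1 (fun f => f 1%R) s0).
rewrite cE// (@cogarchE _ _ _ w _ _ 0%R)// ?discounted_growthE// => u.
by rewrite s0 jump_cst0 mul0r.
Qed.

End model.

(** A vanishing sum of squares has vanishing terms. For the jumps of the subordinator this says that
    zero variance forces zero mean, as [rate_gap_inv_le] requires. *)
Lemma jump_intensity_sqr_eq0 d (T : measurableType d) (R : realType)
    (P : probability T R) (L : R -> T -> R) (g : R -> R) :
  cadlag_levy P L -> admissible g ->
  jump_intensity P L (fun y => g y ^+ 2) = 0%E -> jump_intensity P L g = 0%E.
Proof.
move=> levL ag I0; have ag2 := admissible_sqr ag.
have mJ := measurable_levy_jump_sum levL 0 1 ag2.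
have g0 y : 0 <= g y by case: ag.
have : (\int[P]_w `|jump_sum (L ^~ w) (fun y => g y ^+ 2)%R 0%R 1%R| = 0)%E.
  rewrite -I0; apply: eq_integral => w _; rewrite gee0_abs//.
  by apply: jump_sum_ge0 => y; exact: sqr_ge0.
move=> /(ae_eq_integral_abs P measurableT mJ)[A [mA A0 HA]].
rewrite /jump_intensity -(integral0 P setT).
apply: (eq_integral_null mA A0) => w Aw _.
have J0 : jump_sum (L ^~ w) (fun y => g y ^+ 2) 0 1 = 0%E.
  by apply: contrapT => J0; apply: Aw; apply: HA => /(_ Logic.I).
rewrite /jump_sum esum1// => u /= u01; congr EFin; apply/eqP.
have := @jump_sum_ge_seq _ (L ^~ w) (fun y => g y ^+ 2) 0 1 [:: u] (fun y => sqr_ge0 _) isT.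
rewrite big_seq1 J0 lee_fin => H; rewrite -sqrf_eq0 eq_le sqr_ge0 andbT; apply: H => x.
by rewrite inE => /eqP ->.
Qed.

(** Such a set is an interval, possibly empty; [cogarch_set] and the moment sets are of this
    kind. *)
Lemma down_closed_measurable (R : realType) (A : set R) :
  (forall x, A x -> 0 <= x) -> (forall x y, A y -> 0 <= x -> x <= y -> A x) ->
  measurable (A : set (measurableTypeR R)).
Proof.
move=> A0 Ad; apply: is_interval_measurable => x y Ax Ay z /andP[xz zy].
by apply: (Ad z y) => //; exact: le_trans (A0 _ Ax) xz.
Qed.

Section parameter_sets.
Local Open Scope ereal_scope.
Context d (T : measurableType d) (R : realType) (P : probability T R).
Variables (beta eta : R) (S : R -> T -> R) (nuS : set (measurableTypeR R) -> \bar R).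

Lemma measurable_cogarch_set : measurable (cogarch_set eta nuS).
Proof.
apply: down_closed_measurable => [x []//|x y [y0 ylt] x0 xy]; split => //.
apply: le_lt_trans ylt; apply: le_integral_of_le => z /= z0; rewrite lee_fin.
  by rewrite ln_ge0// lerDl mulr_ge0// ltW.
have zx : (0 <= x * z)%R by rewrite mulr_ge0// ltW.
have zy : (x * z <= y * z)%R by rewrite ler_pM2r.
by rewrite ler_ln ?posrE; lra.
Qed.

Lemma measurable_cogarch_moment_set kappa :
  measurable (cogarch_moment_set P beta eta S nuS kappa).
Proof.
apply: down_closed_measurable => [x []//|x y [y0 ylt] x0 xy]; split => //.
by apply: le_lt_trans ylt; rewrite lee_fin.
Qed.

Lemma cogarch_moment_set_gt kappa x : cogarch_moment_set P beta eta S nuS kappa x ->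
  exists psi, [/\ (0 <= x)%R, (x < psi)%R &
    \int[P]_w poweR (cogarch beta eta S psi 0%R w) kappa < +oo].
Proof.
move=> [x0 /ereal_sup_gt[_ [psi [_ fin] <-]]]; rewrite lte_fin => xpsi.
by exists psi.
Qed.

End parameter_sets.

(** * Inequalities between the rates *)

Section rate_bounds.
Context {R : realType}.
Variables (eta m v : R).
Hypotheses (eta0 : 0 < eta) (m0 : 0 <= m) (v0 : 0 <= v).
Implicit Types x y a b : R.

(** The average of the two diagonal inequalities at [a] and [b], through 2 a b <= a^2 + b^2. *)
Lemma joint_rate_lt x y a b : 0 <= x -> x < a -> 0 <= y -> y < b ->
  (a + a) * m + a * a * v < 2 * eta -> (b + b) * m + b * b * v < 2 * eta ->
  (x + y) * m + x * y * v < 2 * eta.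
Proof.
move=> x0 xa y0 yb ha hb.
have xm : x * m <= a * m by rewrite ler_wpM2r// ltW.
have ym : y * m <= b * m by rewrite ler_wpM2r// ltW.
have xy : x * y <= a * b by apply: ler_pM => //; exact: ltW.
have ab : 2 * (a * b) <= a * a + b * b by have := sqr_ge0 (a - b); rewrite sqrrB; lra.
have xyv : 2 * (x * y * v) <= (a * a + b * b) * v.
  by rewrite mulrA ler_wpM2r//; lra.
by rewrite mulrDl in ha hb *; lra.
Qed.

(** Each summand of the bound covers one case. If x m <= eta / 2, the gap is at least eta / 2.
    Otherwise x > eta / (2 m), and x^2 v < 2 (eta - x m) makes the gap at least eta^2 v / (8 m^2);
    here m > 0, so that v > 0. *)
Lemma rate_gap_inv_le x : 0 <= x -> x * m < eta -> (v = 0 -> m = 0) ->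
  (x + x) * m + x * x * v < 2 * eta ->
  (eta - x * m)^-1 <= 2 / eta + 8 * m ^+ 2 / (eta ^+ 2 * v).
Proof.
move=> x0 xm vm hx; set D := eta - x * m; have D0 : 0 < D by rewrite subr_gt0.
have t1 : 0 <= 2 / eta by rewrite divr_ge0// ltW.
have t2 : 0 <= 8 * m ^+ 2 / (eta ^+ 2 * v).
  by apply: divr_ge0; apply: mulr_ge0 => //; exact: sqr_ge0.
have [h|h] := leP (x * m) (eta / 2).
  apply: (@le_trans _ _ (2 / eta)); last by rewrite lerDl.
  by rewrite -[leRHS]invf_div lef_pV2 ?posrE ?divr_gt0// /D; lra.
have mn0 : m != 0 by apply/negP => /eqP mz; move: h; rewrite mz mulr0 ltNge divr_ge0// ltW.
have vp : 0 < v by rewrite lt_def v0 andbT; apply/negP => /eqP/vm/eqP; exact/negP.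
apply: (@le_trans _ _ (8 * m ^+ 2 / (eta ^+ 2 * v))); last by rewrite lerDr.
have mp : 0 < m by rewrite lt_def mn0.
have p1 : 0 < eta ^+ 2 * v by rewrite mulr_gt0// exprn_gt0.
have p2 : 0 < 8 * m ^+ 2 by rewrite mulr_gt0// exprn_gt0.
rewrite -[leRHS]invf_div lef_pV2 ?posrE ?divr_gt0// ler_pdivrMr//.
have q1 : eta ^+ 2 <= 4 * (x * m) ^+ 2.
  rewrite (_ : 4 * _ = (2 * (x * m)) ^+ 2); last by rewrite exprMn; lra.
  by rewrite ler_sqr ?nnegrE ?ltW//; lra.
have q2 : x * x * v <= 2 * D by rewrite /D; lra.
apply: (@le_trans _ _ (4 * (x * m) ^+ 2 * v)); first by rewrite ler_wpM2r.
rewrite (_ : 4 * (x * m) ^+ 2 * v = (x * x * v) * (4 * m ^+ 2)); last by ring.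
rewrite (_ : D * (8 * m ^+ 2) = (2 * D) * (4 * m ^+ 2)); last by ring.
by rewrite ler_wpM2r// mulr_ge0// sqr_ge0.
Qed.

End rate_bounds.

Lemma probability1_nonempty d (T : measurableType d) (R : realType)
    (P : probability T R) (A : set T) : P A = 1%E -> exists x, A x.
Proof.
move=> A1; apply/set0P/negP => /eqP A0; move: A1; rewrite A0 measure0 => /eqP.
by rewrite eq_sym onee_eq0.
Qed.

Theorem proposition3p12 (d : measure_display) (T : measurableType d)
    (R : realType) (P : probability T R) (beta eta : R)
    (L : R -> {RV P >-> R})
    (nuL : {measure set (measurableTypeR R) -> \bar R})
    (rho : probability (measurableTypeR R) R) :
  0 < beta -> 0 < eta ->
  levy_process L -> is_levy_measure L nuL ->
  let S : R -> T -> R := subordinator L in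
  let nuS := squared_jump_measure nuL in
  let Phi := cogarch_set eta nuS in
  let PhiK := cogarch_moment_set P beta eta S nuS in
  let V (phi t : R) (w : T) : R := fine (cogarch beta eta S phi t w) in
  let Vbar (t : R) (w : T) : R := fine (supcogarch beta eta S Phi rho t w) in
  let m : R := fine ('E_P[(S 1)%R])%E in
  let v : R := fine ('V_P[(S 1)%R])%E in
  rho Phi = 1%E ->
  {ae P, forall w, (supcogarch beta eta S Phi rho 0 w < +oo)%E} ->
  (rho (PhiK 1) = 1%E ->
    forall t : R, 0 <= t ->
      ('E_P[Vbar t] = \int[rho]_(x in Phi) 'E_P[V x 0%R])%E /\
      (\int[rho]_(x in Phi) 'E_P[V x 0%R] =
       beta%:E * \int[rho]_(x in Phi) ((eta - x * m)^-1)%R%:E)%E) /\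
  (rho (PhiK 2) = 1%E ->
    (forall t h : R, 0 <= h ->
      [/\ ('E_P[(Vbar t ^+ 2)%R] =
           \int[rho]_(y in Phi) \int[rho]_(x in Phi) 'E_P[(V x 0 * V y 0)%R])%E,
          ('V_P[Vbar t] =
           \int[rho]_(y in Phi) \int[rho]_(x in Phi)
             covariance P (V x 0%R) (V y 0%R))%E
        & (covariance P (Vbar t) (Vbar (t + h)%R) =
           \int[rho]_(y in Phi) \int[rho]_(x in Phi)
             covariance P (V x 0%R) (V y h))%E]) /\
    (forall x y : R, PhiK 2 x -> PhiK 2 y ->
      ('E_P[(V x 0 * V y 0)%R])%E =
        (beta ^+ 2 * ((x + y) * m - 2 * eta) /
         ((x * m - eta) * (y * m - eta) *
          ((x + y) * m + x * y * v - 2 * eta)))%:E /\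
      forall h : R, 0 <= h ->
        covariance P (V x 0) (V y h) =
          (expR (h * (y * m - eta)) *
           ((beta ^+ 2 * x * y * v) /
            ((x * m - eta) * (y * m - eta) *
             (2 * eta - (x + y) * m - x * y * v))))%:E)).
Proof.
move=> beta0 eta0 levL _ S nuS Phi PhiK V Vbar m v rhoPhi fin0.
have [L' [eps [N [eps0 levL' mN N0 model]]]] := cogarch_model beta eta levL.
have finS w (Nw : ~ N w) := let: And3 H _ _ := model w Nw in H.
have S1E w (Nw : ~ N w) := let: And3 _ H _ := model w Nw in H.
have growth w (Nw : ~ N w) := let: And3 _ _ H := model w Nw in H.
have mPhi : measurable Phi := measurable_cogarch_set eta nuS.
have mPhiK k : measurable (PhiK k) := measurable_cogarch_moment_set P beta eta S nuS k.
have Phi_ge0 x : Phi x -> 0 <= x by case.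
have PhiK_ge0 k x : PhiK k x -> 0 <= x by case.
have m0 : 0 <= m := mean_ge0 eps0 mN N0 S1E.
have PhiK_gt k x (Kx : PhiK k x) := cogarch_moment_set_gt Kx.
split.
  move=> rhoK t t0.
  (* A point of the moment set lies strictly below some [psi0] with a finite moment; then
     [psi0 > 0], which makes the mean of [S 1] finite. *)
  have [x0 /PhiK_gt[psi0 [x00 xpsi0 fin1]]] := probability1_nonempty rhoK.
  have [m1fin _] := moment1_rate beta0 eps0 levL' mN N0 S1E growth (le_lt_trans x00 xpsi0) fin1.
  have K_rate x : PhiK 1 x -> x * m < eta.
    move=> /PhiK_gt[psi [xge0 xpsi finpsi]].
    have [_ pm] := moment1_rate beta0 eps0 levL' mN N0 S1E growth (le_lt_trans xge0 xpsi) finpsi.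
    by apply: le_lt_trans pm; rewrite ler_wpM2r// ltW.
  have [A [mA A0 HA]] := fin0.
  have NA0 : P (N `|` A) = 0%E by exact: null_setU.
  have fin0' w : ~ (N `|` A) w -> (superposed_growth L' beta eta eps rho 0 w < +oo)%E.
    move=> /not_orP[Nw Aw].
    rewrite -(supcogarch_growth growth mPhi rhoPhi Phi_ge0)//.
    by apply: contrapT => H; apply: Aw; exact: HA.
  have [B [mB B0 HB]] := superposed_growth_finite beta0 eta0 eps0 levL' mN N0 finS S1E
    (mPhiK 1) rhoK m1fin (PhiK_ge0 1) K_rate t0 (measurableU _ _ mN mA) NA0 fin0'.
  split; last exact: (integral_expectation_cogarch beta0 eps0 levL' mN N0 S1E growth
    mPhi (mPhiK 1) rhoPhi rhoK m1fin (PhiK_ge0 1) K_rate).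
  exact: (expectation_supcogarch beta0 eps0 levL' mN N0 S1E growth
    mPhi (mPhiK 1) rhoPhi rhoK Phi_ge0 m1fin (PhiK_ge0 1) K_rate mB B0 HB).
move=> rhoK.
have rates psi (psi0 : 0 < psi) := moment2_rate beta0 eps0 levL' mN N0 S1E growth psi0.
have [x0 /PhiK_gt[psi0 [x00 xpsi0 fin1]]] := probability1_nonempty rhoK.
have [m1fin m2fin _ _] := rates _ (le_lt_trans x00 xpsi0) fin1.
have v0 : 0 <= v := variance_ge0 eps0 levL' mN N0 S1E m1fin.
(* The variance is the intensity of the squared jumps of the subordinator, so its vanishing leaves
   almost surely no jumps and hence no mean. *)
have vm : v = 0 -> m = 0.
  rewrite /v /m (variance_subordinator eps0 levL' mN N0 S1E m1fin).
  rewrite (expectation_subordinator mN N0 S1E) => vz.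
  by rewrite (jump_intensity_sqr_eq0 levL' (admissible_jump_size eps0))// -(fineK m2fin) vz.
have K_rate x : PhiK 2 x -> x * m < eta.
  move=> /PhiK_gt[psi [xge0 xpsi /(rates _ (le_lt_trans xge0 xpsi))[_ _ pm _]]].
  by apply: le_lt_trans pm; rewrite ler_wpM2r// ltW.
(* Finite second moments are known for single parameters a > x and b > y; the mixed rate is obtained
   from these two diagonal ones. *)
have K_joint x y : PhiK 2 x -> PhiK 2 y -> (x + y) * m + x * y * v < 2 * eta.
  move=> /PhiK_gt[a [xge0 xa /(rates _ (le_lt_trans xge0 xa))[_ _ _ ha]]].
  move=> /PhiK_gt[b [yge0 yb /(rates _ (le_lt_trans yge0 yb))[_ _ _ hb]]].
  exact: joint_rate_lt ha hb.
have K_den x : PhiK 2 x -> (eta - x * m)^-1 <= 2 / eta + 8 * m ^+ 2 / (eta ^+ 2 * v).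
  by move=> Kx; apply: rate_gap_inv_le => //; [exact: PhiK_ge0 Kx|exact: K_rate|exact: K_joint].
split => [t h h0|x y Kx Ky].
  have cov s u (su : s <= u) := covariance_supcogarch beta0 eps0 levL' mN N0 S1E growth
    mPhi (mPhiK 2) rhoPhi rhoK Phi_ge0 m1fin (PhiK_ge0 2) K_rate m2fin K_joint K_den su.
  split.
  - have := expectation_supcogarchM beta0 eps0 levL' mN N0 S1E growth
      mPhi (mPhiK 2) rhoPhi rhoK Phi_ge0 m1fin (PhiK_ge0 2) K_rate m2fin K_joint K_den (lexx t).
    by rewrite subrr.
  - by have := cov t t (lexx t); rewrite subrr.
  - by have := cov t (t + h) _; rewrite lerDl addrAC subrr add0r; apply.
split.
  exact: (expectation_cogarchM beta0 eps0 levL' mN N0 S1E growth m1fin (PhiK_ge0 2) K_rate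
    m2fin K_joint Kx Ky).
move=> h h0.
exact: (covariance_cogarch beta0 eps0 levL' mN N0 S1E growth m1fin (PhiK_ge0 2) K_rate
  m2fin K_joint Kx Ky h0).
Qed.
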